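(* $E_{K_\sigma}$ is Borel reducible to bi-embeddability of unital AF algebras. That is, there is a Borel map $\Phi:\mathbb N^{\mathbb N}\to\Gamma$ such that $C^*(\Phi(f))$ is a unital AF algebra for every $f\in\mathbb N^{\mathbb N}$ and, for all $f,g\in\mathbb N^{\mathbb N}$, $f\,E_{K_\sigma}\,g$ if and only if $C^*(\Phi(f))$ and $C^*(\Phi(g))$ are bi-embeddable.
   Context: $E_{K_\sigma}$, the complete $K_\sigma$ equivalence relation, is the equivalence relation $=^\infty$ on $\mathbb N^{\mathbb N}$ given by: $f\le^\infty g$ iff $(\exists m)(\forall i)\ f(i)\le g(i)+m$; and $f=^\infty g$ iff $f\le^\infty g$ and $g\le^\infty f$. C$^*$-algebras $A,B$ are bi-embeddable if there exist $*$-monomorphisms $A\to B$ and $B\to A$. Let $H$ be a separable infinite-dimensional complex Hilbert space. $\mathcal B(H)$ carries the Borel structure generated by the weakly open sets and $\Gamma=\mathcal B(H)^{\mathbb N}$ carries the product Borel structure. For $\gamma\in\Gamma$, $C^*(\gamma)\subseteq\mathcal B(H)$ is the C$^*$-algebra generated by the terms of $\gamma$. A separable AF algebra is a C$^*$-algebra that is a direct limit of a sequence of finite-dimensional C$^*$-algebras. *)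

(* Defs.v *)
(* The scalars are R[i] with R : realType. Norms of normed modules over R[i]
   take their values in R[i], where a <= b implies that b - a is real. *)
From HB Require Import structures.
From mathcomp Require Import all_boot all_order all_algebra.
From mathcomp Require Import complex sesquilinear.
From mathcomp Require Import all_classical all_reals all_analysis.
From mathcomp Require Import ring lra.
Set Implicit Arguments.
Unset Strict Implicit.
Unset Printing Implicit Defensive.
Import Order.TTheory GRing.Theory Num.Theory.
Import numFieldNormedType.Exports.
Local Open Scope classical_set_scope.
Local Open Scope ring_scope.
Local Open Scope complex_scope.

(* A C*-algebra need not have a unit, whereas MathComp rings do; hence the
   product cmul is not the multiplication of a ring structure. *)
HB.mixin Record isCstarAlgebra (R : realType) A & CompleteNormedModule R[i] A := {
  cmul : A -> A -> A;
  cadj : A -> A;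
  cmulA : associative cmul;
  cmulDl : forall x y z, cmul (x + y) z = cmul x z + cmul y z;
  cmulDr : forall x y z, cmul x (y + z) = cmul x y + cmul x z;
  cmulZl : forall (a : R[i]) x y, cmul (a *: x) y = a *: cmul x y;
  cmulZr : forall (a : R[i]) x y, cmul x (a *: y) = a *: cmul x y;
  cadjK : involutive cadj;
  cadjD : {morph cadj : x y / x + y};
  cadjZ : forall (a : R[i]) x, cadj (a *: x) = Num.conj a *: cadj x;
  cadjM : forall x y, cadj (cmul x y) = cmul (cadj y) (cadj x);
  cnormM : forall x y, `|cmul x y| <= `|x| * `|y|;
  cnormE : forall x, `|cmul (cadj x) x| = `|x| ^+ 2
}.

#[short(type="cstarAlgType")]
HB.structure Definition CstarAlgebra (R : realType) :=
  {A of isCstarAlgebra R A & CompleteNormedModule R[i] A}.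

Section CstarTheory.
Variables (R : realType) (A : cstarAlgType R).
Implicit Types x y : A.

Lemma cmul0l x : cmul 0 x = 0.
Proof. by rewrite -{1}(scale0r (0 : A)) cmulZl scale0r. Qed.

Lemma cmul0r x : cmul x 0 = 0.
Proof. by rewrite -{1}(scale0r (0 : A)) cmulZr scale0r. Qed.

Lemma cadj0 : cadj (0 : A) = 0.
Proof. by rewrite -{1}(scale0r (0 : A)) cadjZ conjC0 scale0r. Qed.

Lemma cmulNl x y : cmul (- x) y = - cmul x y.
Proof. by rewrite -scaleN1r cmulZl scaleN1r. Qed.

Lemma cmulNr x y : cmul x (- y) = - cmul x y.
Proof. by rewrite -scaleN1r cmulZr scaleN1r. Qed.

Lemma cadjN x : cadj (- x) = - cadj x.
Proof. by rewrite -scaleN1r cadjZ rmorphN1 scaleN1r. Qed.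

End CstarTheory.

(* *-homomorphisms, and hence *-monomorphisms, are not required to preserve
   units. *)
Definition star_hom (R : realType) (A B : cstarAlgType R) (f : A -> B) : Prop :=
  [/\ linear f, {morph f : x y / cmul x y >-> cmul x y}
    & {morph f : x / cadj x >-> cadj x}].

Definition star_mono (R : realType) (A B : cstarAlgType R) (f : A -> B) : Prop :=
  star_hom f /\ injective f.

Definition bi_embeddable (R : realType) (A B : cstarAlgType R) : Prop :=
  (exists f : A -> B, star_mono f) /\ (exists g : B -> A, star_mono g).

Definition unital (R : realType) (A : cstarAlgType R) : Prop :=
  exists e : A, forall x : A, cmul e x = x /\ cmul x e = x.

Definition finite_dim (K : pzRingType) (V : lmodType K) : Prop :=
  exists (n : nat) (v : 'I_n -> V),
    forall x : V, exists c : 'I_n -> K, x = \sum_(i < n) c i *: v i.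

Definition cocone (R : realType) (A : nat -> cstarAlgType R)
    (phi : forall n, A n -> A n.+1) (B : cstarAlgType R)
    (mu : forall n, A n -> B) : Prop :=
  forall n, star_hom (mu n) /\ forall x : A n, mu n.+1 (phi n x) = mu n x.

(* Universal property of the direct limit of
   A 0 --phi 0--> A 1 --phi 1--> ... in the category of C*-algebras and
   *-homomorphisms. *)
Definition direct_limit (R : realType) (A : nat -> cstarAlgType R)
    (phi : forall n, A n -> A n.+1) (L : cstarAlgType R)
    (mu : forall n, A n -> L) : Prop :=
  cocone phi mu /\
  forall (B : cstarAlgType R) (lam : forall n, A n -> B), cocone phi lam ->
    exists! psi : L -> B,
      star_hom psi /\ forall n (x : A n), psi (mu n x) = lam n x.

Definition AF (R : realType) (L : cstarAlgType R) : Prop :=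
  exists (A : nat -> cstarAlgType R) (phi : forall n, A n -> A n.+1)
         (mu : forall n, A n -> L),
    [/\ forall n, finite_dim (A n), forall n, star_hom (phi n)
      & direct_limit phi mu].

Record is_cstar_subalg (R : realType) (A : cstarAlgType R) (S : set A) : Prop :=
  IsCstarSubalg {
    csubZD : forall (a : R[i]) x y, S x -> S y -> S (a *: x + y);
    csub0 : S 0;
    csubM : forall x y, S x -> S y -> S (cmul x y);
    csub_adj : forall x, S x -> S (cadj x);
    csub_closed : closed S
  }.

Structure cstarSubalg (R : realType) (A : cstarAlgType R) := CstarSubalg {
  csub_carrier : set A;
  csub_subproof : is_cstar_subalg csub_carrier
}.

Definition csub_pred (R : realType) (A : cstarAlgType R) (S : cstarSubalg A)
  : {pred A} := mem (csub_carrier S).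

Record csub_type (R : realType) (A : cstarAlgType R) (S : cstarSubalg A) :=
  CsubType { csub_val : A; csub_valP : csub_val \in csub_pred S }.

Arguments csub_val {R A S}.

(* A C*-subalgebra, as a C*-algebra in its own right. *)
Section CsubType.
Variables (R : realType) (A : cstarAlgType R) (S : cstarSubalg A).
Local Notation T := (csub_type S).

Lemma csub_submod_closed : submod_closed (csub_pred S).
Proof.
have [SZD S0 _ _ _] := csub_subproof S.
split; first exact: mem_set.
by move=> a x y /set_mem Sx /set_mem Sy; apply/mem_set/SZD.
Qed.

HB.instance Definition _ :=
  GRing.isSubmodClosed.Build R[i] A (csub_pred S) csub_submod_closed.
HB.instance Definition _ := [isSub of T for @csub_val R A S].
HB.instance Definition _ := [Choice of T by <:].
HB.instance Definition _ := [SubChoice_isSubLmodule of T by <:].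

Let norm (x : T) : R[i] := `|csub_val x|.

Let norm_triangle x y : norm (x + y) <= norm x + norm y.
Proof. exact: ler_normD. Qed.

Let norm_scale (a : R[i]) x : norm (a *: x) = `|a| * norm x.
Proof. exact: normrZ. Qed.

Let norm_eq0 x : norm x = 0 -> x = 0.
Proof. by move/normr0_eq0 => x0; apply/val_inj. Qed.

HB.instance Definition _ :=
  Lmodule_isNormed.Build R[i] T norm_triangle norm_scale norm_eq0.

Lemma csub_normE (x : T) : `|x| = `|csub_val x|.
Proof. by []. Qed.

Let complete (F : set_system T) : ProperFilter F -> cauchy F -> cvg F.
Proof.
move=> FF /cauchy_ballP Fc.
pose G := csub_val @ F.
have cG : cauchy G.
  apply/cauchy_ballP => e e0; have [[P Q] /= [FP FQ] PQ] := Fc e e0.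
  exists (csub_val @` P, csub_val @` Q) => [|[_ _] [/= [x Px <-] [y Qy <-]]].
    by split; [apply: filterS FP => x Px|apply: filterS FQ => x Px]; exists x.
  by have := PQ (x, y) (conj Px Qy); rewrite -!ball_normE.
have Gc : csub_val @ F --> lim G by exact: cauchy_cvg.
have FS : \forall x \near F, csub_carrier S (csub_val x).
  by apply: nearW => x; exact: (set_mem (csub_valP x)).
have Sl := @closed_cvg _ _ F FF csub_val (csub_carrier S)
  (csub_closed (csub_subproof S)) FS (lim G) Gc.
apply/cvg_ex; exists (CsubType (mem_set Sl)).
apply/cvgrPdist_lt => e e0.
by move/cvgrPdist_lt : Gc => /(_ e e0).
Qed.

HB.instance Definition _ := Uniform_isComplete.Build T complete.

Let mul (x y : T) : T := CsubType (mem_set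
  (csubM (csub_subproof S) (set_mem (csub_valP x)) (set_mem (csub_valP y)))).
Let adj (x : T) : T := CsubType (mem_set
  (csub_adj (csub_subproof S) (set_mem (csub_valP x)))).

Let mulA : associative mul.
Proof. by move=> x y z; apply/val_inj/cmulA. Qed.
Let mulDl x y z : mul (x + y) z = mul x z + mul y z.
Proof. exact/val_inj/cmulDl. Qed.
Let mulDr x y z : mul x (y + z) = mul x y + mul x z.
Proof. exact/val_inj/cmulDr. Qed.
Let mulZl (a : R[i]) x y : mul (a *: x) y = a *: mul x y.
Proof. exact/val_inj/cmulZl. Qed.
Let mulZr (a : R[i]) x y : mul x (a *: y) = a *: mul x y.
Proof. exact/val_inj/cmulZr. Qed.
Let adjK : involutive adj.
Proof. by move=> x; apply/val_inj/cadjK. Qed.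
Let adjD : {morph adj : x y / x + y}.
Proof. by move=> x y; apply/val_inj/cadjD. Qed.
Let adjZ (a : R[i]) x : adj (a *: x) = Num.conj a *: adj x.
Proof. exact/val_inj/cadjZ. Qed.
Let adjM x y : adj (mul x y) = mul (adj y) (adj x).
Proof. exact/val_inj/cadjM. Qed.
Let normM x y : `|mul x y| <= `|x| * `|y|.
Proof. exact: cnormM. Qed.
Let normE x : `|mul (adj x) x| = `|x| ^+ 2.
Proof. exact: cnormE. Qed.

HB.instance Definition _ := isCstarAlgebra.Build R T mulA mulDl mulDr mulZl
  mulZr adjK adjD adjZ adjM normM normE.

End CsubType.

Section Generated.
Variables (R : realType) (A : cstarAlgType R) (gen : nat -> A).

Lemma smallest_cstar_subalg :
  is_cstar_subalg (smallest (@is_cstar_subalg R A) (range gen)).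
Proof.
split.
- by move=> a x y Sx Sy S MS; apply: csubZD; [case: MS | exact: Sx | exact: Sy].
- by move=> S [MS _]; exact: csub0.
- by move=> x y Sx Sy S MS; apply: csubM; [case: MS | exact: Sx | exact: Sy].
- by move=> x Sx S MS; apply: csub_adj; [case: MS | exact: Sx].
- by apply: closed_bigI => S [/csub_closed].
Qed.

Definition cstar_generated : cstarSubalg A := CstarSubalg smallest_cstar_subalg.

End Generated.

(* hdot is linear in its first argument and conjugate-linear in the second. *)
HB.mixin Record isHilbert (R : realType) H & CompleteNormedModule R[i] H := {
  hdot : {dot H for Num.conj};
  hdot_norm : forall x : H, `|x| ^+ 2 = hdot x x
}.

#[short(type="hilbertType")]
HB.structure Definition Hilbert (R : realType) :=
  {H of isHilbert R H & CompleteNormedModule R[i] H}.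


Lemma normC_Re (R : realType) (z : R[i]) : `|z| = (complex.Re `|z|)%:C.
Proof. by rewrite normc_def. Qed.

Lemma Re_normC_ge0 (R : realType) (z : R[i]) : 0 <= complex.Re `|z|.
Proof. by rewrite normc_def sqrtr_ge0. Qed.

Section RealNorm.
Variables (R : realType) (V : normedModType R[i]).
Implicit Types x y : V.

Definition rnorm x : R := complex.Re `|x|.

Lemma rnormE x : `|x| = (rnorm x)%:C.
Proof. by rewrite /rnorm RRe_real// normr_real. Qed.

Lemma rnorm_ge0 x : 0 <= rnorm x.
Proof. by rewrite -lecR -rnormE normr_ge0. Qed.

Lemma rnorm0 : rnorm 0 = 0.
Proof. by rewrite /rnorm normr0. Qed.

Lemma rnorm_eq0 x : rnorm x = 0 -> x = 0.
Proof. by move=> x0; apply: normr0_eq0; rewrite rnormE x0. Qed.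

Lemma rnormD x y : rnorm (x + y) <= rnorm x + rnorm y.
Proof. by rewrite -lecR rmorphD/= -!rnormE ler_normD. Qed.

Lemma rnormZ (a : R[i]) x : rnorm (a *: x) = complex.Re `|a| * rnorm x.
Proof.
rewrite {1}/rnorm normrZ (rnormE x); case: `|a| => u v /=.
by rewrite mulr0 subr0.
Qed.

Lemma rnormZr (a : R) x : rnorm (a%:C *: x) = `|a| * rnorm x.
Proof. by rewrite rnormZ normc_def/= expr0n/= addr0 sqrtr_sqr. Qed.

Lemma rnormN x : rnorm (- x) = rnorm x.
Proof. by rewrite /rnorm normrN. Qed.

Lemma rnormB x y : rnorm (x - y) = rnorm (y - x).
Proof. by rewrite /rnorm distrC. Qed.

End RealNorm.

Section HilbertTheory.
Variables (R : realType) (H : hilbertType R).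
Implicit Types x y z : H.

Definition rdot x y : R := complex.Re (hdot x y).

Lemma hdotC x y : hdot y x = Num.conj (hdot x y).
Proof. by rewrite hermC expr0 mul1r. Qed.

Lemma rdotC x y : rdot y x = rdot x y.
Proof. by rewrite /rdot hdotC; case: (hdot x y). Qed.

Lemma rdotDl x y z : rdot (x + y) z = rdot x z + rdot y z.
Proof. by rewrite /rdot linearDl raddfD. Qed.

Lemma rdotZl (a : R) x y : rdot (a%:C *: x) y = a * rdot x y.
Proof.
by rewrite /rdot linearZl_LR/=; case: (hdot x y) => u v /=; rewrite mul0r subr0.
Qed.

Lemma rdotNl x y : rdot (- x) y = - rdot x y.
Proof. by rewrite /rdot linearNl raddfN. Qed.

Lemma rdotDr x y z : rdot z (x + y) = rdot z x + rdot z y.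
Proof. by rewrite rdotC rdotDl !(rdotC z). Qed.

Lemma rdotZr (a : R) x y : rdot y (a%:C *: x) = a * rdot y x.
Proof. by rewrite rdotC rdotZl rdotC. Qed.

Lemma rdotNr x y : rdot y (- x) = - rdot y x.
Proof. by rewrite rdotC rdotNl rdotC. Qed.

Lemma rdot_norm x : rnorm x ^+ 2 = rdot x x.
Proof. by apply: complexI; rewrite /rdot -hdot_norm rnormE -rmorphXn. Qed.

Lemma rnormDZ x y (t : R) :
  rnorm (x + t%:C *: y) ^+ 2
  = rnorm x ^+ 2 + 2 * t * rdot x y + t ^+ 2 * rnorm y ^+ 2.
Proof.
rewrite !rdot_norm !(rdotDl, rdotDr, rdotZl, rdotZr) (rdotC x y); ring.
Qed.

Lemma rdot_le x y : `|rdot x y| <= rnorm x * rnorm y.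
Proof.
have [y0|y0] := eqVneq (rnorm y) 0.
  by rewrite (rnorm_eq0 y0) /rdot linear0r/= normr0 rnorm0 mulr0.
have yp : 0 < rnorm y ^+ 2 by rewrite exprn_gt0// lt_neqAle eq_sym y0 rnorm_ge0.
have := sqr_ge0 (rnorm (x + (- (rdot x y / rnorm y ^+ 2))%:C *: y)).
rewrite rnormDZ; set d := rdot x y; set n := rnorm y ^+ 2 in yp *.
have -> : rnorm x ^+ 2 + 2 * - (d / n) * d + (- (d / n)) ^+ 2 * n
    = rnorm x ^+ 2 - d ^+ 2 / n by field; rewrite gt_eqF.
rewrite subr_ge0 ler_pdivrMr// -exprMn => le.
rewrite -(@ler_pXn2r _ 2) ?nnegrE//; last by rewrite mulr_ge0 ?rnorm_ge0.
by rewrite real_normK// num_real.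
Qed.

Lemma hdot_le x y : `|hdot x y| <= `|x| * `|y|.
Proof.
have [->|d0] := eqVneq (hdot x y) 0; first by rewrite normr0 mulr_ge0.
pose a := Num.conj (hdot x y) / `|hdot x y|.
have na : `|a| = 1 by rewrite normrM normfV norm_conjC normr_id divff// normr_eq0.
have -> : `|hdot x y| = (rdot (a *: x) y)%:C.
  by rewrite /rdot linearZl_LR/= /a mulrAC -normCKC expr2 mulfK ?normr_eq0//.
rewrite !rnormE -rmorphM lecR.
apply: (le_trans (ler_norm _)); apply: (le_trans (rdot_le _ _)).
by rewrite rnormZ na/= mul1r.
Qed.

Lemma hdot_inj y z : (forall x, hdot x y = hdot x z) -> y = z.
Proof.
move=> yz; apply/eqP; rewrite -subr_eq0 -(dnorm_eq0 (@hdot R H)).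
by rewrite linearBr/= yz subrr.
Qed.

Lemma parallelogram x y :
  rnorm (x + y) ^+ 2 + rnorm (x - y) ^+ 2
  = 2 * (rnorm x ^+ 2 + rnorm y ^+ 2).
Proof.
rewrite !rdot_norm !(rdotDl, rdotDr, rdotNl, rdotNr) (rdotC x y); ring.
Qed.

End HilbertTheory.

Section Riesz.
Variables (R : realType) (H : hilbertType R) (f : H -> R[i]) (M : R).
Hypothesis f_linear : scalar f.
Hypothesis f_bounded : forall x, `|f x| <= M%:C * `|x|.

Let g x := complex.Re (f x).

Let gD x y : g (x + y) = g x + g y.
Proof. by rewrite /g -[x]scale1r f_linear scale1r mul1r raddfD. Qed.

Let f0 : f 0 = 0.
Proof. by have := f_linear (-1) 0 0; rewrite scaleN1r addNr mulN1r addNr. Qed.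

Let fZ a x : f (a *: x) = a * f x.
Proof. by have := f_linear a x 0; rewrite !addr0 f0 addr0. Qed.

Let gZ (a : R) x : g (a%:C *: x) = a * g x.
Proof. by rewrite /g fZ; case: (f x) => u v /=; rewrite mul0r subr0. Qed.

Let g_le x : `|g x| <= M * rnorm x.
Proof.
rewrite -lecR rmorphM/= -rnormE; apply: le_trans (f_bounded x).
exact: normc_ge_Re.
Qed.

Let Q x := rnorm x ^+ 2 - 2 * g x.

Let Q_ge x : - M ^+ 2 <= Q x.
Proof.
have := g_le x; rewrite ler_norml => /andP[_ gx].
have := sqr_ge0 (rnorm x - M); rewrite /Q; lra.
Qed.

Let m := inf (range Q).

Let m_le x : m <= Q x.
Proof.
apply: ge_inf; last by exists x.
by exists (- M ^+ 2) => _ [y _ <-]; exact: Q_ge.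
Qed.

Let near_min e := [set x | Q x < m + e].

Let near_min_ex e : 0 < e -> near_min e !=set0.
Proof.
move=> e0; have [|_ [x _ <-] Qx] := @inf_adherent R (range Q) e e0.
  split; first by exists (Q 0), 0.
  by exists (- M ^+ 2) => _ [y _ <-]; exact: Q_ge.
by exists x.
Qed.

Let near_min_close e x y :
  near_min e x -> near_min e y -> rnorm (x - y) ^+ 2 <= 4 * e.
Proof.
rewrite /near_min/= => Qx Qy; have := m_le (2^-1%:C *: (x + y)).
rewrite /Q rnormZr gZ gD ger0_norm ?invr_ge0// exprMn.
have := parallelogram x y; move: Qx Qy; rewrite /Q; lra.
Qed.

Let near_min_deriv e x y : 0 < e ->
  near_min e y -> (rdot x y - g x) ^+ 2 <= e * rnorm x ^+ 2.
Proof.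
rewrite /near_min/= => e0 Qy.
have P t : 0 <= e + 2 * t * (rdot x y - g x) + t ^+ 2 * rnorm x ^+ 2.
  have := m_le (y + t%:C *: x); rewrite /Q gD gZ rnormDZ (rdotC x y).
  move: Qy; rewrite /Q; lra.
move: P; set d := _ - g x; set n := rnorm x ^+ 2 => P.
have n0 : 0 <= n by rewrite sqr_ge0.
have [nE|n1] := eqVneq n 0.
  have [->|d0] := eqVneq d 0; first by rewrite nE mulr0 expr0n.
  have := P (- e / d); rewrite nE mulr0 addr0.
  have -> : 2 * (- e / d) * d = - (2 * e) by field.
  lra.
have np : 0 < n by rewrite lt_neqAle eq_sym n1.
have := P (- d / n).
have -> : e + 2 * (- d / n) * d + (- d / n) ^+ 2 * n = e - d ^+ 2 / n by field.
by rewrite subr_ge0 ler_pdivrMr.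
Qed.

Lemma riesz : exists z, forall x, f x = hdot x z.
Proof.
suff [z gz] : exists z, forall x, g x = rdot x z.
  exists z => x; have := gz x; have := gz ('i *: x).
  rewrite /g /rdot fZ linearZl_LR/=.
  case: (f x) (hdot x z) => [a b] [c d] /=.
  rewrite !mul0r !mul1r !sub0r => /oppr_inj -> -> //.
pose F := filter_from [set e : R | 0 < e] near_min.
have FF : ProperFilter F.
  apply: filter_from_proper => [|e e0]; last exact: near_min_ex.
  apply: filter_from_filter; first by exists 1; rewrite /=.
  move=> e1 e2 /= e10 e20; exists (Num.min e1 e2); first by rewrite /= lt_min e10.
  move=> x; rewrite /near_min /= -!ltrBlDl lt_min => /andP[Q1 Q2].
  by split.
have cF : cauchy F.
  apply/cauchy_ballP => e e0.
  have er : e = (complex.Re e)%:C by rewrite RRe_real// gtr0_real.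
  set r := complex.Re e in er; have r0 : 0 < r by rewrite -ltcR -er.
  pose d := (r ^+ 2 / 8); have d0 : 0 < d by rewrite divr_gt0// exprn_gt0.
  exists (near_min d, near_min d) => [|[x y] /= [xd yd]].
    by split; exists d.
  rewrite -ball_normE /ball_ /= rnormE er ltcR.
  rewrite -(@ltr_pXn2r _ 2) ?nnegrE ?rnorm_ge0//; last exact: ltW.
  apply: le_lt_trans (near_min_close xd yd) _.
  rewrite /d; have : 0 < r ^+ 2 by rewrite exprn_gt0.
  lra.
have zF : forall e : R[i], 0 < e -> \forall y \near F, `|lim F - y| < e.
  by apply/(@cvgrPdist_lt _ _ _ F FF id); exact: cauchy_cvg cF.
exists (lim F) => x; apply/eqP; rewrite eq_sym -subr_eq0 -normr_le0.
set z := lim F in zF *.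
apply/ler_addgt0Pl => e e0; rewrite addr0.
pose c := rnorm x + 1; have c0 : 0 < c by rewrite ltr_wpDl// rnorm_ge0.
pose r := e / (2 * c); have r0 : 0 < r by rewrite divr_gt0// mulr_gt0.
have [] := @filter_ex _ F _ (near_min (r ^+ 2) `&` [set y | `|z - y| < r%:C]).
  apply: filterI; first by exists (r ^+ 2) => //=; rewrite exprn_gt0.
  by apply: zF; rewrite ltcR.
move=> y [yr]; rewrite /= rnormE ltcR => yz.
have := @near_min_deriv _ x y (exprn_gt0 2 r0) yr.
rewrite -exprMn -[X in X <= _]real_normK ?num_real//.
have rx0 : 0 <= r * rnorm x by rewrite mulr_ge0 ?rnorm_ge0// ltW.
rewrite ler_pXn2r ?nnegrE// => h1.
have h2 := rdot_le x (z - y).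
have h3 : rnorm x * rnorm (z - y) <= rnorm x * r.
  by rewrite ler_wpM2l ?rnorm_ge0// ltW.
have -> : rdot x z - g x = rdot x (z - y) + (rdot x y - g x).
  by rewrite rdotDr rdotNr; ring.
apply: (le_trans (ler_normD _ _)).
have -> : e = 2 * (r * rnorm x) + 2 * r by rewrite /r /c; field; rewrite gt_eqF.
move: h1 h2 h3 r0; rewrite -/(rdot x (z - y)); lra.
Qed.

End Riesz.

Definition bounded_op_pred (R : realType) (H : hilbertType R) : {pred H -> H} :=
  mem [set f : H -> H |
    linear f /\ exists M : R[i], forall x, `|f x| <= M * `|x|].

Arguments bounded_op_pred {R} H.

Record bop (R : realType) (H : hilbertType R) := Bop {
  bop_fun :> H -> H;
  bop_subproof : bop_fun \in bounded_op_pred H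
}.
Notation "''B' ( H )" := (bop H) (at level 8, format "''B' ( H )") : type_scope.
Arguments bop_fun {R H}.

Section BopType.
Variables (R : realType) (H : hilbertType R).

HB.instance Definition _ := [isSub of 'B(H) for @bop_fun R H].
HB.instance Definition _ := [Choice of 'B(H) by <:].

Lemma bounded_op_submod_closed : submod_closed (bounded_op_pred H).
Proof.
split.
  apply: mem_set; split; first by move=> a x y; rewrite scaler0 addr0.
  by exists 0 => x; rewrite normr0 mul0r.
move=> a f g /set_mem[fl [M fM]] /set_mem[gl [N gN]]; apply: mem_set; split.
  move=> b x y; rewrite !fctE fl gl !scalerDr !scalerA (mulrC a b) addrACA //.
exists (`|a| * M + N) => x; rewrite mulrDl; apply: (le_trans (ler_normD _ _)).
by rewrite lerD//= normrZ -mulrA ler_wpM2l.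
Qed.

HB.instance Definition _ :=
  GRing.isSubmodClosed.Build R[i] (H -> H) (bounded_op_pred H)
    bounded_op_submod_closed.
HB.instance Definition _ := [SubChoice_isSubLmodule of 'B(H) by <:].

Implicit Types S T : 'B(H).

Lemma bop_linear T : linear T.
Proof. by have /set_mem[] := bop_subproof T. Qed.

HB.instance Definition _ T :=
  GRing.isLinear.Build R[i] H H *:%R (bop_fun T) (bop_linear T).

Lemma bop_bounded T : exists M : R, 0 <= M /\ forall x, rnorm (T x) <= M * rnorm x.
Proof.
have /set_mem[_ [M TM]] := bop_subproof T.
exists (complex.Re `|M|); split; first exact: Re_normC_ge0.
move=> x; rewrite -lecR rmorphM/= -!rnormE -normC_Re.
apply: (le_trans (TM x)).
have [x0|x0] := eqVneq `|x| 0; first by rewrite x0 !mulr0.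
rewrite ler_wpM2r// real_ler_norm//.
have xp : 0 < `|x| by rewrite lt_neqAle eq_sym x0 normr_ge0.
have : 0 <= M * `|x| by apply: le_trans (TM x).
by rewrite pmulr_lge0// => /ger0_real.
Qed.

Lemma bopP S T : (forall x, S x = T x) -> S = T.
Proof. by move=> ST; apply/val_inj/funext. Qed.

(* Real-valued; the norm `|T| of 'B(H) is (opnorm T)%:C. *)
Definition opnorm T : R :=
  sup [set r : R | exists2 x : H, rnorm x <= 1 & r = rnorm (T x)].

Let opnorm_set_ub T :
  has_sup [set r : R | exists2 x : H, rnorm x <= 1 & r = rnorm (T x)].
Proof.
split; first by exists (rnorm (T 0)), 0; rewrite ?rnorm0.
have [M [M0 TM]] := bop_bounded T; exists M => _ [x x1 ->].
by apply: (le_trans (TM x)); rewrite ler_piMr.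
Qed.

Lemma opnorm_ge0 T : 0 <= opnorm T.
Proof.
have [_ ub] := opnorm_set_ub T.
apply: (le_trans (rnorm_ge0 (T 0))); apply: (ub_le_sup ub).
by exists 0 => //; rewrite rnorm0.
Qed.

Lemma opnormP T x : rnorm (T x) <= opnorm T * rnorm x.
Proof.
have [x0|x0] := eqVneq (rnorm x) 0.
  by rewrite (rnorm_eq0 x0) linear0 !rnorm0 mulr0.
have xp : 0 < rnorm x by rewrite lt_neqAle eq_sym x0 rnorm_ge0.
rewrite -ler_pdivrMr//.
have [_ ub] := opnorm_set_ub T; apply: (ub_le_sup ub).
exists (((rnorm x)^-1)%:C *: x).
  by rewrite rnormZr ger0_norm ?invr_ge0 ?rnorm_ge0// mulVf.
by rewrite linearZ rnormZr ger0_norm ?invr_ge0 ?rnorm_ge0// mulrC.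
Qed.

Lemma opnorm_le T M : 0 <= M -> (forall x, rnorm (T x) <= M * rnorm x) ->
  opnorm T <= M.
Proof.
move=> M0 TM; apply: ge_sup; first by have [] := opnorm_set_ub T.
by move=> _ [x x1 ->]; apply: (le_trans (TM x)); rewrite ler_piMr.
Qed.

Let norm T : R[i] := (opnorm T)%:C.

Let norm_triangle S T : norm (S + T) <= norm S + norm T.
Proof.
rewrite /norm -rmorphD lecR; apply: opnorm_le.
  by rewrite addr_ge0 ?opnorm_ge0.
move=> x; apply: (le_trans (rnormD _ _)).
by rewrite mulrDl lerD ?opnormP.
Qed.

Let opnormZ_le (a : R[i]) T : opnorm (a *: T) <= complex.Re `|a| * opnorm T.
Proof.
have a0 := Re_normC_ge0 a.
apply: opnorm_le; first by rewrite mulr_ge0 ?opnorm_ge0.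
by move=> x; rewrite rnormZ -mulrA ler_wpM2l ?opnormP.
Qed.

Let norm_scale (a : R[i]) T : norm (a *: T) = `|a| * norm T.
Proof.
rewrite (normC_Re a) /norm -rmorphM; congr (_%:C); apply/le_anti.
rewrite opnormZ_le andTb.
have [->|a0] := eqVneq a 0.
  by rewrite normr0 mul0r opnorm_ge0.
have ap : 0 < complex.Re `|a| by rewrite -ltcR -normC_Re normr_gt0.
rewrite mulrC -ler_pdivlMr// mulrC.
have := opnormZ_le a^-1 (a *: T); rewrite scalerA mulVf// scale1r.
suff -> : complex.Re `|a^-1| = (complex.Re `|a|)^-1 by [].
apply: complexI; rewrite -normC_Re normfV (normC_Re a).
by rewrite fmorphV.
Qed.

Let norm_eq0 T : norm T = 0 -> T = 0.
Proof.
move=> /complexI T0; apply: bopP => x; apply: rnorm_eq0; apply/le_anti.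
by rewrite rnorm_ge0 andbT; have := opnormP T x; rewrite T0 mul0r.
Qed.

HB.instance Definition _ :=
  Lmodule_isNormed.Build R[i] 'B(H) norm_triangle norm_scale norm_eq0.

Lemma bop_normE T : `|T| = (opnorm T)%:C.
Proof. by []. Qed.

Lemma bop_rnormE T : rnorm T = opnorm T.
Proof. by []. Qed.

Let complete (F : set_system 'B(H)) : ProperFilter F -> cauchy F -> cvg F.
Proof.
move=> FF /cauchy_ballP Fc.
have Fe (e : R) : 0 < e -> exists P : set 'B(H), F P /\
    forall S T, P S -> P T -> opnorm (S - T) < e.
  move=> e0; have [|[P Q] /= [FP FQ] PQ] := Fc e%:C; first by rewrite ltcR.
  exists (P `&` Q); split; first exact: filterI.
  move=> S T [PS _] [_ QT]; have := PQ (S, T) (conj PS QT).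
  by rewrite /= -ball_normE /ball_ /= bop_normE ltcR.
have cx x : cauchy ((fun T : 'B(H) => T x) @ F).
  apply/cauchy_ballP => e e0.
  have er : e = (complex.Re e)%:C by rewrite RRe_real// gtr0_real.
  set r := complex.Re e in er; have r0 : 0 < r by rewrite -ltcR -er.
  pose c := rnorm x + 1; have c0 : 0 < c by rewrite ltr_wpDl// rnorm_ge0.
  have [|P [FP HP]] := Fe (r / c); first by rewrite divr_gt0.
  exists ([set (T : 'B(H)) x | T in P], [set (T : 'B(H)) x | T in P]).
    by split; rewrite /nbhs/=; apply: filterS FP => T PT; exists T.
  move=> [_ _] [/= [S PS <-] [T PT <-]].
  rewrite -ball_normE /ball_ /= rnormE er ltcR.
  apply: (le_lt_trans (opnormP (S - T) x)).
  apply: (@le_lt_trans _ _ (r / c * rnorm x)).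
    by rewrite ler_wpM2r ?rnorm_ge0// ltW// HP.
  by rewrite mulrAC ltr_pdivrMr// ltr_pM2l// ltrDl.
pose L x := lim ((fun T : 'B(H) => T x) @ F).
have cL x : (fun T : 'B(H) => T x) @ F --> L x by exact: cauchy_cvg (cx x).
have L_lin : linear L.
  move=> a x y.
  have h1 : (fun T : 'B(H) => T (a *: x + y)) @ F --> a *: L x + L y.
    under eq_fun do rewrite linearP.
    by apply: cvgD (cL y); exact: (cvgZl_tmp (cL x)).
  exact: (cvg_unique _ (cL _) h1).
have close (e : R) : 0 < e -> exists P : set 'B(H), F P /\
    forall T, P T -> forall x, rnorm (L x - T x) <= e * rnorm x.
  move=> e0; have [P [FP HP]] := Fe e e0; exists P; split=> // T PT x.
  apply/ler_addgt0Pl => d d0.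
  have : \forall S \near F, `|L x - (S : 'B(H)) x| < d%:C.
    by move/cvgrPdist_lt : (cL x); apply; rewrite ltcR.
  move=> /filterI /(_ FP) /filter_ex[S [+ PS]].
  rewrite rnormE ltcR => /ltW LS.
  rewrite -[L x](subrK (S x)) -addrA; apply: (le_trans (rnormD _ _)).
  rewrite lerD//; apply: (le_trans (opnormP (S - T) x)).
  by rewrite ler_wpM2r ?rnorm_ge0// ltW// HP.
have Lb : L \in bounded_op_pred H.
  apply: mem_set; split => //.
  have [P [FP HP]] := close 1 ltr01.
  have [T PT] := filter_ex FP.
  exists (1 + opnorm T)%:C => x; rewrite !rnormE -rmorphM lecR.
  rewrite -[L x](subrK (T x)) mulrDl; apply: (le_trans (rnormD _ _)).
  by rewrite lerD ?HP ?opnormP.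
apply/cvg_ex; exists (Bop Lb); apply/cvgrPdist_le => e e0.
have er : e = (complex.Re e)%:C by rewrite RRe_real// gtr0_real.
set r := complex.Re e in er; have r0 : 0 < r by rewrite -ltcR -er.
have [P [FP HP]] := close r r0.
apply: filterS FP => T PT; rewrite bop_normE er lecR.
by apply: opnorm_le; [exact: ltW | exact: HP].
Qed.

HB.instance Definition _ := Uniform_isComplete.Build 'B(H) complete.

End BopType.

Section BopAlgebra.
Variables (R : realType) (H : hilbertType R).
Implicit Types S T U : 'B(H).

Lemma bop_comp_subproof S T : (S : H -> H) \o T \in bounded_op_pred H.
Proof.
apply: mem_set; split; first by move=> a x y /=; rewrite !linearP.
exists (opnorm S * opnorm T)%:C => x; rewrite !rnormE -rmorphM lecR.
apply: (le_trans (opnormP _ _)).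
by rewrite -mulrA ler_wpM2l ?opnorm_ge0 ?opnormP.
Qed.

Definition bop_comp S T : 'B(H) := Bop (bop_comp_subproof S T).

Lemma adjoint_exists T :
  exists S : 'B(H), forall x y, hdot (T x) y = hdot x (S y).
Proof.
have [g gP] : exists g : H -> H, forall x y, hdot (T x) y = hdot x (g y).
  suff /choice[g gP] : forall y, exists z, forall x, hdot (T x) y = hdot x z.
    by exists g.
  move=> y; apply: (@riesz _ _ (fun x => hdot (T x) y) (opnorm T * rnorm y)).
    by move=> a u v; rewrite linearP linearPl.
  move=> x; apply: (le_trans (hdot_le _ _)).
  rewrite !rnormE -!rmorphM lecR mulrAC ler_wpM2r ?rnorm_ge0//.
  exact: opnormP.
suff gB : g \in bounded_op_pred H by exists (Bop gB).
apply: mem_set; split.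
  move=> a y z; apply: hdot_inj => x.
  by rewrite -gP !linearDr !linearZr_LR/= !gP.
exists (opnorm T)%:C => y; rewrite !rnormE -rmorphM lecR.
have [g0|g0] := eqVneq (rnorm (g y)) 0.
  by rewrite g0 mulr_ge0 ?opnorm_ge0 ?rnorm_ge0.
have gp : 0 < rnorm (g y) by rewrite lt_neqAle eq_sym g0 rnorm_ge0.
rewrite -(ler_pM2r gp) -expr2 rdot_norm /rdot -gP -/(rdot _ _).
apply: (le_trans (ler_norm _)); apply: (le_trans (rdot_le _ _)).
by rewrite mulrAC ler_wpM2r ?rnorm_ge0// opnormP.
Qed.

Definition adjoint T : 'B(H) := projT1 (cid (adjoint_exists T)).

Lemma adjointP T x y : hdot (T x) y = hdot x (adjoint T y).
Proof. by rewrite /adjoint; case: cid. Qed.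

Lemma adjointPr T x y : hdot (adjoint T x) y = hdot x (T y).
Proof. by rewrite hdotC -adjointP -hdotC. Qed.

Lemma adjoint_unique S T :
  (forall x y, hdot (T x) y = hdot x (S y)) -> S = adjoint T.
Proof.
by move=> ST; apply: bopP => y; apply: hdot_inj => x; rewrite -ST adjointP.
Qed.

Let mulA : associative bop_comp.
Proof. by move=> S T U; apply: bopP. Qed.
Let mulDl S T U : bop_comp (S + T) U = bop_comp S U + bop_comp T U.
Proof. exact: bopP. Qed.
Let mulDr S T U : bop_comp S (T + U) = bop_comp S T + bop_comp S U.
Proof. by apply: bopP => x /=; rewrite linearD. Qed.
Let mulZl (a : R[i]) S T : bop_comp (a *: S) T = a *: bop_comp S T.
Proof. exact: bopP. Qed.
Let mulZr (a : R[i]) S T : bop_comp S (a *: T) = a *: bop_comp S T.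
Proof. by apply: bopP => x /=; rewrite linearZ. Qed.
Let adjK : involutive adjoint.
Proof. by move=> T; apply/esym/adjoint_unique => x y; rewrite adjointPr. Qed.
Let adjD : {morph adjoint : S T / S + T}.
Proof.
move=> S T; apply/esym/adjoint_unique => x y.
suff: hdot (S x + T x) y = hdot x (adjoint S y + adjoint T y) by [].
by rewrite linearDl linearDr/= !adjointP.
Qed.
Let adjZ (a : R[i]) T : adjoint (a *: T) = Num.conj a *: adjoint T.
Proof.
apply/esym/adjoint_unique => x y.
suff: hdot (a *: T x) y = hdot x (Num.conj a *: adjoint T y) by [].
by rewrite linearZl_LR linearZr_LR/= conjCK adjointP.
Qed.
Let adjM S T : adjoint (bop_comp S T) = bop_comp (adjoint T) (adjoint S).
Proof. by apply/esym/adjoint_unique => x y /=; rewrite !adjointP. Qed.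

Let opnormM S T : opnorm (bop_comp S T) <= opnorm S * opnorm T.
Proof.
apply: opnorm_le => [|x]; first by rewrite mulr_ge0 ?opnorm_ge0.
apply: (le_trans (opnormP S (T x))).
by rewrite -mulrA ler_wpM2l ?opnorm_ge0 ?opnormP.
Qed.

Let opnorm_sqr T : opnorm T ^+ 2 <= opnorm (bop_comp (adjoint T) T).
Proof.
set U := bop_comp _ _.
have U0 : 0 <= opnorm U := opnorm_ge0 U.
rewrite -(sqr_sqrtr U0) ler_pXn2r ?nnegrE ?sqrtr_ge0 ?opnorm_ge0//.
apply: opnorm_le => [|x]; first exact: sqrtr_ge0.
rewrite -(@ler_pXn2r _ 2) ?nnegrE ?mulr_ge0 ?sqrtr_ge0 ?rnorm_ge0//.
rewrite exprMn sqr_sqrtr// rdot_norm /rdot -adjointPr -/(rdot (U x) x).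
apply: (le_trans (ler_norm _)); apply: (le_trans (rdot_le _ _)).
by rewrite expr2 mulrA ler_wpM2r ?rnorm_ge0 ?opnormP.
Qed.

Let opnorm_adj_ge T : opnorm T <= opnorm (adjoint T).
Proof.
have [->|T0] := eqVneq (opnorm T) 0; first exact: opnorm_ge0.
have Tp : 0 < opnorm T by rewrite lt_neqAle eq_sym T0 opnorm_ge0.
rewrite -(ler_pM2r Tp) -expr2.
exact: le_trans (opnorm_sqr T) (opnormM _ _).
Qed.

Let normM S T : `|bop_comp S T| <= `|S| * `|T|.
Proof. by rewrite !bop_normE -rmorphM lecR opnormM. Qed.

Let normE T : `|bop_comp (adjoint T) T| = `|T| ^+ 2.
Proof.
rewrite !bop_normE -rmorphXn; congr (_%:C); apply/le_anti.
rewrite opnorm_sqr andbT; apply: (le_trans (opnormM _ _)).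
rewrite expr2 ler_wpM2r ?opnorm_ge0//.
by have := opnorm_adj_ge (adjoint T); rewrite adjK.
Qed.

HB.instance Definition _ := isCstarAlgebra.Build R 'B(H) mulA mulDl mulDr mulZl
  mulZr adjK adjD adjZ adjM normM normE.

End BopAlgebra.

(* The coarsest topology that makes T |-> hdot (T x) y continuous for all
   x and y. The topology of R[i] is attached to its numFieldType structure;
   without C, inference would unfold initial_topology and silently find the
   norm topology of 'B(H). *)
Definition weak_operator_topology (R : realType) (H : hilbertType R)
    : topologicalType :=
  let C : topologicalType := (R[i] : numFieldType) in
  initial_topology ((fun T xy => hdot (T xy.1) xy.2)
    : 'B(H) -> prod_topology (fun _ : H * H => C)).

Definition weakly_open (R : realType) (H : hilbertType R) : set_system 'B(H) :=
  @open (weak_operator_topology H).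

(* Preimages of Borel sets under the coordinate projections; they generate the
   product Borel structure of the sequences of operators. *)
Definition Gamma_cylinder (R : realType) (H : hilbertType R) :
    set_system (nat -> 'B(H)) :=
  \bigcup_n preimage_set_system setT
    ((fun gamma => gamma n) : (nat -> 'B(H)) -> 'B(H))
    <<s @weakly_open R H >>.

(* nat is discrete, and {ptws nat -> nat} carries the product topology. *)
Definition baire_open : set_system (nat -> nat) := @open {ptws nat -> nat}.

Definition borel_map (R : realType) (H : hilbertType R)
    (Phi : (nat -> nat) -> nat -> 'B(H)) : Prop :=
  measurable_fun setT
    (Phi : g_sigma_algebraType baire_open ->
           g_sigma_algebraType (@Gamma_cylinder R H)).

Definition le_inf (f g : nat -> nat) : Prop :=
  exists m, forall i, (f i <= g i + m)%N.

Definition E_Ksigma (f g : nat -> nat) : Prop := le_inf f g /\ le_inf g f.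

(* The identity of 'B(H) is not among the generators. *)
Definition Cstar (R : realType) (H : hilbertType R) (gamma : nat -> 'B(H))
  : cstarAlgType R := csub_type (cstar_generated gamma).

Definition separable (T : topologicalType) : Prop :=
  exists D : set T, countable D /\ dense D.

(* Main.v *)
(* Let [ket (k, t)], for natural numbers [k] and [t], be orthonormal in [H].
   For each [k], the matrix units [munit k D a b], which map
   [ket (k, q D + b)] to [ket (k, q D + a)], span a copy of the D x D matrices, and
   these copies are nested when [D] divides [D']. With
   [D = dim f k n = prod_(i < n) p_i ^ (f i + k)] they generate, as [n] grows, a
   UHF algebra with supernatural number [prod_i p_i ^ (f i + k)], and
   C*(Phi f) is the unitization of the c0-direct sum over [k] of these algebras.
   If [f <= g + m], shifting [k] to [k + m] embeds C*(Phi f) into C*(Phi g).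
   Conversely, an embedding sends the unit of the component [0] to a projection
   [q] that is nonzero in some component [k] of C*(Phi g). Every projection there
   has a trace whose denominator divides some [dim g k m], so the trace of [q] is
   [c / dim g k m]; but [q] is also the sum of [dim f 0 i.+1] equivalent
   projections for every [i], and comparing p_i-adic valuations yields
   [f i <= g i + k + c].

   The AF property rests on the automatic continuity of *-homomorphisms, and the
   traces on perturbations of idempotents. Both are reduced to a single
   contraction [isqrt_step] that computes inverse square roots near the unit. *)
Require Import Defs.
From HB Require Import structures.
From mathcomp Require Import all_boot all_order all_algebra.
From mathcomp Require Import complex sesquilinear.
From mathcomp Require Import all_classical all_reals all_analysis.
From mathcomp Require Import ring lra zify.
Set Implicit Arguments.
Unset Strict Implicit.
Unset Printing Implicit Defensive.
Import Order.TTheory GRing.Theory Num.Theory.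
Import numFieldNormedType.Exports.
Local Open Scope classical_set_scope.
Local Open Scope ring_scope.
Local Open Scope complex_scope.

(** * Normalization of linear combinations *)

(** A UHF algebra with supernatural number [prod_i p_i ^ f i] embeds unitally only under a pointwise
    inequality, whereas the relation allows a bounded error. Taking the exponents [f i + k] for all
    [k] at once puts every shift of [f] into one algebra, and an embedding that need not preserve
    units can move along the shifts. The price is the unknown numerator [c] of a trace; but [c] is
    fixed before [i] varies and bounds all its own valuations, so it costs only a constant.

    The orthonormal sequence need not be a basis: the operators live in the set [corner] of those
    supported on its closed span, with the projection [tail 0] as unit. All generators send kets to
    kets or to 0, so their identities reduce to arithmetic on indices. No tracial state is built:
    traces are matrix traces on finite blocks, and agreement in the limit is expressed by
    [null_trace]. Similarity of idempotents is enough for this, so the perturbed idempotents need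
    not be self-adjoint.

    Automatic continuity enters because the universal property of the direct limit ranges over
    cocones of purely algebraic *-homomorphisms. *)

Section LinearExpressions.
Variables (K : pzRingType) (V : lmodType K).

Inductive lexp :=
  LVar of nat | LZero | LAdd of lexp & lexp | LOpp of lexp | LScale of K & lexp.

Fixpoint leval (env : seq V) (t : lexp) : V :=
  match t with
  | LVar i => nth 0 env i
  | LZero => 0
  | LAdd s t => leval env s + leval env t
  | LOpp s => - leval env s
  | LScale a s => a *: leval env s
  end.

(** [PeanoNat.Nat.eqb] instead of [==] lets [cbn], with its explicit list of constants, decide the
    comparison on closed numerals. *)
Fixpoint lcoef (t : lexp) (i : nat) : K :=
  match t with
  | LVar j => if PeanoNat.Nat.eqb j i then 1 else 0
  | LZero => 0
  | LAdd s t => lcoef s i + lcoef t i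
  | LOpp s => - lcoef s i
  | LScale a s => a * lcoef s i
  end.

Fixpoint lsame (n : nat) (s t : lexp) : Prop :=
  if n is n'.+1 then lsame n' s t /\ lcoef s n' = lcoef t n' else True.

Lemma levalE env t : leval env t = \sum_(i < size env) lcoef t i *: env`_i.
Proof.
elim: t => [j||s IHs t IHt|s IHs|a s IHs] /=.
- have [ji|ij] := ltnP j (size env).
    rewrite (bigD1 (Ordinal ji))//= PeanoNat.Nat.eqb_refl scale1r big1 ?addr0// => i ne.
    have -> : PeanoNat.Nat.eqb j i = false.
      by apply/PeanoNat.Nat.eqb_neq => e; move/eqP: ne; apply; exact: val_inj.
    by rewrite scale0r.
  rewrite nth_default// big1// => i _.
  have -> : PeanoNat.Nat.eqb j i = false.
    by apply/PeanoNat.Nat.eqb_neq => e; move: (ltn_ord i); rewrite -e ltnNge ij.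
  by rewrite scale0r.
- by rewrite big1// => i _; rewrite scale0r.
- by rewrite IHs IHt -big_split; apply: eq_bigr => i _; rewrite scalerDl.
- by rewrite IHs -sumrN; apply: eq_bigr => i _; rewrite scaleNr.
- by rewrite IHs scaler_sumr; apply: eq_bigr => i _; rewrite scalerA.
Qed.

Lemma leval_same env s t : lsame (size env) s t -> leval env s = leval env t.
Proof.
move=> st; rewrite !levalE; apply: eq_bigr => -[i /= iN] _; congr (_ *: _).
elim: (size env) st i iN => //= n IH [st e] i.
by rewrite ltnS leq_eqVlt => /predU1P[->//|]; exact: IH.
Qed.

End LinearExpressions.

(** Atoms are compared up to conversion: typing [erefl] at [x = y] either succeeds or makes the
    match fall through to the next branch. *)
Ltac lin_find x env :=
  lazymatch env with
  | nil => constr:(@None nat)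
  | cons ?y ?l =>
    match constr:(Set) with
    | _ => let _ := match constr:(Set) with _ => constr:(erefl : x = y) end in constr:(Some 0%N)
    | _ => lazymatch lin_find x l with
           | Some ?n => constr:(Some (S n))
           | None => constr:(@None nat)
           end
    end
  end.

Ltac lin_env K V x env :=
  lazymatch x with
  | @GRing.add _ ?s ?t => let e := lin_env K V s env in lin_env K V t e
  | @GRing.opp _ ?s => lin_env K V s env
  | @GRing.scale _ _ ?a ?s => lin_env K V s env
  | @GRing.zero _ => env
  | _ => lazymatch lin_find x env with
         | Some _ => env | None => constr:(cons (x : V) env) end
  end.

Ltac lin_term K x env :=
  lazymatch x with
  | @GRing.add _ ?s ?t =>
      let s' := lin_term K s env in let t' := lin_term K t env in constr:(@LAdd K s' t')
  | @GRing.opp _ ?s => let s' := lin_term K s env in constr:(@LOpp K s')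
  | @GRing.scale _ _ ?a ?s => let s' := lin_term K s env in constr:(@LScale K a s')
  | @GRing.zero _ => constr:(@LZero K)
  | _ => lazymatch lin_find x env with Some ?n => constr:(@LVar K n) end
  end.

(* [lin K V] proves equalities of K-linear combinations of arbitrary atoms of [V]. *)
Ltac lin K V :=
  lazymatch goal with
  | |- ?x = ?y =>
    let env := lin_env K V x (@nil (GRing.Lmodule.sort V)) in
    let env := lin_env K V y env in
    let s := lin_term K x env in
    let t := lin_term K y env in
    apply: (@leval_same K V env s t); cbn [size lsame lcoef PeanoNat.Nat.eqb];
    repeat split; first [ring | field]
  end.

(** * Inverse square roots and idempotents in C*-algebras *)

Section NormedSpace.
Variables (R : realType) (V : completeNormedModType R[i]).
Implicit Types (x y : V) (S : set V) (u : nat -> V).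

(** Closure and convergence are restated with real radii, where [lra] and [nra] apply; the filters
    of a normed module over [R[i]] have radii in [R[i]]. *)
Definition approx S x := forall eps : R, 0 < eps -> exists2 s, S s & rnorm (x - s) < eps.

Definition tends u x :=
  forall eps : R, 0 < eps -> exists N, forall n, (N <= n)%N -> rnorm (u n - x) < eps.

Lemma approx_closure S x : approx S x <-> closure S x.
Proof.
split=> [Sx B /nbhs_ballP[e /= e0 eB]|Sx eps e0].
  have er : e = (complex.Re e)%:C by rewrite RRe_real// gtr0_real.
  have [|s Ss xs] := Sx (complex.Re e); first by rewrite -ltcR -er.
  by exists s; split=> //; apply: eB; rewrite -ball_normE /ball_ /= rnormE er ltcR.
have [|s [Ss]] := Sx (ball x eps%:C); first by apply: nbhsx_ballx; rewrite ltcR.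
by rewrite -ball_normE /ball_ /= rnormE ltcR; exists s.
Qed.

Lemma closed_approx S x : closed S -> approx S x -> S x.
Proof. by move=> cS /approx_closure; exact: cS. Qed.

Lemma approx_closed S : (forall x, approx S x -> S x) -> closed S.
Proof. by move=> aS x /approx_closure; exact: aS. Qed.

Lemma tends_closed S u x : closed S -> (forall n, S (u n)) -> tends u x -> S x.
Proof.
move=> cS Su ux; apply: closed_approx => // eps /ux[N /(_ N (leqnn N)) uN].
by exists (u N) => //; rewrite rnormB.
Qed.

Lemma cauchy_tends u :
  (forall eps : R, 0 < eps ->
    exists N, forall n, (N <= n)%N -> rnorm (u n - u N) < eps) ->
  exists x, tends u x.
Proof.
move=> uc.
have cu : cauchy (u @ \oo).
  apply/cauchy_ballP => e e0.
  have er : e = (complex.Re e)%:C by rewrite RRe_real// gtr0_real.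
  have [|N HN] := uc (complex.Re e / 2).
    by rewrite divr_gt0// -ltcR -er.
  exists (u @` [set n | (N <= n)%N], u @` [set n | (N <= n)%N]).
    by split; exists N => // n /= Nn; exists n.
  move=> [_ _] [/= [m Nm <-] [n Nn <-]].
  rewrite -ball_normE /ball_ /= rnormE er ltcR.
  have -> : u m - u n = (u m - u N) - (u n - u N) by rewrite opprB addrA subrK.
  apply: (le_lt_trans (rnormD _ _)); rewrite rnormN.
  have := HN m Nm; have := HN n Nn; lra.
exists (lim (u @ \oo)) => eps e0.
have /cvgrPdist_lt/(_ eps%:C) : u @ \oo --> lim (u @ \oo) by exact: cauchy_cvg.
rewrite ltcR => /(_ e0)[N _ HN]; exists N => n /HN /=.
by rewrite rnormE ltcR rnormB.
Qed.

Lemma tends_unique u x y : tends u x -> tends u y -> x = y.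
Proof.
move=> ux uy; apply/eqP; rewrite -subr_eq0; apply/eqP/rnorm_eq0/le_anti.
rewrite rnorm_ge0 andbT; apply/ler_addgt0Pl => e e0; rewrite addr0.
have [|N HN] := ux (e / 2); first by rewrite divr_gt0.
have [|M HM] := uy (e / 2); first by rewrite divr_gt0.
have := HN _ (leq_maxl N M); have := HM _ (leq_maxr N M).
have -> : x - y = (u (maxn N M) - y) - (u (maxn N M) - x).
  by lin R[i] (V : lmodType R[i]).
have := rnormD (u (maxn N M) - y) (- (u (maxn N M) - x)); rewrite rnormN; lra.
Qed.

Lemma geometric_tends u (C : R) :
  (forall n, rnorm (u n.+1 - u n) <= C * 2^-1 ^+ n) -> exists x, tends u x.
Proof.
move=> uC.
have C0 : 0 <= C by have := uC 0%N; rewrite expr0 mulr1; apply: le_trans; exact: rnorm_ge0.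
(* The factor [1 - 2^-1 ^+ m] of the exact geometric sum lets the induction on [m] close. *)
have tail m n : rnorm (u (m + n)%N - u n) <= 2 * C * 2^-1 ^+ n * (1 - 2^-1 ^+ m).
  elim: m => [|m IH]; first by rewrite add0n subrr rnorm0 expr0 subrr mulr0.
  have -> : u (m.+1 + n)%N - u n = (u (m + n).+1 - u (m + n)%N) + (u (m + n)%N - u n).
    by rewrite addrA subrK.
  apply: (le_trans (rnormD _ _)); apply: (le_trans (lerD (uC _) IH)).
  rewrite exprD exprS le_eqVlt; apply/orP; left; apply/eqP; by field.
apply: cauchy_tends => eps e0.
have [N HN] : exists N, 2 * C * 2^-1 ^+ N < eps.
  have D0 : 0 < eps / (2 * C + 1) by rewrite divr_gt0// ltr_wpDl// mulr_ge0.
  have /cvgrPdist_lt/(_ _ D0)[N _ /(_ N (leqnn N))/=] :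
      (fun n : nat => 2^-1 ^+ n : R) @ \oo --> (0 : R).
    by apply: cvg_expr; rewrite ger0_norm ?invr_ge0// invf_lt1// ltr1n.
  rewrite sub0r normrN ger0_norm ?exprn_ge0 ?invr_ge0// ltr_pdivlMr ?ltr_wpDl ?mulr_ge0//.
  move=> h; exists N; apply: le_lt_trans h; rewrite mulrC ler_wpM2l ?exprn_ge0 ?invr_ge0//; lra.
exists N => n Nn; rewrite -(subnK Nn); apply: le_lt_trans (tail _ _) _.
apply: le_lt_trans HN; rewrite ler_piMr ?mulr_ge0 ?exprn_ge0 ?invr_ge0//.
Qed.

End NormedSpace.

Section CstarNorm.
Variables (R : realType) (A : cstarAlgType R).
Implicit Types x y z k : A.

Lemma rnormM x y : rnorm (cmul x y) <= rnorm x * rnorm y.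
Proof. by rewrite -lecR rmorphM/= -!rnormE; exact: cnormM. Qed.

Lemma rnorm_cstar x : rnorm (cmul (cadj x) x) = rnorm x ^+ 2.
Proof. by apply: complexI; rewrite rmorphXn/= -!rnormE; exact: cnormE. Qed.

Lemma rnorm_adj x : rnorm (cadj x) = rnorm x.
Proof.
suff le y : rnorm y <= rnorm (cadj y).
  by apply/le_anti; rewrite le andbT -{2}(cadjK x) le.
have [y0|y0] := eqVneq (rnorm y) 0; first by rewrite y0 rnorm_ge0.
have yp : 0 < rnorm y by rewrite lt_neqAle eq_sym y0 rnorm_ge0.
by rewrite -(ler_pM2r yp) -expr2 -rnorm_cstar rnormM.
Qed.

Lemma cmulBl x y z : cmul (x - y) z = cmul x z - cmul y z.
Proof. by rewrite cmulDl cmulNl. Qed.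

Lemma cmulBr x y z : cmul x (y - z) = cmul x y - cmul x z.
Proof. by rewrite cmulDr cmulNr. Qed.

Lemma cadjB x y : cadj (x - y) = cadj x - cadj y.
Proof. by rewrite cadjD cadjN. Qed.

(** Commutants, self-adjoint parts, annihilators and finite-dimensional spans are all shown closed
    as kernels of such maps. Only compatibility with subtraction is asked of [f], because the
    adjoint is conjugate-linear. [C] may be negative, hence [|C| + 1] in the proof. *)
Lemma closed_bounded_eq (B : completeNormedModType R[i]) (f : A -> B) (C : R) :
  (forall x y, f (x - y) = f x - f y) -> (forall x, rnorm (f x) <= C * rnorm x) ->
  closed [set x | f x = 0].
Proof.
move=> fB fC; apply: approx_closed => x ax; apply: rnorm_eq0; apply/le_anti.
rewrite rnorm_ge0 andbT; apply/ler_addgt0Pl => e e0; rewrite addr0.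
have D0 : 0 < `|C| + 1 by rewrite ltr_wpDl.
have [|s /= fs xs] := ax (e / (`|C| + 1)); first by rewrite divr_gt0.
have -> : f x = f (x - s) by rewrite fB fs subr0.
apply: (le_trans (fC _)); apply: (@le_trans _ _ ((`|C| + 1) * rnorm (x - s))).
  by rewrite ler_wpM2r ?rnorm_ge0//; have := ler_norm C; lra.
by move: xs; rewrite ltr_pdivlMr// mulrC => /ltW.
Qed.

(* With [e] a unit, a commuting solution satisfies [(e - z)^2 (e - k) = e]. *)
Definition isqrt_step k z := 2^-1 *: (cmul z z - k + cmul k z + cmul k z - cmul k (cmul z z)).

(** For [k] of norm at most 1/5 the step maps the ball of radius 1/4 into itself, with Lipschitz
    constant at most [((1/4 + 1/4) + 2/5 + 1/10) / 2 = 1/2]. The iteration starts at 0, and the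
    closed invariant set [S] hands algebraic properties of the iterates (membership in a subalgebra,
    commutation, self-adjointness) on to the limit. *)
Lemma isqrt_fixpoint k (S : set A) :
  rnorm k <= 5^-1 -> closed S -> S 0 -> (forall z, S z -> S (isqrt_step k z)) ->
  exists2 z, S z & rnorm z <= 4^-1 /\ isqrt_step k z = z.
Proof.
move=> k5 cS S0 Sg.
pose g := isqrt_step k.
have half x : rnorm ((2^-1 : R[i]) *: x) = 2^-1 * rnorm x.
  have -> : (2^-1 : R[i]) = (2^-1 : R)%:C by rewrite fmorphV rmorph_nat.
  by rewrite rnormZr ger0_norm ?invr_ge0.
have k0 := rnorm_ge0 k.
have g_bnd z : rnorm z <= 4^-1 -> rnorm (g z) <= 4^-1.
  move=> z4; have z0 := rnorm_ge0 z.
  rewrite /g /isqrt_step half.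
  have zz := rnormM z z; have kz := rnormM k z; have kzz := rnormM k (cmul z z).
  have h1 := rnormD (cmul z z - k + cmul k z + cmul k z) (- cmul k (cmul z z)).
  have h2 := rnormD (cmul z z - k + cmul k z) (cmul k z).
  have h3 := rnormD (cmul z z - k) (cmul k z).
  have h4 := rnormD (cmul z z) (- k).
  rewrite !rnormN in h1 h4.
  have zz16 : rnorm (cmul z z) <= 16^-1 by apply: (le_trans zz); nra.
  have kz20 : rnorm (cmul k z) <= 20^-1 by apply: (le_trans kz); nra.
  have kzz80 : rnorm (cmul k (cmul z z)) <= 80^-1.
    by apply: (le_trans kzz); have := rnorm_ge0 (cmul z z); nra.
  lra.
have g_lip z w : rnorm z <= 4^-1 -> rnorm w <= 4^-1 ->
    rnorm (g z - g w) <= 2^-1 * rnorm (z - w).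
  move=> z4 w4; have z0 := rnorm_ge0 z; have w0 := rnorm_ge0 w.
  set d := z - w.
  have zw : cmul z z - cmul w w = cmul z d + cmul d w.
    by rewrite /d cmulBr cmulBl addrA subrK.
  have -> : g z - g w = 2^-1 *: (cmul z d + cmul d w
      + (cmul k d + cmul k d - cmul k (cmul z d + cmul d w))).
    rewrite /g /isqrt_step -scalerBr; congr (_ *: _).
    rewrite -zw /d !cmulBr.
    set p := cmul z z; set q := cmul w w; set r := cmul k p; set s := cmul k q.
    set t := cmul k z; set v := cmul k w.
    by lin R[i] (A : lmodType R[i]).
  rewrite half ler_wpM2l ?invr_ge0//.
  have d0 := rnorm_ge0 d.
  have zd : rnorm (cmul z d) <= 4^-1 * rnorm d by apply: (le_trans (rnormM _ _)); nra.
  have dw : rnorm (cmul d w) <= 4^-1 * rnorm d by apply: (le_trans (rnormM _ _)); nra.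
  have s1 := rnormD (cmul z d) (cmul d w).
  have s2 : rnorm (cmul k (cmul z d + cmul d w)) <= 10^-1 * rnorm d.
    apply: (le_trans (rnormM _ _)).
    have := rnorm_ge0 (cmul z d + cmul d w); nra.
  have s3 : rnorm (cmul k d) <= 5^-1 * rnorm d by apply: (le_trans (rnormM _ _)); nra.
  have t1 := rnormD (cmul z d + cmul d w) (cmul k d + cmul k d - cmul k (cmul z d + cmul d w)).
  have t2 := rnormD (cmul k d + cmul k d) (- cmul k (cmul z d + cmul d w)).
  have t3 := rnormD (cmul k d) (cmul k d).
  rewrite rnormN in t2; lra.
have gE : isqrt_step k = g by [].
rewrite gE in Sg *; clearbody g; clear gE.
pose u n := iter n g 0.
have uS n : S (u n) by elim: n => //= n IH; exact: Sg.
have u4 n : rnorm (u n) <= 4^-1.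
  by elim: n => [|n IH] /=; [rewrite rnorm0 invr_ge0 | exact: g_bnd].
have uC n : rnorm (u n.+1 - u n) <= 4^-1 * 2^-1 ^+ n.
  elim: n => [|n IH]; first by rewrite /u/= subr0 expr0 mulr1; exact: (u4 1%N).
  apply: (le_trans (g_lip (u n.+1) (u n) (u4 _) (u4 _))).
  by rewrite exprS mulrCA ler_wpM2l ?invr_ge0.
have [z uz] := geometric_tends uC.
have z4 : rnorm z <= 4^-1.
  apply/ler_addgt0Pl => e e0; have [N /(_ N (leqnn N))] := uz _ e0.
  have -> : z = u N - (u N - z) by rewrite subKr.
  rewrite subKr; have := rnormD (u N) (- (u N - z)); rewrite rnormN; have := u4 N; lra.
exists z; first exact: tends_closed cS uS uz.
split=> //; apply: (@tends_unique _ _ u) => //.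
move=> eps /uz[N HN]; exists N.+1 => -[//|n] Nn.
apply: le_lt_trans (HN n Nn); apply: le_trans (g_lip _ _ (u4 _) z4) _.
by have := rnorm_ge0 (u n - z); lra.
Qed.

Lemma isqrt_step_comm k y c : cmul k c = cmul c k -> cmul y c = cmul c y ->
  cmul (isqrt_step k y) c = cmul c (isqrt_step k y).
Proof.
move=> kc yc.
have kyc : cmul (cmul k y) c = cmul c (cmul k y) by rewrite -cmulA yc cmulA kc cmulA.
have yyc : cmul (cmul y y) c = cmul c (cmul y y) by rewrite -cmulA yc cmulA yc cmulA.
have kyyc : cmul (cmul k (cmul y y)) c = cmul c (cmul k (cmul y y)).
  by rewrite -cmulA yyc cmulA kc -cmulA.
by rewrite /isqrt_step cmulZl cmulZr cmulBl cmulBr !cmulDl !cmulDr cmulNl cmulNr yyc kyc kyyc kc.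
Qed.

(** The product expands to [e - 2 y + (y^2 - k + 2 k y - k y^2)], and the bracket is [2 y] by the
    fixed-point equation. The element [e] is a unit only for [k] and [S], since the lemma is applied
    to subalgebras with units of their own. *)
Lemma isqrt_inverse k e (S : set A) :
  rnorm k <= 5^-1 -> closed S -> S 0 -> (forall y, S y -> S (isqrt_step k y)) ->
  cmul e e = e -> cmul e k = k -> cmul k e = k ->
  (forall y, S y -> [/\ cmul e y = y, cmul y e = y & cmul y k = cmul k y]) ->
  exists2 y, S y & rnorm y <= 4^-1 /\ cmul (e - k) (cmul (e - y) (e - y)) = e.
Proof.
move=> k5 cS S0 Sg ee ek ke Se; have [y Sy [y4 yE]] := isqrt_fixpoint k5 cS S0 Sg.
exists y => //; split=> //; have [ey ye yk] := Se _ Sy.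
have yE2 : y + y = cmul y y - k + cmul k y + cmul k y - cmul k (cmul y y).
  by rewrite -{1 2}yE /isqrt_step; lin R[i] (A : lmodType R[i]).
have eyy : cmul e (cmul y y) = cmul y y by rewrite cmulA ey.
rewrite !(cmulBl, cmulBr) !(ee, ek, ke, ey, ye, eyy).
set T := RHS in yE2.
transitivity (e - (y + y) + T); last by rewrite yE2 subrK.
by rewrite /T; lin R[i] (A : lmodType R[i]).
Qed.

Lemma commutant_closed c : closed [set y : A | cmul y c = cmul c y].
Proof.
have -> : [set y : A | cmul y c = cmul c y] = [set y | cmul y c - cmul c y = 0].
  by apply/seteqP; split=> y /= /eqP h; apply/eqP; rewrite ?subr_eq0// -subr_eq0.
apply: (@closed_bounded_eq _ _ (2 * rnorm c)) => [x y|x].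
  by rewrite cmulBl cmulBr; lin R[i] (A : lmodType R[i]).
have := rnormD (cmul x c) (- cmul c x); rewrite rnormN.
by have := rnormM x c; have := rnormM c x; lra.
Qed.

Lemma selfadj_closed : closed [set y : A | cadj y = y].
Proof.
have -> : [set y : A | cadj y = y] = [set y | cadj y - y = 0].
  by apply/seteqP; split=> y /= /eqP h; apply/eqP; rewrite ?subr_eq0// -subr_eq0.
apply: (@closed_bounded_eq _ _ 2) => [x y|x].
  by rewrite cadjB; lin R[i] (A : lmodType R[i]).
by have := rnormD (cadj x) (- x); rewrite rnormN rnorm_adj; lra.
Qed.

Lemma projection_norm (p : A) : cmul p p = p -> cadj p = p -> p = 0 \/ rnorm p = 1.
Proof.
move=> pp pa; have : rnorm p = rnorm p ^+ 2 by rewrite -rnorm_cstar pa pp.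
move=> /eqP; rewrite expr2 -{1}[rnorm p]mulr1 -subr_eq0 -mulrBr mulf_eq0 subr_eq0.
by move=> /orP[/eqP/rnorm_eq0|/eqP]; [left|right].
Qed.

Section Subalgebra.
Variable T : set A.
Hypothesis Ts : is_cstar_subalg T.

Lemma csubZ (a : R[i]) x : T x -> T (a *: x).
Proof. by move=> Tx; have := csubZD Ts a Tx (csub0 Ts); rewrite addr0. Qed.

Lemma csubD x y : T x -> T y -> T (x + y).
Proof. by move=> Tx Ty; have := csubZD Ts 1 Tx Ty; rewrite scale1r. Qed.

Lemma csubB x y : T x -> T y -> T (x - y).
Proof. by move=> Tx Ty; rewrite -scaleN1r; apply: csubD => //; exact: csubZ. Qed.

End Subalgebra.

(** The iterates are polynomials in [k], so they stay in [T] and commute with everything in [C];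
    both conditions are closed. Having [k] in [C] makes the solution commute with [k]. *)
Lemma isqrt_commutant (T : set A) e k (C : set A) : is_cstar_subalg T -> T e -> T k ->
  (forall y, T y -> cmul e y = y /\ cmul y e = y) ->
  C k -> (forall c, C c -> cmul k c = cmul c k) -> rnorm k <= 5^-1 ->
  exists2 y, T y & [/\ rnorm y <= 4^-1, forall c, C c -> cmul y c = cmul c y
    & cmul (e - k) (cmul (e - y) (e - y)) = e].
Proof.
move=> Ts Te Tk eP Ck kC k5; have TM := csubM Ts.
have TD := csubD Ts; have TZ := csubZ Ts; have TB := csubB Ts.
pose S := T `&` \bigcap_(c in C) [set y | cmul y c = cmul c y].
have cS : closed S.
  by apply: closedI; [exact: csub_closed Ts|]; apply: closed_bigI => c _; exact: commutant_closed.
have S0 : S 0 by split=> [|c _ /=]; rewrite ?cmul0l ?cmul0r//; exact: csub0 Ts.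
have Sg y : S y -> S (isqrt_step k y).
  move=> [Ty yC]; split; last first.
    by move=> c Cc; apply: isqrt_step_comm; [exact: kC|exact: yC].
  have Tyy : T (cmul y y) by exact: TM.
  have Tky : T (cmul k y) by exact: TM.
  have Tkyy : T (cmul k (cmul y y)) by exact: TM.
  by apply/TZ/(TB _ _ _ Tkyy)/(TD _ _ _ Tky)/(TD _ _ _ Tky)/TB.
have Se y : S y -> [/\ cmul e y = y, cmul y e = y & cmul y k = cmul k y].
  by move=> [Ty yC]; have [] := eP _ Ty; split=> //; exact: yC.
have [ee _] := eP _ Te; have [ek ke] := eP _ Tk.
by have [y [Ty yC] [y4 yE]] := isqrt_inverse k5 cS S0 Sg ee ek ke Se; exists y.
Qed.

(* Functional calculus for the spectral projection of [x] near [1]: with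
   [s = 2 x - e] one has [s^2 = e - k], so that [s (e - k)^(-1/2)] is an involution. *)
Lemma idempotent_near (T : set A) e q x : is_cstar_subalg T -> T e -> T x ->
  (forall y, T y -> cmul e y = y /\ cmul y e = y) ->
  cadj e = e -> cmul q q = q -> cadj q = q ->
  rnorm (x - q) <= 100^-1 ->
  exists2 p, T p & cmul p p = p /\ rnorm (p - q) <= 2 / 5.
Proof.
move=> Ts Te Tx eP ea qq qa xq; have TM := csubM Ts.
have TD := csubD Ts; have TZ := csubZ Ts; have TB := csubB Ts.
have [ee _] := eP _ Te; have [ex xe] := eP _ Tx.
have proj1 (p : A) : cmul p p = p -> cadj p = p -> rnorm p <= 1.
  by move=> pp /(projection_norm pp)[->|->]; rewrite ?rnorm0.
have e1 := proj1 _ ee ea; have q1 := proj1 _ qq qa.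
set d := x - q in xq; have xE : x = q + d by rewrite /d addrC subrK.
have d0 := rnorm_ge0 d.
pose k := (4 : R)%:C *: (x - cmul x x).
have k5 : rnorm k <= 5^-1.
  rewrite rnormZr ger0_norm//.
  (* Because [q] is idempotent, [x - x^2] is of first order in [d], and
     [4 (3 + 1/100) / 100 < 1/5]. *)
  have -> : x - cmul x x = d - (cmul q d + cmul d q + cmul d d).
    by rewrite xE !(cmulDl, cmulDr) qq; lin R[i] (A : lmodType R[i]).
  have h1 := rnormD d (- (cmul q d + cmul d q + cmul d d)); rewrite rnormN in h1.
  have h2 := rnormD (cmul q d + cmul d q) (cmul d d).
  have h3 := rnormD (cmul q d) (cmul d q).
  have h4 : rnorm (cmul q d) <= rnorm d.
    by apply: (le_trans (rnormM _ _)); rewrite ler_piMl.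
  have h5 : rnorm (cmul d q) <= rnorm d.
    by apply: (le_trans (rnormM _ _)); rewrite ler_piMr.
  have h6 : rnorm (cmul d d) <= 100^-1 * rnorm d.
    by apply: (le_trans (rnormM _ _)); rewrite ler_wpM2r.
  lra.
have Tk : T k by apply: TZ; apply: TB => //; exact: TM.
have xk : cmul k x = cmul x k.
  by rewrite /k cmulZl cmulZr cmulBl cmulBr cmulA.
have [y Ty [y4 yC yE]] : exists2 y, T y & [/\ rnorm y <= 4^-1,
    forall c, c = x \/ c = k -> cmul y c = cmul c y
    & cmul (e - k) (cmul (e - y) (e - y)) = e].
  by apply: isqrt_commutant => //; [right|move=> c [->|->]].
have yx : cmul y x = cmul x y by apply: yC; left.
have [ey ye] := eP _ Ty.
pose s := 2 *: x - e.
have Ts' : T s by apply: TB => //; exact: TZ.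
have [es se] := eP _ Ts'.
have ss : cmul s s = e - k.
  rewrite /s /k !(cmulBl, cmulBr, cmulZl, cmulZr) ee ex xe.
  have -> : (4 : R)%:C = 4 :> R[i] by rewrite rmorph_nat.
  by lin R[i] (A : lmodType R[i]).
pose w := e - y.
have sw : cmul w s = cmul s w.
  rewrite /w /s !(cmulBl, cmulBr, cmulZl, cmulZr) ee ex xe ey ye yx.
  by lin R[i] (A : lmodType R[i]).
have invol : cmul (cmul s w) (cmul s w) = e.
  by rewrite -cmulA (cmulA w) sw -cmulA cmulA ss.
have Tsw : T (cmul s w) by apply: TM => //; exact: TB.
have [esw swe] := eP _ Tsw.
have half t : cmul e t = t -> cmul t e = t -> cmul t t = e ->
    cmul (2^-1 *: (e + t)) (2^-1 *: (e + t)) = 2^-1 *: (e + t).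
  move=> et te tt; rewrite !(cmulZl, cmulZr, cmulDl, cmulDr) !(ee, et, te, tt).
  by lin R[i] (A : lmodType R[i]).
exists (2^-1 *: (e + cmul s w)); first by apply: TZ; exact: TD.
split; first exact: half.
(* Here [(e + s) / 2 = x] and [s w = s - s y]. The bounds 3.02 for [s] and 1/4 for [y] give a
   distance of at most 0.3875; 2/5 is a convenient upper bound because its square is below the 1/5
   required of [(p - q)^2] by the similarity argument. *)
have -> : 2^-1 *: (e + cmul s w) - q = d - (2^-1 : R)%:C *: cmul s y.
  have -> : (2^-1 : R)%:C = 2^-1 :> R[i] by rewrite fmorphV rmorph_nat.
  rewrite /w cmulBr se {1}/s /d.
  by lin R[i] (A : lmodType R[i]).
apply: (le_trans (rnormD _ _)); rewrite rnormN rnormZr ger0_norm ?invr_ge0//.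
have h1 := rnormM s y.
have h2 : rnorm s <= 3 + 2 / 100.
  have -> : s = (2 : R)%:C *: x - e by rewrite rmorph_nat.
  have := rnormD ((2 : R)%:C *: x) (- e); rewrite rnormN rnormZr ger0_norm//.
  have := rnormD q d; rewrite -xE; lra.
have s0 := rnorm_ge0 s; have y0 := rnorm_ge0 y.
have h3 : rnorm s * rnorm y <= (3 + 2 / 100) * 4^-1 by exact: ler_pM.
lra.
Qed.

(* With [k = (p - q)^2] and [w = q p + (e - q) (e - p)] one has
   [w w' = w' w = e - k] for the adjoint-like [w' = p q + (e - p) (e - q)]. *)
Lemma close_idempotents_similar (T : set A) e p q : is_cstar_subalg T -> T e ->
  (forall y, T y -> cmul e y = y /\ cmul y e = y) -> T p -> T q ->
  cmul p p = p -> cmul q q = q -> rnorm (p - q) <= 2 / 5 ->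
  exists w v, [/\ T w, T v, cmul w v = e, cmul v w = e & cmul q w = cmul w p].
Proof.
move=> Ts Te eP Tp Tq pp qq pq; have TM := csubM Ts.
have TD := csubD Ts; have TZ := csubZ Ts; have TB := csubB Ts.
have [ee _] := eP _ Te; have [ep pe] := eP _ Tp; have [eq' qe] := eP _ Tq.
pose k := cmul (p - q) (p - q).
have k5 : rnorm k <= 5^-1.
  apply: (le_trans (rnormM _ _)); have := rnorm_ge0 (p - q); nra.
have Tk : T k by apply: TM; exact: TB.
have pqp : cmul (cmul p q) p = cmul p (cmul q p) by rewrite cmulA.
have qpq : cmul (cmul q p) q = cmul q (cmul p q) by rewrite cmulA.
have ppq : cmul p (cmul p q) = cmul p q by rewrite cmulA pp.
have qqp : cmul q (cmul q p) = cmul q p by rewrite cmulA qq.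
have qpp : cmul (cmul q p) p = cmul q p by rewrite -cmulA pp.
have pqq : cmul (cmul p q) q = cmul p q by rewrite -cmulA qq.
have kE : k = p - cmul p q - cmul q p + q.
  by rewrite /k !(cmulBl, cmulBr) pp qq; lin R[i] (A : lmodType R[i]).
have kp : cmul k p = cmul p k.
  rewrite kE !(cmulBl, cmulBr, cmulDl, cmulDr) pp ppq qpp pqp.
  by lin R[i] (A : lmodType R[i]).
have kq : cmul k q = cmul q k.
  rewrite kE !(cmulBl, cmulBr, cmulDl, cmulDr) qq qqp pqq qpq.
  by lin R[i] (A : lmodType R[i]).
have [y Ty [y4 yC yE]] : exists2 y, T y & [/\ rnorm y <= 4^-1,
    forall c, [\/ c = p, c = q | c = k] -> cmul y c = cmul c y
    & cmul (e - k) (cmul (e - y) (e - y)) = e].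
  by apply: isqrt_commutant => //; [constructor 3|move=> c [->|->|->]].
have yp : cmul y p = cmul p y by apply: yC; constructor 1.
have yq : cmul y q = cmul q y by apply: yC; constructor 2.
have yk : cmul y k = cmul k y by apply: yC; constructor 3.
have [ey ye] := eP _ Ty; have [ek ke] := eP _ Tk.
pose u := cmul (e - y) (e - y).
have Tu : T u by apply: TM; exact: TB.
have com_u c : T c -> cmul y c = cmul c y -> cmul u c = cmul c u.
  move=> Tc' yc; have [ec ce] := eP _ Tc'.
  have h : cmul (e - y) c = cmul c (e - y) by rewrite cmulBl cmulBr ec ce yc.
  by rewrite /u -cmulA h cmulA h cmulA.
have uk : cmul u (e - k) = e.
  rewrite com_u//; first exact: TB.
  by rewrite cmulBl cmulBr ey ye yk.
pose w := 2 *: cmul q p - q - p + e.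
pose w' := 2 *: cmul p q - p - q + e.
have Tw : T w by apply: (TD) => //; do 2 apply: (TB) => //; apply: TZ; exact: TM.
have Tw' : T w' by apply: (TD) => //; do 2 apply: (TB) => //; apply: TZ; exact: TM.
have yw : cmul y w = cmul w y.
  have yqp : cmul y (cmul q p) = cmul (cmul q p) y by rewrite cmulA yq -cmulA yp cmulA.
  by rewrite /w !(cmulBl, cmulBr, cmulDl, cmulDr, cmulZl, cmulZr) yqp yp yq ye ey.
have [_ pqe] := eP _ (TM _ _ Tp Tq); have [_ qpe] := eP _ (TM _ _ Tq Tp).
have ww' : cmul w w' = e - k.
  rewrite kE /w /w' !(cmulBl, cmulBr, cmulDl, cmulDr, cmulZl, cmulZr).
  rewrite !cmulA !(qpp, qq, pp, ee, ep, pe, eq', qe, pqe, qpe).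
  by lin R[i] (A : lmodType R[i]).
have w'w : cmul w' w = e - k.
  rewrite kE /w /w' !(cmulBl, cmulBr, cmulDl, cmulDr, cmulZl, cmulZr).
  rewrite !cmulA !(pqq, qq, pp, ee, ep, pe, eq', qe, pqe, qpe).
  by lin R[i] (A : lmodType R[i]).
(* Since [u] inverts [e - k] and commutes with [w], the element [u w'] is a two-sided inverse of
   [w]; both [q w] and [w p] are equal to [q p]. *)
exists w, (cmul u w'); split=> //; first exact: TM.
- by rewrite cmulA -(com_u w)// -cmulA ww' uk.
- by rewrite -cmulA w'w uk.
- rewrite /w !(cmulBl, cmulBr, cmulDl, cmulDr, cmulZl, cmulZr) !(qqp, qq, pp, qpp, qe, ep).
  by lin R[i] (A : lmodType R[i]).
Qed.

End CstarNorm.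

(** * Automatic continuity *)

Section Tends.
Variables (R : realType).

Lemma tendsZD (V : completeNormedModType R[i]) (a : R[i]) (u v : nat -> V) x y :
  tends u x -> tends v y -> tends (fun n => a *: u n + v n) (a *: x + y).
Proof.
move=> ux vy eps e0.
pose c := complex.Re `|a|; have c0 : 0 <= c by exact: Re_normC_ge0.
have d0 : 0 < eps / (c + 1) by rewrite divr_gt0// ltr_wpDl.
have [N HN] := ux _ d0; have [M HM] := vy _ d0.
exists (maxn N M) => n; rewrite geq_max => /andP[nN nM].
have -> : a *: u n + v n - (a *: x + y) = a *: (u n - x) + (v n - y).
  by rewrite scalerBr; lin R[i] (V : lmodType R[i]).
apply: (le_lt_trans (rnormD _ _)); rewrite rnormZ -/c.
have e1 : eps = eps / (c + 1) * (c + 1) by rewrite mulfVK// gt_eqF// ltr_wpDl.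
have u0 := rnorm_ge0 (u n - x); have v0 := rnorm_ge0 (v n - y).
set d := eps / _ in d0 e1 HN HM.
have h1 : rnorm (u n - x) < d by exact: HN.
have h2 : rnorm (v n - y) < d by exact: HM.
rewrite e1; nra.
Qed.

Variables (A : cstarAlgType R).

Lemma tendsM (u v : nat -> A) x y :
  tends u x -> tends v y -> tends (fun n => cmul (u n) (v n)) (cmul x y).
Proof.
move=> ux vy eps e0.
have x0 := rnorm_ge0 x; have y0 := rnorm_ge0 y.
have p0 : 0 < rnorm x + rnorm y + 2 by rewrite ltr_wpDl// addr_ge0.
have d0 : 0 < eps / (rnorm x + rnorm y + 2) by rewrite divr_gt0.
have [N HN] := ux _ d0; have [M HM] := vy _ d0; have [P HP] := vy _ ltr01.
exists (maxn N (maxn M P)) => n; rewrite !geq_max => /and3P[/HN h1 /HM h2 /HP h3].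
have -> : cmul (u n) (v n) - cmul x y = cmul (u n - x) (v n) + cmul x (v n - y).
  by rewrite cmulBl cmulBr addrA subrK.
apply: (le_lt_trans (rnormD _ _)).
have m1 := rnormM (u n - x) (v n); have m2 := rnormM x (v n - y).
have vb : rnorm (v n) <= rnorm y + 1.
  have := rnormD (v n - y) y; rewrite subrK; lra.
have e1 : eps = eps / (rnorm x + rnorm y + 2) * (rnorm x + rnorm y + 2).
  by rewrite mulfVK// gt_eqF.
set d := eps / _ in h1 h2 d0 e1.
have u0 := rnorm_ge0 (u n - x); have v0 := rnorm_ge0 (v n - y).
rewrite e1; nra.
Qed.

Lemma tends_adj (u : nat -> A) x : tends u x -> tends (fun n => cadj (u n)) (cadj x).
Proof.
move=> ux eps e0; have [N HN] := ux _ e0; exists N => n /HN.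
by rewrite -cadjB rnorm_adj.
Qed.

Lemma tends_cst (V : completeNormedModType R[i]) (x : V) : tends (fun=> x) x.
Proof. by move=> eps e0; exists 0%N => n _; rewrite subrr rnorm0. Qed.

Lemma approx_tends (V : completeNormedModType R[i]) (S : set V) x :
  approx S x -> exists2 u : nat -> V, (forall n, S (u n)) & tends u x.
Proof.
move=> Sx.
have /choice[u uP] : forall n : nat, exists s, S s /\ rnorm (x - s) < n.+1%:R^-1.
  by move=> n; have [|s Ss xs] := Sx (n.+1%:R^-1); [rewrite invr_gt0|exists s].
exists u => [n|eps e0]; first by have [] := uP n.
have [N _ HN] := near_infty_natSinv_lt (PosNum e0).
exists N => n /HN /= h; rewrite rnormB; have [_ h'] := uP n; exact: lt_trans h.
Qed.

End Tends.

Section StarHom.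
Variables (R : realType) (A B : cstarAlgType R) (f : A -> B).
Hypothesis f_hom : star_hom f.

Lemma star_homD x y : f (x + y) = f x + f y.
Proof. by have [fl _ _] := f_hom; have := fl 1 x y; rewrite !scale1r. Qed.

Lemma star_hom0 : f 0 = 0.
Proof. by apply: (@addrI _ (f 0)); rewrite -star_homD !addr0. Qed.

Lemma star_homZ a x : f (a *: x) = a *: f x.
Proof. by have [fl _ _] := f_hom; have := fl a x 0; rewrite star_hom0 !addr0. Qed.

Lemma star_homN x : f (- x) = - f x.
Proof. by rewrite -[- x]scaleN1r star_homZ scaleN1r. Qed.

Lemma star_homB x y : f (x - y) = f x - f y.
Proof. by rewrite star_homD star_homN. Qed.

Lemma star_homM x y : f (cmul x y) = cmul (f x) (f y).
Proof. by have [_ ->] := f_hom. Qed.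

Lemma star_hom_adj x : f (cadj x) = cadj (f x).
Proof. by have [_ _ ->] := f_hom. Qed.

End StarHom.

Section Automatic.
Variables (R : realType) (A : cstarAlgType R) (e : A).
Hypothesis eP : forall x : A, cmul e x = x /\ cmul x e = x.

Let e1 x : cmul e x = x. Proof. by have [] := eP x. Qed.
Let e2 x : cmul x e = x. Proof. by have [] := eP x. Qed.

Lemma unit_adj : cadj e = e.
Proof. by rewrite -[RHS]cadjK -[in RHS](e2 (cadj e)) cadjM cadjK e2. Qed.

(* A self-adjoint [h] of norm at most [2/5] is the real part of the unitary
   [h + i sqrt (e - h^2)], and *-homomorphisms map unitaries to partial
   isometries; hence they are continuous. *)
Lemma selfadj_unitary h : cadj h = h -> rnorm h <= 2 / 5 ->
  exists2 u : A, cmul (cadj u) u = e & h = 2^-1 *: (u + cadj u).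
Proof.
move=> hh h5.
pose k := cmul h h.
have k5 : rnorm k <= 5^-1.
  by apply: (le_trans (rnormM _ _)); have := rnorm_ge0 h; nra.
pose S := [set z : A | cadj z = z] `&` [set z | cmul z h = cmul h z].
have cS : closed S.
  by apply: closedI; [exact: selfadj_closed|exact: commutant_closed].
have comk z : cmul z h = cmul h z -> cmul z k = cmul k z.
  by move=> zh; rewrite /k cmulA zh -cmulA zh cmulA.
have hi : Num.conj (2^-1 : R[i]) = 2^-1 by rewrite fmorphV rmorph_nat.
have S0 : S 0 by split; rewrite /= ?cadj0 ?cmul0l ?cmul0r.
have kh : cmul k h = cmul h k by rewrite /k cmulA.
have ka : cadj k = k by rewrite /k cadjM hh.
have Sg z : S z -> S (isqrt_step k z).
  move=> [/= za zh]; have zk := comk _ zh.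
  have zza : cadj (cmul z z) = cmul z z by rewrite cadjM za.
  split; last exact: isqrt_step_comm.
  rewrite /= /isqrt_step cadjZ hi cadjB !cadjD cadjN (cadjM k (cmul z z)) (cadjM k z) zza ka za zk.
  by congr (_ *: (_ - _)); rewrite -cmulA zk cmulA zk cmulA.
have Se z : S z -> [/\ cmul e z = z, cmul z e = z & cmul z k = cmul k z].
  by move=> [/= _ /comk].
have [z [/= za zh] [_ mww]] := isqrt_inverse k5 cS S0 Sg (e1 e) (e1 k) (e2 k) Se.
pose m := e - k; pose w := e - z; rewrite -/m -/w in mww.
have zk := comk _ zh.
have mw : cmul m w = cmul w m.
  by rewrite /m /w !cmulBl !cmulBr !e1 !e2 zk; lin R[i] (A : lmodType R[i]).
(* As [m w^2 = e], the element [m w] is a square root of [m = e - h^2]. *)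
pose c := cmul m w.
have cc : cmul c c = m.
  by rewrite /c -cmulA (cmulA w) -mw -cmulA mww e2.
have ca : cadj c = c.
  by rewrite /c cadjM /m /w !cadjB unit_adj za /k cadjM hh -mw.
have ch : cmul c h = cmul h c.
  have wh : cmul w h = cmul h w by rewrite /w cmulBl cmulBr e1 e2 zh.
  have mh : cmul m h = cmul h m by rewrite /m cmulBl cmulBr e1 e2 kh.
  by rewrite /c -cmulA wh cmulA mh -cmulA.
have ua : cadj (h + 'i *: c) = h - 'i *: c.
  by rewrite cadjD cadjZ hh ca conjCi scaleNr.
exists (h + 'i *: c).
  rewrite ua cmulBl !cmulDr !cmulZl !cmulZr ch scalerA -expr2 sqrCi cc /m -/k.
  by lin R[i] (A : lmodType R[i]).
by rewrite ua; lin R[i] (A : lmodType R[i]).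
Qed.

(** A self-adjoint [h] of norm at most 2/5 goes to the mean of [f u] and its adjoint, hence to norm
    at most 1. For [h = s x^* x], with [s] scaled so that [h] has norm 2/5, the C*-identity gives
    [|f x|^2 <= 5/2 |x|^2], and 2 is a rounded square root. Any constant would serve for extension
    by continuity. *)
Lemma star_hom_bounded (B : cstarAlgType R) (f : A -> B) x :
  star_hom f -> rnorm (f x) <= 2 * rnorm x.
Proof.
move=> fh.
have half (V : completeNormedModType R[i]) (y : V) : rnorm ((2^-1 : R[i]) *: y) = 2^-1 * rnorm y.
  have -> : (2^-1 : R[i]) = (2^-1 : R)%:C by rewrite fmorphV rmorph_nat.
  by rewrite rnormZr ger0_norm ?invr_ge0.
have fe : rnorm (f e) <= 1.
  have : rnorm (f e) = rnorm (f e) ^+ 2.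
    by rewrite -rnorm_cstar -star_hom_adj// -star_homM// e2 unit_adj.
  have := rnorm_ge0 (f e); rewrite expr2 => h1 h2.
  by rewrite leNgt; apply/negP => h3; nra.
have fsa h : cadj h = h -> rnorm h <= 2 / 5 -> rnorm (f h) <= 1.
  move=> hh /(selfadj_unitary hh)[u uu ->].
  rewrite star_homZ// star_homD// half star_hom_adj//.
  have : rnorm (f u) ^+ 2 <= 1.
    by rewrite -rnorm_cstar -star_hom_adj// -star_homM// uu.
  have := rnormD (f u) (cadj (f u)); rewrite rnorm_adj.
  have := rnorm_ge0 (f u); nra.
have [x0|x0] := eqVneq (rnorm x) 0.
  by rewrite (rnorm_eq0 x0) star_hom0// !rnorm0 mulr0.
have xp : 0 < rnorm x by rewrite lt_neqAle eq_sym x0 rnorm_ge0.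
set t := rnorm x in xp x0 *.
pose s := 2 / 5 / t ^+ 2.
have s0 : 0 < s by rewrite !divr_gt0// exprn_gt0.
have st : s * t ^+ 2 = 2 / 5 by rewrite /s mulfVK// expf_neq0.
have sr : Num.conj s%:C = s%:C :> R[i] by exact: conjc_real.
have := fsa (s%:C *: cmul (cadj x) x).
rewrite cadjZ cadjM cadjK sr rnormZr gtr0_norm// rnorm_cstar -/t st.
move=> /(_ erefl (lexx _)).
rewrite star_homZ// star_homM// star_hom_adj// rnormZr gtr0_norm// rnorm_cstar.
move=> sf; rewrite -(@ler_pXn2r _ 2) ?nnegrE ?rnorm_ge0//; last lra.
rewrite -(ler_pM2l s0).
have -> : s * (2 * t) ^+ 2 = 4 * (s * t ^+ 2) by ring.
rewrite st; lra.
Qed.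

End Automatic.

(** * Direct limits *)

Section Extension.
Variables (R : realType) (A B : cstarAlgType R) (U : set A) (u : A -> B) (C : R).
Hypothesis U_ZD : forall (a : R[i]) x y, U x -> U y -> U (a *: x + y).
Hypothesis U_M : forall x y, U x -> U y -> U (cmul x y).
Hypothesis U_adj : forall x, U x -> U (cadj x).
Hypothesis u_ZD : forall (a : R[i]) x y, U x -> U y -> u (a *: x + y) = a *: u x + u y.
Hypothesis u_M : forall x y, U x -> U y -> u (cmul x y) = cmul (u x) (u y).
Hypothesis u_adj : forall x, U x -> u (cadj x) = cadj (u x).
Hypothesis u_bounded : forall x, U x -> rnorm (u x) <= C * rnorm x.

Let uB x y : U x -> U y -> u (x - y) = u x - u y.
Proof. by move=> Ux Uy; have := u_ZD (-1) Uy Ux; rewrite !scaleN1r ![- _ + _]addrC. Qed.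

Let U_B x y : U x -> U y -> U (x - y).
Proof. by move=> Ux Uy; have := U_ZD (-1) Uy Ux; rewrite scaleN1r addrC. Qed.

(** The closure of the graph of [u] restricted to [U]; [u] is a total function about which nothing
    is known outside [U]. Boundedness makes this relation single-valued and total on the closure of
    [U], and each algebraic law then follows by uniqueness of limits. *)
Let graph x y :=
  exists s : nat -> A, [/\ forall n, U (s n), tends s x & tends (fun n => u (s n)) y].

Let C1 : 0 < `|C| + 1. Proof. by rewrite ltr_wpDl. Qed.

Let u_bounded1 x y : U x -> U y -> rnorm (u x - u y) <= (`|C| + 1) * rnorm (x - y).
Proof.
move=> Ux Uy; rewrite -uB//; apply: (le_trans (u_bounded (U_B Ux Uy))).
by rewrite ler_wpM2r ?rnorm_ge0//; have := ler_norm C; lra.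
Qed.

Let graph_unique x y z : graph x y -> graph x z -> y = z.
Proof.
move=> [s [Us sx sy]] [t [Ut tx tz]]; apply: (tends_unique sy).
move=> e e0.
have d0 : 0 < e / (4 * (`|C| + 1)) by rewrite divr_gt0// mulr_gt0.
have [N HN] := sx _ d0; have [M HM] := tx _ d0.
have [P HP] := tz _ (divr_gt0 e0 (@ltr0n R 2)).
exists (maxn N (maxn M P)) => n; rewrite !geq_max => /and3P[/HN h1 /HM h2 /HP h3].
have h4 := u_bounded1 (Us n) (Ut n).
have h5 : rnorm (s n - t n) <= rnorm (s n - x) + rnorm (t n - x).
  have -> : s n - t n = (s n - x) - (t n - x) by rewrite opprB addrA subrK.
  by apply: (le_trans (rnormD _ _)); rewrite rnormN.
have h6 : rnorm (u (s n) - z) <= rnorm (u (s n) - u (t n)) + rnorm (u (t n) - z).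
  by rewrite -{1}[u (s n)](subrK (u (t n))) -addrA rnormD.
have e1 : e = e / (4 * (`|C| + 1)) * (4 * (`|C| + 1)).
  by rewrite mulfVK// gt_eqF// mulr_gt0.
set d := e / (4 * _) in d0 h1 h2 e1.
have s0 := rnorm_ge0 (s n - t n).
move: C1 h3; rewrite e1; set c := `|C| + 1 in h4 *; nra.
Qed.

Let graph_total x : approx U x -> exists y, graph x y.
Proof.
move=> /approx_tends[s Us sx].
have [|y sy] := @cauchy_tends _ _ (fun n => u (s n)); last by exists y, s.
move=> e e0.
have d0 : 0 < e / (2 * (`|C| + 1)) by rewrite divr_gt0// mulr_gt0.
have [N HN] := sx _ d0; exists N => n /HN h1; have h2 := HN _ (leqnn N).
apply: le_lt_trans (u_bounded1 (Us n) (Us N)) _.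
have h5 : rnorm (s n - s N) <= rnorm (s n - x) + rnorm (s N - x).
  have -> : s n - s N = (s n - x) - (s N - x) by rewrite opprB addrA subrK.
  by apply: (le_trans (rnormD _ _)); rewrite rnormN.
have e1 : e = e / (2 * (`|C| + 1)) * (2 * (`|C| + 1)).
  by rewrite mulfVK// gt_eqF// mulr_gt0.
set d := e / (2 * _) in d0 h1 h2 e1.
move: C1; rewrite e1; set c := `|C| + 1; nra.
Qed.

Lemma star_hom_extension (L : cstarSubalg A) :
  (forall x, csub_carrier L x -> approx U x) ->
  exists psi : csub_type L -> B,
    star_hom psi /\ forall x, U (csub_val x) -> psi x = u (csub_val x).
Proof.
move=> LU.
have /choice[psi psiP] : forall x : csub_type L, exists y, graph (csub_val x) y.
  by move=> x; apply/graph_total/LU/set_mem/(csub_valP x).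
exists psi; split=> [|x Ux]; last first.
  by apply: graph_unique (psiP x) _; exists (fun=> csub_val x); split=> //; exact: tends_cst.
split.
- move=> a x y; apply: graph_unique (psiP _) _.
  have [s [Us sx su]] := psiP x; have [t [Ut tx tu]] := psiP y.
  exists (fun n => a *: s n + t n); split=> [n||]; [exact: U_ZD|exact: tendsZD|].
  under eq_fun => n do rewrite u_ZD//.
  exact: tendsZD.
- move=> x y; apply: graph_unique (psiP _) _.
  have [s [Us sx su]] := psiP x; have [t [Ut tx tu]] := psiP y.
  exists (fun n => cmul (s n) (t n)); split=> [n||]; [exact: U_M|exact: tendsM|].
  under eq_fun => n do rewrite u_M//.
  exact: tendsM.
- move=> x; apply: graph_unique (psiP _) _.
  have [s [Us sx su]] := psiP x.
  exists (fun n => cadj (s n)); split=> [n||]; [exact: U_adj|exact: tends_adj|].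
  under eq_fun => n do rewrite u_adj//.
  exact: tends_adj.
Qed.

End Extension.

Section Chain.
Variables (R : realType) (A : cstarAlgType R).

Definition csub_inc (S T : cstarSubalg A) (ST : csub_carrier S `<=` csub_carrier T)
  (x : csub_type S) : csub_type T := CsubType (mem_set (ST _ (set_mem (csub_valP x)))).

Lemma csub_inc_hom S T (ST : csub_carrier S `<=` csub_carrier T) :
  star_hom (csub_inc ST).
Proof. by split; repeat move=> ?; exact/val_inj. Qed.

Variables (S : nat -> cstarSubalg A) (L : cstarSubalg A) (e : A).
Hypothesis e_unit : forall x, csub_carrier L x -> cmul e x = x /\ cmul x e = x.
Hypothesis Se : forall n, csub_carrier (S n) e.
Hypothesis S_mono : forall n, csub_carrier (S n) `<=` csub_carrier (S n.+1).
Hypothesis SL : forall n, csub_carrier (S n) `<=` csub_carrier L.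
Hypothesis S_dense : forall x, csub_carrier L x ->
  approx (\bigcup_n csub_carrier (S n)) x.
Hypothesis S_fin : forall n, finite_dim (csub_type (S n)).

(** All stages share the unit [e], so each leg of a cocone is bounded by the same constant. The legs
    therefore glue to a bounded map on the union, which extends to [L]. Two mediating maps agree on
    the dense union and are both bounded, as [L] too has the unit [e]. *)
Lemma AF_chain : AF (csub_type L).
Proof.
exists (fun n => csub_type (S n)), (fun n => csub_inc (@S_mono n)),
  (fun n => csub_inc (@SL n)).
split=> // [n|]; first exact: csub_inc_hom.
split=> [n|B lam lamP].
  by split=> [|x]; [exact: csub_inc_hom|exact/val_inj].
have S_le m n : (m <= n)%N -> csub_carrier (S m) `<=` csub_carrier (S n).
  move=> /subnK <-; elim: (n - m)%N => // d IH x /IH; rewrite addSn; exact: S_mono.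
have lam_hom n : star_hom (lam n) by have [] := lamP n.
have lam_inc m n (mn : (m <= n)%N) x : lam n (csub_inc (S_le _ _ mn) x) = lam m x.
  elim: n mn => [|n IH] mn.
    have m0 : m = 0%N by apply/eqP; rewrite -leqn0.
    by subst m; congr (lam 0%N _); exact/val_inj.
  have [mn'|nm] := leqP m n.
    rewrite -(IH mn') -(proj2 (lamP n)); congr (lam n.+1 _); exact/val_inj.
  have mE : m = n.+1 by apply/eqP; rewrite eqn_leq mn nm.
  by subst m; congr (lam n.+1 _); exact/val_inj.
have lam_eq m n x y : csub_val x = csub_val y -> lam m x = lam n y.
  move=> xy; rewrite -(lam_inc m (maxn m n) (leq_maxl m n)).
  rewrite -(lam_inc n (maxn m n) (leq_maxr m n)).
  by congr (lam _ _); exact/val_inj.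
pose U := \bigcup_n csub_carrier (S n).
(* Off the union the value is 0 and the condition is vacuous; on it, [lam_eq] makes the value
   independent of the stage. *)
have /choice[u uP] : forall x : A, exists y, forall n (s : csub_type (S n)),
    csub_val s = x -> y = lam n s.
  move=> x; have [[n _ Sx]|nU] := pselect (U x).
    by exists (lam n (CsubType (mem_set Sx))) => m s sx; apply: lam_eq; rewrite sx.
  exists 0 => n s sx; exfalso; apply: nU; exists n => //.
  by rewrite -sx; exact: (set_mem (csub_valP s)).
have U2 x y : U x -> U y -> exists n (s t : csub_type (S n)), csub_val s = x /\ csub_val t = y.
  move=> [m _ Sx] [n _ Sy]; exists (maxn m n).
  exists (CsubType (mem_set (S_le _ _ (leq_maxl m n) _ Sx))).
  by exists (CsubType (mem_set (S_le _ _ (leq_maxr m n) _ Sy))).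
have bnd n (x : csub_type (S n)) : rnorm (lam n x) <= 2 * rnorm x.
  have eP y : cmul (CsubType (mem_set (Se n))) y = y /\ cmul y (CsubType (mem_set (Se n))) = y.
    have [h1 h2] := e_unit (SL (set_mem (csub_valP y))).
    by split; exact/val_inj.
  exact: (star_hom_bounded eP x (lam_hom n)).
have UM x y : U x -> U y -> U (cmul x y).
  move=> Ux Uy; have [n [s [t [<- <-]]]] := U2 _ _ Ux Uy.
  by exists n => //; exact: (set_mem (csub_valP (cmul s t))).
have UZD (a : R[i]) x y : U x -> U y -> U (a *: x + y).
  move=> Ux Uy; have [n [s [t [<- <-]]]] := U2 _ _ Ux Uy.
  by exists n => //; exact: (set_mem (csub_valP (a *: s + t))).
have Uadj x : U x -> U (cadj x).
  move=> Ux; have [n [s [_ [<- _]]]] := U2 _ _ Ux Ux.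
  by exists n => //; exact: (set_mem (csub_valP (cadj s))).
have uZD (a : R[i]) x y : U x -> U y -> u (a *: x + y) = a *: u x + u y.
  move=> Ux Uy; have [n [s [t [<- <-]]]] := U2 _ _ Ux Uy.
  rewrite (uP _ n (a *: s + t))// (uP _ n s)// (uP _ n t)//.
  by have [-> _ _] := lam_hom n.
have uM x y : U x -> U y -> u (cmul x y) = cmul (u x) (u y).
  move=> Ux Uy; have [n [s [t [<- <-]]]] := U2 _ _ Ux Uy.
  rewrite (uP _ n (cmul s t))// (uP _ n s)// (uP _ n t)//.
  exact: (star_homM (lam_hom n)).
have uadj x : U x -> u (cadj x) = cadj (u x).
  move=> Ux; have [n [s [_ [<- _]]]] := U2 _ _ Ux Ux.
  rewrite (uP _ n (cadj s))// (uP _ n s)//.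
  exact: (star_hom_adj (lam_hom n)).
have ubnd x : U x -> rnorm (u x) <= 2 * rnorm x.
  move=> Ux; have [n [s [_ [<- _]]]] := U2 _ _ Ux Ux.
  by rewrite (uP _ n s)//; exact: bnd.
have [psi [psi_hom psiE]] := star_hom_extension UZD UM Uadj uZD uM uadj ubnd S_dense.
have psi_lam n (x : csub_type (S n)) : psi (csub_inc (@SL n) x) = lam n x.
  rewrite psiE/= ?(uP _ n x)//.
  by exists n => //; exact: (set_mem (csub_valP x)).
exists psi; split=> // psi' [psi'_hom psi'_lam].
apply/funext => x; apply/eqP; rewrite -subr_eq0; apply/eqP/rnorm_eq0/le_anti.
rewrite rnorm_ge0 andbT; apply/ler_addgt0Pl => d d0; rewrite addr0.
(* Each of the two maps multiplies norms by at most 2, so an error of [d / 4] costs [d] in all. *)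
have /(_ (d / 4))[|s0 [n _ Ss] xs] := S_dense (set_mem (csub_valP x)).
  by rewrite divr_gt0.
pose t : csub_type (S n) := CsubType (mem_set Ss).
set y := csub_inc (@SL n) t.
have -> : psi x - psi' x = psi (x - y) - psi' (x - y).
  rewrite (star_homB psi_hom) (star_homB psi'_hom) /y psi_lam psi'_lam.
  by rewrite opprB addrA subrK.
pose eL : csub_type L := CsubType (mem_set (SL (Se 0%N))).
have eP z : cmul eL z = z /\ cmul z eL = z.
  have [h1 h2] := e_unit (set_mem (csub_valP z)).
  by split; exact/val_inj.
have h1 := star_hom_bounded eP (x - y) psi_hom.
have h2 := star_hom_bounded eP (x - y) psi'_hom.
have h3 : rnorm (x - y) < d / 4 by exact: xs.
by apply: (le_trans (rnormD _ _)); rewrite rnormN; lra.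
Qed.

End Chain.

(** * Orthonormal sequences *)

Section HilbertSums.
Variables (R : realType) (H : hilbertType R).
Implicit Types (x y : H) (e f : nat -> H) (c : nat -> R[i]).

Lemma hdotxx x : hdot x x = (rnorm x ^+ 2)%:C.
Proof. by rewrite -hdot_norm rnormE rmorphXn. Qed.

Lemma hdot0_sym x y : hdot x y = 0 -> hdot y x = 0.
Proof. by move=> xy; rewrite (hdotC x y) xy conjC0. Qed.

Lemma hdot_suml I (r : seq I) (P : pred I) (F : I -> H) y :
  hdot (\sum_(i <- r | P i) F i) y = \sum_(i <- r | P i) hdot (F i) y.
Proof.
apply: (big_morph (fun x => hdot x y)) => [u v|]; first exact: linearDl.
exact: linear0l.
Qed.

Lemma hdotZl (a : R[i]) x y : hdot (a *: x) y = a * hdot x y.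
Proof. by rewrite linearZl_LR. Qed.

Lemma hdotBl x y z : hdot (x - y) z = hdot x z - hdot y z.
Proof. exact: linearBl. Qed.

Lemma hdotDl x y z : hdot (x + y) z = hdot x z + hdot y z.
Proof. exact: linearDl. Qed.

Lemma hdotZr (a : R[i]) x y : hdot x (a *: y) = Num.conj a * hdot x y.
Proof. by rewrite linearZr_LR. Qed.

Lemma hdotBr x y z : hdot x (y - z) = hdot x y - hdot x z.
Proof. exact: linearBr. Qed.

Definition orthonormal_seq e := forall i j, hdot (e i) (e j) = (i == j)%:R.

Lemma orthonormal_extend (s : seq H) : ~ finite_dim H ->
  (forall i j, (i < size s)%N -> (j < size s)%N -> hdot s`_i s`_j = (i == j)%:R) ->
  exists x, hdot x x = 1 /\ forall i, (i < size s)%N -> hdot s`_i x = 0.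
Proof.
move=> Hinf son.
have [v vs] : exists v : H, v != \sum_(i < size s) hdot v s`_i *: s`_i.
  apply: contrapT => nv; apply: Hinf; exists (size s), (fun i => s`_i) => v.
  exists (fun i => hdot v s`_i); apply/eqP/negPn/negP => ne.
  by apply: nv; exists v.
pose w := v - \sum_(i < size s) hdot v s`_i *: s`_i.
have ws i : (i < size s)%N -> hdot w s`_i = 0.
  move=> si; rewrite /w hdotBl hdot_suml (bigD1 (Ordinal si))//= hdotZl son// eqxx mulr1.
  rewrite big1 ?addr0 ?subrr// => j ji; rewrite hdotZl son//.
  rewrite (_ : (val j == i) = false) ?mulr0//.
  by apply/negbTE; apply: contraNneq ji => ji; apply/eqP/val_inj.
have w0 : rnorm w != 0.
  by apply: contraNneq vs => /rnorm_eq0/eqP; rewrite subr_eq0.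
exists ((rnorm w)^-1%:C *: w); split=> [|i si].
  by rewrite hdotxx rnormZr normfV ger0_norm ?rnorm_ge0// mulVf// expr1n.
by apply: hdot0_sym; rewrite hdotZl ws ?mulr0.
Qed.

Lemma orthonormal_exists : ~ finite_dim H -> exists e, orthonormal_seq e.
Proof.
move=> Hinf.
pose on (s : seq H) := forall i j, (i < size s)%N -> (j < size s)%N ->
  hdot s`_i s`_j = (i == j)%:R.
(* The value on lists that are not orthonormal is arbitrary, so that the recursion [L] carries no
   proofs. *)
have /choice[g gP] : forall s : seq H, exists x, on s ->
    hdot x x = 1 /\ forall i, (i < size s)%N -> hdot s`_i x = 0.
  move=> s; have [/(orthonormal_extend Hinf)[x xP]|ns] := pselect (on s); first by exists x.
  by exists 0 => /ns.
pose L := fix L n := if n is n'.+1 then rcons (L n') (g (L n')) else [::].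
have sL n : size (L n) = n by elim: n => //= n IH; rewrite size_rcons IH.
have Lon n : on (L n).
  elim: n => [|n IH] //= i j; rewrite size_rcons sL !ltnS => iN jN.
  have [g1 g2] := gP _ IH; rewrite !nth_rcons sL.
  have [iN'|ni] := ltnP i n; have [jN'|nj] := ltnP j n.
  - by apply: IH; rewrite sL.
  - have -> : j = n by apply/eqP; rewrite eqn_leq jN.
    by rewrite eqxx g2 ?sL// (ltn_eqF iN').
  - have -> : i = n by apply/eqP; rewrite eqn_leq iN.
    by rewrite eqxx (gtn_eqF jN'); apply: hdot0_sym; rewrite g2 ?sL.
  - have -> : i = n by apply/eqP; rewrite eqn_leq iN.
    have -> : j = n by apply/eqP; rewrite eqn_leq jN.
    by rewrite !eqxx g1.
exists (fun n => g (L n)) => i j.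
have Li n k : (k < n)%N -> (L n)`_k = g (L k).
  elim: n => // n IH; rewrite ltnS leq_eqVlt /= nth_rcons sL => /predU1P[->|kn].
    by rewrite ltnn eqxx.
  by rewrite kn IH.
have := @Lon (maxn i j).+1 i j; rewrite !sL !Li ?ltnS ?leq_maxl ?leq_maxr//.
by apply.
Qed.

Lemma pythagoras x y : hdot x y = 0 -> rnorm (x + y) ^+ 2 = rnorm x ^+ 2 + rnorm y ^+ 2.
Proof.
move=> xy; rewrite !rdot_norm rdotDl !rdotDr (rdotC x y).
by rewrite /rdot xy /= add0r addr0.
Qed.

Lemma rnorm_orthogonal_sum f c m n : (m <= n)%N ->
  (forall i j, i != j -> hdot (f i) (f j) = 0) ->
  rnorm (\sum_(m <= i < n) c i *: f i) ^+ 2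
  = \sum_(m <= i < n) (complex.Re `|c i| * rnorm (f i)) ^+ 2.
Proof.
move=> mn fo; elim: n mn => [|n IH] mn.
  by rewrite !big_geq// rnorm0 expr0n.
have [mn'|nm] := leqP m n; last by rewrite !big_geq// rnorm0 expr0n.
rewrite !(@big_nat_recr _ _ _ n)//= pythagoras ?IH// ?rnormZ//.
rewrite hdot_suml big_nat big1// => i /andP[_ ni].
by rewrite hdotZl hdotZr fo ?mulr0// ltn_eqF.
Qed.

Lemma bessel e x n : orthonormal_seq e ->
  \sum_(0 <= i < n) complex.Re `|hdot x (e i)| ^+ 2 <= rnorm x ^+ 2.
Proof.
move=> eo; pose s := \sum_(0 <= i < n) hdot x (e i) *: e i.
have se j : (j < n)%N -> hdot s (e j) = hdot x (e j).
  move=> jn; rewrite hdot_suml big_mkord (bigD1 (Ordinal jn))//= hdotZl eo eqxx mulr1.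
  rewrite big1 ?addr0// => i ij; rewrite hdotZl eo.
  rewrite (_ : (val i == j) = false) ?mulr0//.
  by apply/negbTE; apply: contraNneq ij => ij; apply/eqP/val_inj.
have sx : hdot s (x - s) = 0.
  rewrite {1}/s hdot_suml big_nat big1// => i /andP[_ iN].
  by rewrite hdotZl (hdotC (x - s)) hdotBl se// subrr conjC0 mulr0.
have := pythagoras sx; rewrite addrC subrK => ->.
apply: (@le_trans _ _ (rnorm s ^+ 2)); last by rewrite lerDl sqr_ge0.
rewrite /s rnorm_orthogonal_sum//; last by move=> i j ij; rewrite eo (negbTE ij).
apply: ler_sum => i _.
have /eqP : rnorm (e i) ^+ 2 = 1 by apply: complexI; rewrite -hdotxx eo eqxx.
by rewrite sqrp_eq1 ?rnorm_ge0// => /eqP ->; rewrite mulr1.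
Qed.

Lemma tends_rnorm_le (V : completeNormedModType R[i]) (u : nat -> V) (x : V) M :
  (forall n, rnorm (u n) <= M) -> tends u x -> rnorm x <= M.
Proof.
move=> uM ux; apply/ler_addgt0Pl => d /ux[N /(_ N (leqnn N))].
have := rnormD (u N) (x - u N); rewrite addrC subrK [rnorm (x - _)]rnormB.
have := uM N; lra.
Qed.

(** The operator is [x |-> sum_i <x, e i> f i]; orthogonality of the [f i] and Bessel's inequality
    make the partial sums Cauchy. Some [f i] may be 0, which yields partial isometries. The last two
    clauses locate kernel and range, as needed for [corner]. *)
Lemma orthogonal_operator e f : orthonormal_seq e ->
  (forall i j, i != j -> hdot (f i) (f j) = 0) -> (forall i, rnorm (f i) <= 1) ->
  exists T : 'B(H), [/\ forall i, T (e i) = f i,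
    forall x, (forall i, f i = 0 \/ hdot x (e i) = 0) -> T x = 0
    & forall x y, (forall i, hdot (f i) y = 0) -> hdot (T x) y = 0].
Proof.
move=> eo fo f1.
pose S x n := \sum_(0 <= i < n) hdot x (e i) *: f i.
pose b x n := \sum_(0 <= i < n) complex.Re `|hdot x (e i)| ^+ 2.
have Sb x m n : (m <= n)%N -> rnorm (S x n - S x m) ^+ 2 <= b x n - b x m.
  move=> mn; rewrite /S /b !(@big_cat_nat _ _ _ m 0%N n)//=.
  have ck (V : zmodType) (y z : V) : y + z - y = z by rewrite addrC addKr.
  rewrite !ck rnorm_orthogonal_sum//; apply: ler_sum => i _.
  rewrite ler_pXn2r ?nnegrE ?mulr_ge0 ?rnorm_ge0 ?Re_normC_ge0//.
  by rewrite ler_piMr ?Re_normC_ge0.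
have S1 x n : rnorm (S x n) <= rnorm x.
  rewrite -(@ler_pXn2r _ 2) ?nnegrE ?rnorm_ge0//.
  have := Sb x 0%N n (leq0n n).
  rewrite {2}/S {2}/b !big_geq// !subr0 => h; exact: le_trans h (bessel x n eo).
(* A bounded increasing sequence is Cauchy: some term of [- b x] is within [eps] of its infimum. *)
have b_cvg x eps : 0 < eps -> exists N, forall n, (N <= n)%N -> b x n - b x N < eps.
  move=> e0; have [|_ [N _ <-] HN] := @inf_adherent R (range (fun n => - b x n)) eps e0.
    split; first by exists (- b x 0%N), 0%N.
    exists (- rnorm x ^+ 2) => _ [n _ <-]; rewrite lerN2; exact: bessel.
  exists N => n Nn.
  have : inf (range (fun n => - b x n)) <= - b x n.
    apply: ge_inf; last by exists n.
    exists (- rnorm x ^+ 2) => _ [j _ <-]; rewrite lerN2; exact: bessel.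
  lra.
have /choice[t tP] : forall x, exists y, tends (S x) y.
  move=> x; apply: cauchy_tends => eps e0.
  have [|N HN] := b_cvg x (eps ^+ 2); first by rewrite exprn_gt0.
  exists N => n Nn; rewrite -(@ltr_pXn2r _ 2) ?nnegrE ?rnorm_ge0// ?ltW//.
  exact: le_lt_trans (Sb _ _ _ Nn) (HN _ Nn).
have tlin : linear t.
  move=> a x y; apply: (tends_unique (tP _)).
  have -> : S (a *: x + y) = fun n => a *: S x n + S y n.
    apply/funext => n; rewrite /S scaler_sumr -big_split; apply: eq_bigr => i _ /=.
    by rewrite hdotDl hdotZl scalerDl scalerA.
  exact: tendsZD.
have tb : t \in bounded_op_pred H.
  apply: mem_set; split=> //; exists 1 => x.
  by rewrite mul1r !rnormE lecR; exact: tends_rnorm_le (S1 x) (tP x).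
exists (Bop tb); split=> [i|x fx|x y fy] /=.
- apply: (tends_unique (tP _)) => eps e0; exists i.+1 => n iN.
  rewrite /S big_mkord (bigD1 (Ordinal iN))//= eo eqxx scale1r big1 ?addr0 ?subrr ?rnorm0//.
  move=> j ji; rewrite eo (_ : (i == j) = false) ?scale0r//.
  by apply/negbTE; apply: contraNneq ji => ji; apply/eqP/val_inj.
- apply: (tends_unique (tP _)).
  have -> : S x = fun=> 0; last exact: tends_cst.
  apply/funext => n; rewrite /S big1// => i _.
  by case: (fx i) => ->; rewrite ?scaler0 ?scale0r.
- apply: hdot0_sym; apply/eqP; rewrite -normr_le0; apply/ler_addgt0Pl => d d0; rewrite addr0.
  have er : d = (complex.Re d)%:C by rewrite RRe_real// gtr0_real.
  have r0 : 0 < complex.Re d by rewrite -ltcR -er.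
  have y0 := rnorm_ge0 y.
  have [|N /(_ N (leqnn N)) HN] := tP x (complex.Re d / (rnorm y + 1)).
    by rewrite divr_gt0// ltr_wpDl.
  have -> : hdot y (t x) = - hdot y (S x N - t x).
    rewrite hdotBr opprB; rewrite [hdot y (S x N)]hdot0_sym ?subr0//.
    by rewrite hdot_suml big1// => i _; rewrite hdotZl fy mulr0.
  rewrite normrN; apply: (le_trans (hdot_le _ _)); rewrite !rnormE -rmorphM er lecR.
  rewrite ltr_pdivlMr ?ltr_wpDl// in HN.
  have := rnorm_ge0 (S x N - t x); nra.
Qed.

End HilbertSums.

(** * Partial isometries permuting an orthonormal family *)

Section Kets.
Variables (R : realType) (H : hilbertType R) (e : nat -> H).
Hypothesis e_on : orthonormal_seq e.
Implicit Types (p q : nat * nat) (S T : 'B(H)).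

Definition ket p : H := e (pickle p).

Lemma ket_dot p q : hdot (ket p) (ket q) = (p == q)%:R.
Proof.
by rewrite e_on (inj_eq (pcan_inj pickleK)).
Qed.

Lemma ket_norm p : rnorm (ket p) = 1.
Proof.
have /eqP : rnorm (ket p) ^+ 2 = 1 by apply: complexI; rewrite -hdotxx ket_dot eqxx.
by rewrite sqrp_eq1 ?rnorm_ge0// => /eqP.
Qed.

(** With [P] the projection onto the closed span of the kets, these are the operators [T = P T P].
    Such operators are determined by their matrix coefficients although the kets need not be total
    in [H]. *)
Definition corner : set 'B(H) := [set T : 'B(H) | forall y : H,
  (forall p, hdot y (ket p) = 0) -> T y = 0 /\ adjoint T y = 0].

Lemma bop_eval_closed y : closed [set T : 'B(H) | T y = 0].
Proof.
apply: (@closed_bounded_eq _ _ _ (fun T : 'B(H) => T y) (rnorm y)) => // T.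
by rewrite mulrC; exact: opnormP.
Qed.

Lemma adj_eval_closed y : closed [set T : 'B(H) | adjoint T y = 0].
Proof.
apply: (@closed_bounded_eq _ _ _ (fun T : 'B(H) => adjoint T y) (rnorm y)) => [S T|T].
  by rewrite (cadjB S T : adjoint (S - T) = adjoint S - adjoint T).
rewrite mulrC -(rnorm_adj T); exact: opnormP.
Qed.

Lemma corner_subalg : is_cstar_subalg corner.
Proof.
split.
- move=> a S T cS cT y /[dup] /cS[S1 S2] /cT[T1 T2].
  change (adjoint (a *: S + T)) with (cadj (a *: S + T)); rewrite cadjD cadjZ.
  suff : a *: S y + T y = 0 /\ Num.conj a *: adjoint S y + adjoint T y = 0 by [].
  by rewrite S1 S2 T1 T2 !scaler0 addr0.
- move=> y _; rewrite (cadj0 _ : adjoint 0 = 0); by [].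
- move=> S T cS cT y /[dup] /cS[S1 S2] /cT[T1 T2].
  rewrite (cadjM S T : adjoint (cmul S T) = cmul (adjoint T) (adjoint S)).
  suff : S (T y) = 0 /\ adjoint T (adjoint S y) = 0 by [].
  by rewrite T1 S2 !linear0.
- move=> S cS y /cS[S1 S2]; split; first exact: S2.
  by rewrite (cadjK S : adjoint (cadj S) = S).
- have -> : corner = \bigcap_(y in [set y | forall p, hdot y (ket p) = 0])
      ([set T : 'B(H) | T y = 0] `&` [set T : 'B(H) | adjoint T y = 0]).
    by apply/seteqP; split=> T cT y; exact: cT.
  by apply: closed_bigI => y _; apply: closedI; [exact: bop_eval_closed|exact: adj_eval_closed].
Qed.

Definition coef T p q : R[i] := hdot (T (ket q)) (ket p).

Lemma coefZD (a : R[i]) S T p q : coef (a *: S + T) p q = a * coef S p q + coef T p q.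
Proof.
rewrite /coef -hdotZl -hdotDl; by [].
Qed.

Lemma coefB S T p q : coef (S - T) p q = coef S p q - coef T p q.
Proof. by rewrite /coef -hdotBl. Qed.

Lemma coef0 p q : coef 0 p q = 0.
Proof. by rewrite -(subrr 0) coefB subrr. Qed.

Lemma coef_le T p q : complex.Re `|coef T p q| <= rnorm T.
Proof.
rewrite -lecR -normC_Re; apply: (le_trans (hdot_le _ _)).
rewrite !rnormE ket_norm mulr1 lecR; have := opnormP T (ket q).
by rewrite ket_norm mulr1.
Qed.

Lemma coef_adj T p q : coef (adjoint T) p q = Num.conj (coef T q p).
Proof. by rewrite /coef adjointPr hdotC. Qed.

(** No expansion in kets is used. For [U = S - T], the vector [U (ket q)] is orthogonal to all kets,
    so [U^*] kills it and [|U (ket q)|^2 = 0]. Hence every [U^* y] is orthogonal to all kets, [U]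
    kills it, and [U^* = 0]. *)
Lemma corner_coef S T : corner S -> corner T ->
  (forall p q, coef S p q = coef T p q) -> S = T.
Proof.
move=> cS cT ST; apply/eqP; rewrite -subr_eq0; apply/eqP.
have cU : corner (S - T).
  by have := csubZD corner_subalg (-1) cT cS; rewrite scaleN1r addrC.
have U0 p q : coef (S - T) p q = 0 by rewrite coefB ST subrr.
set U := S - T in cU U0 *.
have Uk q : U (ket q) = 0.
  apply: rnorm_eq0; apply/eqP; rewrite -sqrf_eq0; apply/eqP/complexI.
  rewrite -hdotxx adjointP (proj2 (cU (U (ket q)) _)) ?linear0r//.
  by move=> p; exact: U0.
have aU y : adjoint U y = 0.
  apply: rnorm_eq0; apply/eqP; rewrite -sqrf_eq0; apply/eqP/complexI.
  rewrite -hdotxx adjointPr (proj1 (cU (adjoint U y) _)) ?linear0r//.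
  by move=> p; rewrite adjointPr Uk linear0r.
rewrite -(cadjK U) (_ : cadj U = 0) ?cadj0//.
by apply: bopP => y; rewrite [LHS]aU.
Qed.

Lemma corner_ext S T : corner S -> corner T ->
  (forall p, S (ket p) = T (ket p)) -> S = T.
Proof. by move=> cS cT ST; apply: corner_coef => // p q; rewrite /coef ST. Qed.

Definition partial_inj (s : nat * nat -> option (nat * nat)) :=
  forall p q r, s p = Some r -> s q = Some r -> p = q.

(** [partial_inj s] stands under the existential, so that the choice made in [pisom] takes [s] as
    its only argument. *)
Lemma partial_isometry_exists (s : nat * nat -> option (nat * nat)) :
  exists T : 'B(H), partial_inj s ->
    (forall p, T (ket p) = oapp ket 0 (s p)) /\ corner T.
Proof.
have [si|] := pselect (partial_inj s); last by exists 0.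
pose f n := if pickle_inv n is Some p then oapp ket 0 (s p) else 0.
have fo i j : i != j -> hdot (f i) (f j) = 0.
  rewrite /f; case Ei : (pickle_inv i : option (nat * nat)) => [p|]; last by rewrite linear0l.
  case Ej : (pickle_inv j : option (nat * nat)) => [q|]; last by rewrite linear0r.
  move=> ij.
  case sp : (s p) => [p'|]; last by rewrite linear0l.
  case sq : (s q) => [q'|]; last by rewrite linear0r.
  rewrite ket_dot; case: eqP => // pq; case/eqP: ij.
  rewrite -(@pickle_invK (nat * nat)%type i) -(@pickle_invK (nat * nat)%type j) Ei Ej /=.
  by congr pickle; apply: si sp _; rewrite pq.
have f1 i : rnorm (f i) <= 1.
  rewrite /f; case: pickle_inv => [p|]; last by rewrite rnorm0.
  by case: (s p) => [q|] /=; rewrite ?ket_norm ?rnorm0.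
have [T [Te Tp Tr]] := orthogonal_operator e_on fo f1.
have fk n : f n = 0 \/ exists p, f n = ket p.
  rewrite /f; case: pickle_inv => [p|]; last by left.
  by case: (s p) => [q|] /=; [right; exists q|left].
exists T => _; split=> [p|y yk].
  by rewrite Te /f pickleK_inv.
split.
  apply: Tp => i; rewrite /f.
  case Ei : (pickle_inv i : option (nat * nat)) => [p|]; last by left.
  by right; have := @pickle_invK (nat * nat)%type i; rewrite Ei /= => <-; exact: yk.
apply: hdot_inj => x; rewrite -adjointP linear0r; apply: Tr => i.
by have [->|[p ->]] := fk i; [rewrite linear0l|exact: hdot0_sym].
Qed.

(** Matrix units, tails and shifts all have this form, so their products and adjoints become
    compositions and inverses of partial injections. *)
Definition pisom (s : nat * nat -> option (nat * nat)) : 'B(H) :=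
  projT1 (cid (partial_isometry_exists s)).

Lemma pisom_ket s p : partial_inj s -> pisom s (ket p) = oapp ket 0 (s p).
Proof. by rewrite /pisom; case: cid => /= T TP /TP[]. Qed.

Lemma pisom_corner s : partial_inj s -> corner (pisom s).
Proof. by rewrite /pisom; case: cid => /= T TP /TP[]. Qed.

Lemma pisom_coef s p q : partial_inj s -> coef (pisom s) p q = (s q == Some p)%:R.
Proof.
move=> si; rewrite /coef pisom_ket//.
by case: (s q) => [r|] /=; rewrite ?ket_dot// linear0l.
Qed.

Lemma pisom_mul s t r : partial_inj s -> partial_inj t -> partial_inj r ->
  (forall p, obind s (t p) = r p) -> cmul (pisom s) (pisom t) = pisom r.
Proof.
move=> si ti ri str; apply: corner_ext.
- by apply: (csubM corner_subalg); exact: pisom_corner.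
- exact: pisom_corner.
- move=> p; rewrite [LHS](_ : _ = pisom s (pisom t (ket p)))// !pisom_ket// -str.
  by case: (t p) => [q|] /=; rewrite ?pisom_ket// linear0.
Qed.

Lemma pisom_mul0 s t : partial_inj s -> partial_inj t ->
  (forall p, obind s (t p) = None) -> cmul (pisom s) (pisom t) = 0.
Proof.
move=> si ti st; apply: corner_ext.
- by apply: (csubM corner_subalg); exact: pisom_corner.
- exact: csub0 corner_subalg.
- move=> p; rewrite [LHS](_ : _ = pisom s (pisom t (ket p)))// pisom_ket//.
  by have := st p; case: (t p) => [q|] /= sq; rewrite ?pisom_ket// ?sq// linear0.
Qed.

Lemma pisom_adj s t : partial_inj s -> partial_inj t ->
  (forall p q, s p = Some q <-> t q = Some p) -> cadj (pisom s) = pisom t.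
Proof.
move=> si ti st; apply: corner_coef.
- exact: (csub_adj corner_subalg (pisom_corner si)).
- exact: pisom_corner.
- move=> p q; rewrite [LHS]coef_adj !pisom_coef// rmorph_nat; congr (_%:R).
  by congr nat_of_bool; apply/eqP/eqP => /st.
Qed.

Lemma bop_sumE I (r : seq I) (P : pred I) (F : I -> 'B(H)) x :
  (\sum_(i <- r | P i) F i : 'B(H)) x = \sum_(i <- r | P i) F i x.
Proof. exact: (big_morph (fun T : 'B(H) => T x)). Qed.

End Kets.

(** * Matrix units *)

Section Frames.
Variables (R : realType) (H : hilbertType R) (e : nat -> H).
Hypothesis e_on : orthonormal_seq e.
Variables (J : eqType) (s : seq J) (op : J -> 'B(H)) (src dst : J -> nat * nat).
Hypothesis s_uniq : uniq s.
Hypothesis biorth : forall g g', g \in s -> g' \in s ->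
  coef e (op g) (dst g') (src g') = (g == g')%:R.
Hypothesis op_mul : forall g g', g \in s -> g' \in s ->
  cmul (op g) (op g') = 0 \/ exists2 g'', g'' \in s & cmul (op g) (op g') = op g''.
Hypothesis op_adj : forall g, g \in s -> exists2 g', g' \in s & cadj (op g) = op g'.
Implicit Types (x y : 'B(H)).

(** The span is encoded as the fixed points of a bounded linear map, the projection given by the
    dual coefficients. This makes it closed at once and supplies coordinates; [biorth] places the
    family itself in it. *)
Definition frame_span : set 'B(H) :=
  [set x : 'B(H) | x = \sum_(g <- s) coef e x (dst g) (src g) *: op g].

Lemma frame_span_op g : g \in s -> frame_span (op g).
Proof.
move=> gs; rewrite /frame_span /= (bigD1_seq g)//= biorth// eqxx scale1r.
rewrite big_seq_cond big1 ?addr0// => g' /andP[g's g'g].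
by rewrite biorth// eq_sym (negbTE g'g) scale0r.
Qed.

Lemma frame_span_ZD (a : R[i]) x y :
  frame_span x -> frame_span y -> frame_span (a *: x + y).
Proof.
rewrite /frame_span /= => {1}-> {1}->.
rewrite scaler_sumr -big_split; apply: eq_bigr => g _ /=.
by rewrite coefZD scalerDl scalerA.
Qed.

Lemma frame_span0 : frame_span 0.
Proof. by rewrite /frame_span /= big1// => g _; rewrite coef0 scale0r. Qed.

Lemma frame_span_ind (P : set 'B(H)) :
  (forall (a : R[i]) x y, P x -> P y -> P (a *: x + y)) -> P 0 ->
  (forall g, g \in s -> P (op g)) -> forall x, frame_span x -> P x.
Proof.
move=> PZD P0 Pop x ->; rewrite big_seq_cond.
elim/big_rec : _ => // g y /andP[gs _] Py.
by apply: PZD => //; exact: Pop.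
Qed.

Lemma frame_span_closed : closed frame_span.
Proof.
have -> : frame_span = [set x | x - \sum_(g <- s) coef e x (dst g) (src g) *: op g = 0].
  by apply/seteqP; split=> x /= /eqP h; apply/eqP; rewrite ?subr_eq0// -subr_eq0.
apply: (@closed_bounded_eq _ _ _ _ (1 + \sum_(g <- s) rnorm (op g))) => [x y|x].
  transitivity (x - y - (\sum_(g <- s) coef e x (dst g) (src g) *: op g
      - \sum_(g <- s) coef e y (dst g) (src g) *: op g)).
    rewrite -sumrB; congr (_ - _); apply: eq_bigr => g _.
    by rewrite coefB scalerBl.
  by lin R[i] ('B(H) : lmodType R[i]).
apply: (le_trans (rnormD _ _)); rewrite rnormN mulrDl mul1r lerD2l.
elim/big_rec2 : _ => [|g y1 y2 _ IH]; first by rewrite mul0r rnorm0.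
apply: (le_trans (rnormD _ _)); rewrite mulrDl lerD// rnormZ mulrC.
by rewrite ler_wpM2l ?rnorm_ge0// coef_le.
Qed.

Lemma frame_span_subalg : is_cstar_subalg frame_span.
Proof.
split.
- exact: frame_span_ZD.
- exact: frame_span0.
- move=> x y Sx Sy; move: x Sx; apply: frame_span_ind => [a x x' Px Px'||g gs].
  + by rewrite cmulDl cmulZl; exact: frame_span_ZD.
  + by rewrite cmul0l; exact: frame_span0.
  move: y Sy; apply: frame_span_ind => [a x x' Px Px'||g' g's].
  + by rewrite cmulDr cmulZr; exact: frame_span_ZD.
  + by rewrite cmul0r; exact: frame_span0.
  have [->|[g'' g''s ->]] := op_mul gs g's; first exact: frame_span0.
  exact: frame_span_op.
- apply: frame_span_ind => [a x x' Px Px'||g gs].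
  + by rewrite cadjD cadjZ; exact: frame_span_ZD.
  + by rewrite cadj0; exact: frame_span0.
  by have [g' g's ->] := op_adj gs; exact: frame_span_op.
- exact: frame_span_closed.
Qed.

Definition frame_alg := CstarSubalg frame_span_subalg.

Lemma frame_alg_finite_dim : finite_dim (csub_type frame_alg).
Proof.
have opS (i : 'I_(size s)) : frame_span (op (tnth (in_tuple s) i)).
  by apply/frame_span_op/mem_tnth.
pose v i : csub_type frame_alg :=
  CsubType (mem_set (opS i) : op (tnth (in_tuple s) i) \in csub_pred frame_alg).
exists (size s), v => x.
exists (fun i => let g := tnth (in_tuple s) i in coef e (csub_val x) (dst g) (src g)).
apply: (val_inj : injective (@csub_val R 'B(H) frame_alg)).
rewrite (big_morph (@csub_val R 'B(H) frame_alg) (id1 := 0) (op1 := +%R))//=.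
have := set_mem (csub_valP x); rewrite /= /frame_span /= => {1}->.
by rewrite big_tnth.
Qed.

End Frames.

Section MatrixUnits.
Variables (R : realType) (H : hilbertType R) (e : nat -> H).
Hypothesis e_on : orthonormal_seq e.
Implicit Types (k t D a b c d n m : nat) (p q : nat * nat).

Definition munit_map k D a b p : option (nat * nat) :=
  if (p.1 == k) && (p.2 %% D == b)%N then Some (k, p.2 - b + a)%N else None.

Definition tail_map n p : option (nat * nat) := if (n <= p.1)%N then Some p else None.

Definition shift_map m p : option (nat * nat) := Some (p.1 + m, p.2)%N.

Lemma munit_map_inj k D a b : partial_inj (munit_map k D a b).
Proof.
move=> [k1 t1] [k2 t2] r; rewrite /munit_map /=.
case: ifP => // /andP[/eqP-> /eqP h1] [<-]; case: ifP => // /andP[/eqP-> /eqP h2] [h].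
have b1 : (b <= t1)%N by rewrite -h1 leq_mod.
have b2 : (b <= t2)%N by rewrite -h2 leq_mod.
by rewrite -(subnK b1) -(subnK b2); move/addIn: h => ->.
Qed.

Lemma tail_map_inj n : partial_inj (tail_map n).
Proof. by move=> p q r; rewrite /tail_map; case: ifP => // _ [->]; case: ifP => // _ [->]. Qed.

Lemma shift_map_inj m : partial_inj (shift_map m).
Proof.
by move=> [k1 t1] [k2 t2] r; rewrite /shift_map /= => -[<-] [/addIn-> ->].
Qed.

Definition munit k D a b : 'B(H) := pisom e_on (munit_map k D a b).
(** The projection onto the components from [n] on. [tail 0] is the unit, and modulo the c0-direct
    sum all tails agree with it: they supply the scalars of the unitization. *)
Definition tail n : 'B(H) := pisom e_on (tail_map n).
Definition shift m : 'B(H) := pisom e_on (shift_map m).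

Lemma munit_ket k D a b k' t : munit k D a b (ket e (k', t)) =
  if (k' == k) && (t %% D == b)%N then ket e (k, t - b + a)%N else 0.
Proof. by rewrite pisom_ket; [rewrite /munit_map; case: ifP|exact: munit_map_inj]. Qed.

Lemma tail_ket n k t : tail n (ket e (k, t)) = if (n <= k)%N then ket e (k, t) else 0.
Proof. by rewrite pisom_ket; [rewrite /tail_map; case: ifP|exact: tail_map_inj]. Qed.

Lemma munit_corner k D a b : corner e (munit k D a b).
Proof. exact/pisom_corner/munit_map_inj. Qed.

Lemma tail_corner n : corner e (tail n).
Proof. exact/pisom_corner/tail_map_inj. Qed.

Lemma munit_coef k D a b k1 t1 k2 t2 : coef e (munit k D a b) (k1, t1) (k2, t2) =
  [&& k1 == k, k2 == k, (t2 %% D == b)%N & (t1 == t2 - b + a)%N]%:R.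
Proof.
rewrite pisom_coef; last exact: munit_map_inj.
rewrite /munit_map /=; case: (k2 == k); case: (t2 %% D == b)%N;
  rewrite /= ?andbF// -[Some _ == Some _]/((k, _) == (k1, t1)) xpair_eqE eq_sym.
by rewrite [(t2 - b + a == t1)%N]eq_sym.
Qed.

Lemma tail_coef n k t : coef e (tail n) (k, t) (k, t) = (n <= k)%N%:R.
Proof.
rewrite pisom_coef; last exact: tail_map_inj.
by rewrite /tail_map /=; case: ifP => // _; rewrite eqxx.
Qed.

Lemma munit_mul k D a b c d : (b < D)%N -> (c < D)%N ->
  cmul (munit k D a b) (munit k D c d) = if b == c then munit k D a d else 0.
Proof.
move=> bD cD.
have cm t : (t %% D == d)%N -> ((t - d + c) %% D = c)%N.
  move=> /eqP td; rewrite {1}(divn_eq t D) td addnK.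
  by rewrite modnMDl modn_small.
case: eqP => [bc|bc].
  apply: pisom_mul; try exact: munit_map_inj.
  move=> [k' t]; rewrite /munit_map /=; case: ifP => //= /andP[kk /cm ->].
  by rewrite bc !eqxx /= addnK.
apply: pisom_mul0; try exact: munit_map_inj.
move=> [k' t]; rewrite /munit_map /=; case: ifP => //= /andP[kk /cm ->].
by rewrite eqxx /= eq_sym; case: eqP.
Qed.

Lemma munit_mul0 k k' D D' a b c d : k != k' ->
  cmul (munit k D a b) (munit k' D' c d) = 0.
Proof.
move=> kk; apply: pisom_mul0; try exact: munit_map_inj.
move=> [k1 t]; rewrite /munit_map /=; case: ifP => //= /andP[_ _].
by rewrite eq_sym (negbTE kk).
Qed.

Lemma munit_adj k D a b : (a < D)%N -> (b < D)%N ->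
  cadj (munit k D a b) = munit k D b a.
Proof.
move=> aD bD; apply: pisom_adj; try exact: munit_map_inj.
suff h x y t1 t2 k1 k2 : (x < D)%N -> (y < D)%N ->
    munit_map k D x y (k1, t1) = Some (k2, t2) -> munit_map k D y x (k2, t2) = Some (k1, t1).
  by move=> [k1 t1] [k2 t2]; split; exact: h.
move=> xD yD; rewrite /munit_map /=; case: ifP => //= /andP[/eqP-> /eqP ty] [<- <-].
rewrite eqxx -{1 2}[t1](subnK (leq_mod t1 D)) ty addnK addnK.
have -> : ((t1 - y + x) %% D = x)%N.
  by rewrite {1}(divn_eq t1 D) ty addnK modnMDl modn_small.
by rewrite eqxx /= -ty subnK// leq_mod.
Qed.

Lemma tail_munit n k D a b :
  cmul (tail n) (munit k D a b) = if (n <= k)%N then munit k D a b else 0.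
Proof.
case: ifP => nk.
  apply: pisom_mul; try exact: munit_map_inj; try exact: tail_map_inj.
  by move=> [k' t]; rewrite /munit_map /tail_map /=; case: ifP => //= _; rewrite nk.
apply: pisom_mul0; try exact: munit_map_inj; try exact: tail_map_inj.
by move=> [k' t]; rewrite /munit_map /tail_map /=; case: ifP => //= _; rewrite nk.
Qed.

Lemma munit_tail n k D a b :
  cmul (munit k D a b) (tail n) = if (n <= k)%N then munit k D a b else 0.
Proof.
case: ifP => nk.
  apply: pisom_mul; try exact: munit_map_inj; try exact: tail_map_inj.
  move=> [k' t]; rewrite /munit_map /tail_map /=; case: ifP => //= nk'.
  by case: eqP => // k'k; move: nk'; rewrite k'k nk.
apply: pisom_mul0; try exact: munit_map_inj; try exact: tail_map_inj.
move=> [k' t]; rewrite /munit_map /tail_map /=; case: ifP => //= nk'.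
by case: eqP => // k'k; move: nk'; rewrite k'k nk.
Qed.

Lemma tail_mul m n : cmul (tail m) (tail n) = tail (maxn m n).
Proof.
apply: pisom_mul; try exact: tail_map_inj.
move=> [k' t]; rewrite /tail_map /= geq_max; case: ifP => nk /=; rewrite ?andbT ?andbF//.
Qed.

Lemma tail_adj n : cadj (tail n) = tail n.
Proof.
apply: pisom_adj; try exact: tail_map_inj.
by move=> p q; rewrite /tail_map; split; case: ifP => // np [<-]; rewrite np.
Qed.

(** The residue of [t] modulo [D] is [b] exactly when its residue modulo [D d] is [c D + b] for some
    [c < d]. So the smaller matrices sit block-diagonally in the larger ones, with multiplicity
    [d]. *)
Lemma munit_split k D d a b : (0 < D)%N -> (0 < d)%N -> (a < D)%N -> (b < D)%N ->
  munit k D a b = \sum_(c < d) munit k (D * d) (c * D + a) (c * D + b).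
Proof.
move=> D0 d0 aD bD; apply: (@corner_ext _ _ e).
- exact: munit_corner.
- elim/big_ind : _ => [|x y cx cy|i _]; [exact: csub0 (corner_subalg e)| |exact: munit_corner].
  by have := csubZD (corner_subalg e) 1 cx cy; rewrite scale1r.
- move=> [k' t]; rewrite munit_ket bop_sumE.
  have cd : ((t %/ D) %% d < d)%N by rewrite ltn_mod.
  have tE : (t %% (D * d) = (t %/ D) %% d * D + t %% D)%N.
    rewrite [in LHS](divn_eq t D) [in LHS](divn_eq (t %/ D) d) mulnDl -addnA -mulnA.
    rewrite (mulnC d D) modnMDl modn_small//.
    apply: (@leq_trans ((t %/ D) %% d * D + D)); first by rewrite ltn_add2l ltn_mod.
    by rewrite -mulSnr mulnC leq_mul2l cd orbT.
  rewrite (bigD1 (Ordinal cd))//= big1 ?addr0 => [|c cc].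
    rewrite munit_ket tE eqn_add2l; case: ifP => // /andP[_ /eqP tb].
    congr (ket e (_, _)); have := leq_mod t (D * d); rewrite tE tb.
    set u := (_ * D)%N; lia.
  rewrite munit_ket tE; case: ifP => // /andP[_ /eqP h]; exfalso.
  move/eqP: cc; apply; apply/val_inj => /=.
  have : (((t %/ D) %% d * D + t %% D) %/ D = (c * D + b) %/ D)%N by rewrite h.
  by rewrite !divnMDl// (divn_small (ltn_pmod t D0)) (divn_small bD) !addn0 => ->.
Qed.

(** All residues modulo 1 vanish, so [munit n 1 0 0] is the unit of the component [n]. *)
Lemma tail_split n : tail n = tail n.+1 + munit n 1 0 0.
Proof.
apply: (@corner_ext _ _ e).
- exact: tail_corner.
- by have := csubZD (corner_subalg e) 1 (tail_corner n.+1) (munit_corner n 1 0 0); rewrite scale1r.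
- move=> [k t]; rewrite [RHS](_ : _ = tail n.+1 (ket e (k, t)) + munit n 1 0 0 (ket e (k, t)))//.
  rewrite !tail_ket munit_ket modn1 eqxx andbT subn0 addn0 (leq_eqVlt n) [n == k]eq_sym.
  by case: eqP => [->|_]; rewrite ?ltnn ?add0r// addr0.
Qed.

Lemma tail_unit x : corner e x -> cmul (tail 0) x = x /\ cmul x (tail 0) = x.
Proof.
move=> cx; suff h y : corner e y -> cmul y (tail 0) = y.
  split; last exact: h.
  by rewrite -[LHS]cadjK cadjM tail_adj h ?cadjK//; exact: (csub_adj (corner_subalg e)).
move=> cy; apply: (@corner_ext _ _ e) => //.
  exact: (csubM (corner_subalg e) cy (tail_corner 0)).
by move=> [k t]; rewrite [LHS](_ : _ = y (tail 0 (ket e (k, t))))// tail_ket.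
Qed.

End MatrixUnits.

(** * The algebras C*(Phi f) *)

(** [prime_above] need not return the next prime; a sequence of distinct primes is enough. *)
Fixpoint nprime (n : nat) : nat := if n is n'.+1 then s2val (prime_above (nprime n')) else 2.

Lemma nprime_prime n : prime (nprime n).
Proof. by case: n => //= n; case: (prime_above _). Qed.

Lemma nprime_inj : injective nprime.
Proof.
have lt m n : (m < n)%N -> (nprime m < nprime n)%N.
  elim: n => // n IH; rewrite ltnS leq_eqVlt => /predU1P[->|/IH h] /=.
    by case: (prime_above _).
  by apply: ltn_trans h _; case: (prime_above _).
move=> m n mn; apply/eqP; case: ltngtP => // /lt; by rewrite mn ltnn.
Qed.

Definition dim (f : nat -> nat) (k n : nat) : nat :=
  (\prod_(i < n) nprime i ^ (f i + k))%N.

Lemma dimS f k n : dim f k n.+1 = (dim f k n * nprime n ^ (f n + k))%N.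
Proof. by rewrite /dim big_ord_recr. Qed.

Lemma dim_gt0 f k n : (0 < dim f k n)%N.
Proof. by apply: prodn_gt0 => i; rewrite expn_gt0 prime_gt0// nprime_prime. Qed.

Lemma dim_dvd f k m n : (m <= n)%N -> (dim f k m %| dim f k n)%N.
Proof.
move=> /subnK <-; elim: (n - m)%N => // d IH.
by rewrite addSn dimS; exact: dvdn_mulr.
Qed.

(** The exponents satisfy [f i + k <= g i + (k + m)]: the component index absorbs the additive
    error. *)
Lemma dim_shift f g k m n : (forall i, (f i <= g i + m)%N) ->
  (dim f k n %| dim g (k + m) n)%N.
Proof.
move=> fg; elim: n => [|n IH]; first by rewrite /dim !big_ord0.
rewrite !dimS dvdn_mul// dvdn_exp2l//; have := fg n; lia.
Qed.

Lemma dim_logn f k n i : logn (nprime i) (dim f k n) = if (i < n)%N then (f i + k)%N else 0%N.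
Proof.
elim: n => [|n IH]; first by rewrite /dim big_ord0 logn1.
rewrite dimS lognM ?dim_gt0 ?expn_gt0 ?prime_gt0 ?nprime_prime// IH lognX.
rewrite (logn_prime _ (nprime_prime n)) (inj_eq nprime_inj) ltnS [(i <= n)%N]leq_eqVlt.
by case: eqP => [->|_]; rewrite ?ltnn ?muln1// muln0 addn0.
Qed.

Section ApproxSubalgebra.
Variables (R : realType) (A : cstarAlgType R) (U : set A).
Hypothesis U_ZD : forall (a : R[i]) x y, U x -> U y -> U (a *: x + y).
Hypothesis U0 : U 0.
Hypothesis U_M : forall x y, U x -> U y -> U (cmul x y).
Hypothesis U_adj : forall x, U x -> U (cadj x).

Lemma approx_subalg : is_cstar_subalg (approx U).
Proof.
have ta u x : (forall n, U (u n)) -> tends u x -> approx U x.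
  move=> Uu ux eps /ux[N /(_ N (leqnn N))]; rewrite rnormB.
  by exists (u N).
split.
- move=> a x y /approx_tends[u Uu ux] /approx_tends[v Uv vy].
  by apply: ta (tendsZD a ux vy) => n; exact: U_ZD.
- by move=> eps e0; exists 0 => //; rewrite subrr rnorm0.
- move=> x y /approx_tends[u Uu ux] /approx_tends[v Uv vy].
  by apply: ta (tendsM ux vy) => n; exact: U_M.
- move=> x /approx_tends[u Uu ux].
  by apply: ta (tends_adj ux) => n; exact: U_adj.
- have -> : approx U = closure U by apply/seteqP; split=> x /approx_closure.
  exact: closed_closure.
Qed.

End ApproxSubalgebra.

(** * Finite-dimensional stages and their closure *)

Section Levels.
Variables (R : realType) (H : hilbertType R) (e : nat -> H).
Hypothesis e_on : orthonormal_seq e.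
Local Notation munit := (munit e_on).
Local Notation tail := (tail e_on).

Section OneLevel.
Variables (D : nat -> nat) (n : nat).

(** [None] stands for [tail n], which replaces all components from [n] on by a single scalar. The
    span is thus a direct sum of [n] matrix algebras and one copy of the scalars. *)
Definition level_seq : seq (option (nat * (nat * nat))) :=
  None :: [seq Some (k, ab) | k <- iota 0 n,
    ab <- [seq (a, b) | a <- iota 0 (D k), b <- iota 0 (D k)]].

Definition level_op (g : option (nat * (nat * nat))) : 'B(H) :=
  if g is Some (k, (a, b)) then munit k (D k) a b else tail n.

(** The pair [(n, 0)] of [None] indexes a ket of the component [n], which [tail n] fixes and every
    matrix unit of a component below [n] kills. *)
Definition level_src (g : option (nat * (nat * nat))) : nat * nat :=
  if g is Some (k, (a, b)) then (k, b) else (n, 0%N).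

Definition level_dst (g : option (nat * (nat * nat))) : nat * nat :=
  if g is Some (k, (a, b)) then (k, a) else (n, 0%N).

Lemma pairs_mem d a b : ((a, b) \in [seq (a, b) | a <- iota 0 d, b <- iota 0 d])
  = (a < d)%N && (b < d)%N.
Proof.
apply/allpairsP/andP => [[[x y] /= [hx hy [-> ->]]]|[ad bd]].
  by move: hx hy; rewrite !mem_iota.
by exists (a, b); rewrite !mem_iota.
Qed.

Lemma pairs_uniq d : uniq [seq (a, b) | a <- iota 0 d, b <- iota 0 d].
Proof. by apply: allpairs_uniq; rewrite ?iota_uniq// => -[? ?] [? ?]. Qed.

Lemma level_seq_Some k a b : (Some (k, (a, b)) \in level_seq)
  = [&& k < n, a < D k & b < D k]%N.
Proof.
rewrite inE /=; apply/allpairsPdep/and3P => [[k' [ab [hk hab [kk abE]]]]|[kn ad bd]].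
  by move: hk hab; rewrite -kk -abE mem_iota pairs_mem => h /andP[].
by exists k, (a, b); rewrite mem_iota pairs_mem kn ad bd.
Qed.

Lemma level_seq_uniq : uniq level_seq.
Proof.
rewrite /=; apply/andP; split; first by apply/allpairsPdep => -[? [? []]].
apply: allpairs_uniq_dep => [|k _|]; [exact: iota_uniq|exact: pairs_uniq|].
by move=> [k ab] [k' ab'] _ _ /= [-> ->].
Qed.

Lemma level_biorth g g' : g \in level_seq -> g' \in level_seq ->
  coef e (level_op g) (level_dst g') (level_src g') = (g == g')%:R.
Proof.
case: g => [[k [a b]]|]; case: g' => [[k' [a' b']]|];
  rewrite ?level_seq_Some => h h' /=.
- have {h}/and3P[kn ad bd] := h; have {h'}/and3P[kn' ad' bd'] := h'.
  rewrite munit_coef; congr (_ %:R); congr nat_of_bool.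
  rewrite -[RHS]/((k, (a, b)) == (k', (a', b'))) !xpair_eqE [k' == k]eq_sym.
  have [kk|//] := eqVneq k k'; subst k'.
  rewrite /= modn_small// [b' == b]eq_sym; have [->|] := eqVneq b b'; last by rewrite andbF.
  by rewrite subnn add0n andbT eq_sym.
- rewrite munit_coef; have {h}/and3P[kn _ _] := h.
  by rewrite gtn_eqF//.
- have {h'}/and3P[kn _ _] := h'.
  by rewrite /coef tail_ket leqNgt kn /= linear0l.
- by rewrite tail_coef leqnn.
Qed.

Lemma level_mul g g' : g \in level_seq -> g' \in level_seq ->
  cmul (level_op g) (level_op g') = 0 \/
  exists2 g'', g'' \in level_seq & cmul (level_op g) (level_op g') = level_op g''.
Proof.
case: g => [[k [a b]]|]; case: g' => [[k' [a' b']]|];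
  rewrite ?level_seq_Some => h h' /=.
- have {h}/and3P[kn ad bd] := h; have {h'}/and3P[kn' ad' bd'] := h'.
  have [kk|/munit_mul0->] := eqVneq k k'; last by left.
  subst k'; rewrite munit_mul//; case: ifP => _; last by left.
  by right; exists (Some (k, (a, b'))) => //; rewrite level_seq_Some kn ad bd'.
- by have {h}/and3P[kn _ _] := h; rewrite munit_tail leqNgt kn; left.
- by have {h'}/and3P[kn _ _] := h'; rewrite tail_munit leqNgt kn; left.
- by right; exists None => //; rewrite tail_mul maxnn.
Qed.

Lemma level_adj g : g \in level_seq ->
  exists2 g', g' \in level_seq & cadj (level_op g) = level_op g'.
Proof.
case: g => [[k [a b]]|]; rewrite ?level_seq_Some => h.
  have {h}/and3P[kn ad bd] := h.
  exists (Some (k, (b, a))); first by rewrite level_seq_Some kn ad bd.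
  by rewrite /= munit_adj.
by exists None => //; rewrite /level_op tail_adj.
Qed.

Definition level_alg : cstarSubalg 'B(H) :=
  frame_alg e_on level_seq_uniq level_biorth level_mul level_adj.

End OneLevel.

Variable f : nat -> nat.

Definition stage n : cstarSubalg 'B(H) := level_alg (fun k => dim f k n) n.

Lemma stage_tail n : csub_carrier (stage n) (tail n).
Proof.
apply: (frame_span_op (level_seq_uniq _ _) (@level_biorth _ _)) (_ : None \in _).
by rewrite inE.
Qed.

Lemma stage_munit k n a b : (k < n)%N -> (a < dim f k n)%N -> (b < dim f k n)%N ->
  csub_carrier (stage n) (munit k (dim f k n) a b).
Proof.
move=> kn ad bd.
apply: (frame_span_op (level_seq_uniq _ _) (@level_biorth _ _)) (_ : Some (k, (a, b)) \in _).
by rewrite level_seq_Some kn ad.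
Qed.

Lemma csub_sum (A : cstarAlgType R) (S : cstarSubalg A) I (r : seq I) (P : pred I) (F : I -> A) :
  (forall i, P i -> csub_carrier S (F i)) -> csub_carrier S (\sum_(i <- r | P i) F i).
Proof.
move=> SF; apply: big_ind => // [|x y Sx Sy]; first exact: csub0 (csub_subproof S).
by have := csubZD (csub_subproof S) 1 Sx Sy; rewrite scale1r.
Qed.

Lemma stage_munit_dvd k n D a b : (k < n)%N -> (D %| dim f k n)%N ->
  (a < D)%N -> (b < D)%N -> csub_carrier (stage n) (munit k D a b).
Proof.
move=> kn /dvdnP[d dD] ad bd.
have D0 : (0 < D)%N by exact: leq_trans ad.
have d0 : (0 < d)%N by have := dim_gt0 f k n; rewrite dD muln_gt0 => /andP[].
rewrite (munit_split _ _ D0 d0)// mulnC -dD; apply: csub_sum => c _.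
have cD x : (x < D)%N -> (c * D + x < dim f k n)%N.
  move=> xD; rewrite dD; apply: (@leq_trans (c * D + D)); first by rewrite ltn_add2l.
  by rewrite -mulSnr leq_mul2r ltn_ord orbT.
by apply: stage_munit => //; exact: cD.
Qed.

(** Old matrix units are refined by [munit_split], and [tail n] sheds the unit of the component [n],
    which the next stage contains as a 1 x 1 unit. *)
Lemma stage_mono n : csub_carrier (stage n) `<=` csub_carrier (stage n.+1).
Proof.
have [SZD S0 _ _ _] := csub_subproof (stage n.+1).
apply: frame_span_ind => // -[[k [a b]]|].
  rewrite level_seq_Some => /and3P[kn ad bd].
  by apply: stage_munit_dvd => //; [exact: ltnW|exact: dim_dvd].
move=> _; rewrite /level_op tail_split addrC -[munit _ _ _ _]scale1r.
apply: SZD; last exact: stage_tail.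
by apply: stage_munit_dvd => //; exact: dvd1n.
Qed.

Lemma stage_le m n : (m <= n)%N -> csub_carrier (stage m) `<=` csub_carrier (stage n).
Proof.
by move=> /subnK <-; elim: (n - m)%N => // d IH x /IH; rewrite addSn; exact: stage_mono.
Qed.

(** The index [j] alone encodes [k], [n], [a], [b], and [f] enters only through [dim f k n]; this is
    what makes the map to sequences Borel. Out-of-range entries and numbers that code nothing give
    0. *)
Definition generator (j : nat) : 'B(H) :=
  match unpickle j : option (nat + (nat * nat) * (nat * nat)) with
  | Some (inl n) => tail n
  | Some (inr ((k, n), (a, b))) =>
      if (a < dim f k n)%N && (b < dim f k n)%N then munit k (dim f k n) a b else 0
  | None => 0
  end.

Definition alg : cstarSubalg 'B(H) := cstar_generated generator.

Lemma alg_ind (S : set 'B(H)) : is_cstar_subalg S -> (forall n, S (tail n)) ->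
  (forall k n a b, (a < dim f k n)%N -> (b < dim f k n)%N -> S (munit k (dim f k n) a b)) ->
  csub_carrier alg `<=` S.
Proof.
move=> Ssub Stail Smunit x; apply; split=> // _ [j _ <-]; rewrite /generator.
case: unpickle => [[n|[[k n] [a b]]]|]; [exact: Stail| |exact: csub0].
by case: ifP => [/andP[ad bd]|_]; [exact: Smunit|exact: csub0].
Qed.

Lemma alg_generator j : csub_carrier alg (generator j).
Proof. by move=> S [_]; apply; exists j. Qed.

Lemma alg_tail n : csub_carrier alg (tail n).
Proof.
have := alg_generator (pickle (inl n : nat + (nat * nat) * (nat * nat))).
by rewrite /generator pickleK.
Qed.

Lemma alg_munit k n a b : (a < dim f k n)%N -> (b < dim f k n)%N ->
  csub_carrier alg (munit k (dim f k n) a b).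
Proof.
move=> ad bd.
have := alg_generator (pickle (inr ((k, n), (a, b)) : nat + (nat * nat) * (nat * nat))).
by rewrite /generator pickleK ad bd.
Qed.

Lemma alg_corner : csub_carrier alg `<=` corner e.
Proof.
apply: alg_ind => [|n|k n a b _ _]; [exact: corner_subalg|exact: tail_corner|exact: munit_corner].
Qed.

Lemma stage_alg n : csub_carrier (stage n) `<=` csub_carrier alg.
Proof.
have [SZD S0 _ _ _] := csub_subproof alg.
apply: frame_span_ind => // -[[k [a b]]|].
  by rewrite level_seq_Some => /and3P[kn ad bd]; exact: alg_munit.
by move=> _; exact: alg_tail.
Qed.

(** The stages form a chain, so the closure of their union is a C*-subalgebra, and it contains the
    generators. *)
Lemma alg_dense x : csub_carrier alg x -> approx (\bigcup_n csub_carrier (stage n)) x.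
Proof.
have U2 y z : (\bigcup_n csub_carrier (stage n)) y -> (\bigcup_n csub_carrier (stage n)) z ->
    exists n, csub_carrier (stage n) y /\ csub_carrier (stage n) z.
  move=> [m _ my] [n _ nz]; exists (maxn m n).
  by split; [exact: (stage_le (leq_maxl m n) my)|exact: (stage_le (leq_maxr m n) nz)].
have ap (S : set 'B(H)) y : S y -> approx S y.
  by move=> Sy eps e0; exists y => //; rewrite subrr rnorm0.
move: x; apply: alg_ind => [|n|k n a b ad bd].
- apply: approx_subalg => [a y z /U2 h /h[n [ny nz]]||y z /U2 h /h[n [ny nz]]|y [n _ ny]].
  + by exists n => //; exact: csubZD (csub_subproof (stage n)) _ _ _ ny nz.
  + by exists 0%N => //; exact: csub0 (csub_subproof (stage 0)).
  + by exists n => //; exact: csubM (csub_subproof (stage n)) _ _ ny nz.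
  by exists n => //; exact: csub_adj (csub_subproof (stage n)) _ ny.
- by apply: ap; exists n => //; exact: stage_tail.
(* The stage must both include the component [k] and have matrices of a size divisible by
   [dim f k n]. *)
- apply: ap; exists (maxn k.+1 n) => //; apply: stage_munit_dvd => //.
    by rewrite leq_maxl.
  by apply: dim_dvd; rewrite leq_maxr.
Qed.

Lemma alg_unit x : csub_carrier alg x -> cmul (tail 0) x = x /\ cmul x (tail 0) = x.
Proof. by move=> /alg_corner; exact: tail_unit. Qed.

Lemma alg_AF : AF (csub_type alg).
Proof.
apply: (@AF_chain _ _ stage alg (tail 0)).
- exact: alg_unit.
- move=> n; apply: (stage_le (leq0n n)); exact: stage_tail.
- exact: stage_mono.
- exact: stage_alg.
- exact: alg_dense.
- by move=> n; exact: frame_alg_finite_dim.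
Qed.

Lemma alg_unital : unital (csub_type alg).
Proof.
exists (CsubType (mem_set (alg_tail 0))) => x.
have [h1 h2] := alg_unit (set_mem (csub_valP x)).
by split; exact/val_inj.
Qed.

End Levels.

(** * Embeddings *)

Section Embedding.
Variables (R : realType) (H : hilbertType R) (e : nat -> H).
Hypothesis e_on : orthonormal_seq e.
Local Notation munit := (munit e_on).
Local Notation tail := (tail e_on).
Local Notation shift := (shift e_on).

Lemma alg_munit_dvd f k n D a b : (D %| dim f k n)%N -> (a < D)%N -> (b < D)%N ->
  csub_carrier (alg e_on f) (munit k D a b).
Proof.
move=> Dd ad bd; apply: (@stage_alg _ _ _ _ _ (maxn k.+1 n)).
apply: stage_munit_dvd => //; first by rewrite leq_maxl.
by apply: dvdn_trans Dd (dim_dvd _ _ _); rewrite leq_maxr.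
Qed.

Definition unshift_map m (p : nat * nat) : option (nat * nat) :=
  if (m <= p.1)%N then Some (p.1 - m, p.2)%N else None.

Lemma unshift_map_inj m : partial_inj (unshift_map m).
Proof.
move=> [k1 t1] [k2 t2] r; rewrite /unshift_map /=.
case: ifP => // h1 [<-]; case: ifP => // h2 [h ->].
by congr (_, _); rewrite -(subnK h1) -(subnK h2) h.
Qed.

Lemma shift_adj m : cadj (shift m) = pisom e_on (unshift_map m).
Proof.
apply: pisom_adj; [exact: shift_map_inj|exact: unshift_map_inj|].
move=> [k1 t1] [k2 t2]; rewrite /shift_map /unshift_map /=; split.
  by move=> [<- <-]; rewrite leq_addl addnK.
by case: ifP => // h [<- <-]; rewrite subnK.
Qed.

Lemma shift_isometry m : cmul (cadj (shift m)) (shift m) = tail 0.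
Proof.
rewrite shift_adj.
apply: pisom_mul; [exact: unshift_map_inj|exact: shift_map_inj|exact: tail_map_inj|].
by move=> [k t]; rewrite /shift_map /unshift_map /tail_map /= leq_addl addnK.
Qed.

Definition conj_shift m (x : 'B(H)) : 'B(H) := cmul (cmul (shift m) x) (cadj (shift m)).

(** [s] is [t] read with all components lowered by [m], and [t] lives on components [m] and above,
    where truncated subtraction loses nothing. *)
Lemma conj_shift_pisom m s t : partial_inj s -> partial_inj t ->
  (forall k u, s (k, u) = omap (fun p => (p.1 - m, p.2)%N) (t (k + m, u)%N)) ->
  (forall p q, t p = Some q -> (m <= p.1)%N /\ (m <= q.1)%N) ->
  conj_shift m (pisom e_on s) = pisom e_on t.
Proof.
move=> si ti st tm.
have ri : partial_inj (fun p => t (p.1 + m, p.2)%N).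
  by move=> [k u] [k' u'] r /= h /(ti _ _ _ h)[/addIn-> ->].
rewrite /conj_shift shift_adj.
have -> : cmul (shift m) (pisom e_on s) = pisom e_on (fun p => t (p.1 + m, p.2)%N).
  apply: pisom_mul => //; first exact: shift_map_inj.
  move=> [k u]; rewrite st /=; case E : (t _) => [[k' u']|] //=.
  by have [_ /= h] := tm _ _ E; rewrite /shift_map /= subnK.
apply: pisom_mul => //; first exact: unshift_map_inj.
move=> [k u]; rewrite /unshift_map /=; case: ifP => h /=; first by rewrite subnK.
by case E : (t _) => [q|] //; have [/= ] := tm _ _ E; rewrite h.
Qed.

Lemma conj_shift_tail m n : conj_shift m (tail n) = tail (n + m).
Proof.
apply: conj_shift_pisom; [exact: tail_map_inj|exact: tail_map_inj| |].
  by move=> k u; rewrite /tail_map /= leq_add2r; case: ifP => //= _; rewrite addnK.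
move=> p q; rewrite /tail_map; case: ifP => // h [<-].
by have := leq_trans (leq_addl n m) h.
Qed.

Lemma conj_shift_munit m k D a b : conj_shift m (munit k D a b) = munit (k + m) D a b.
Proof.
apply: conj_shift_pisom; [exact: munit_map_inj|exact: munit_map_inj| |].
  move=> k' u; rewrite /munit_map /= eqn_add2r; case: ifP => //= _.
  by rewrite addnK.
move=> p q; rewrite /munit_map; case: ifP => // /andP[/eqP -> _] [<-] /=.
by rewrite leq_addl.
Qed.

Lemma conj_shiftZD m (a : R[i]) x y :
  conj_shift m (a *: x + y) = a *: conj_shift m x + conj_shift m y.
Proof. by rewrite /conj_shift cmulDr cmulZr cmulDl cmulZl. Qed.

Lemma conj_shift_adj m x : conj_shift m (cadj x) = cadj (conj_shift m x).
Proof. by rewrite /conj_shift !cadjM cadjK cmulA. Qed.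

Lemma conj_shift_mul m x y : corner e x ->
  conj_shift m (cmul x y) = cmul (conj_shift m x) (conj_shift m y).
Proof.
move=> cx; rewrite /conj_shift !cmulA; congr (cmul (cmul _ y) _).
by rewrite -[RHS]cmulA shift_isometry -cmulA (proj2 (tail_unit e_on cx)).
Qed.

Lemma conj_shift_le m x :
  rnorm (conj_shift m x) <= rnorm (shift m) * rnorm (cadj (shift m)) * rnorm x.
Proof.
apply: (le_trans (rnormM _ _)); rewrite mulrAC.
by rewrite ler_wpM2r ?rnorm_ge0// rnormM.
Qed.

Lemma conj_shift_inj m x y : corner e x -> corner e y -> conj_shift m x = conj_shift m y -> x = y.
Proof.
suff h z : corner e z -> cmul (cmul (cadj (shift m)) (conj_shift m z)) (shift m) = z.
  by move=> /h {2}<- /h {2}<- ->.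
move=> cz; rewrite /conj_shift !cmulA shift_isometry -cmulA shift_isometry.
by have [-> ->] := tail_unit e_on cz.
Qed.

Lemma preimage_closed (A B : cstarAlgType R) (h : A -> B) (C : R) (S : set B) : 0 <= C ->
  (forall x y, h (x - y) = h x - h y) -> (forall x, rnorm (h x) <= C * rnorm x) ->
  closed S -> closed [set x | S (h x)].
Proof.
move=> C0 hB hC cS; apply: approx_closed => x ax; apply: (@closed_approx _ _ S (h x)) => // eps e0.
have [|s Ss xs] := ax (eps / (C + 1)); first by rewrite divr_gt0// ltr_wpDl.
exists (h s) => //; rewrite -hB; apply: le_lt_trans (hC _) _.
rewrite ltr_pdivlMr ?ltr_wpDl// in xs; have := rnorm_ge0 (x - s); lra.
Qed.

Lemma alg_conj_shift f g m : (forall i, (f i <= g i + m)%N) ->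
  csub_carrier (alg e_on f) `<=` [set x | csub_carrier (alg e_on g) (conj_shift m x)].
Proof.
move=> fg; have [GZD G0 GM Gadj Gcl] := csub_subproof (alg e_on g).
(* Membership in [corner] is carried along because multiplicativity of [conj_shift] is established
   only there. *)
suff h : csub_carrier (alg e_on f) `<=`
    corner e `&` [set x | csub_carrier (alg e_on g) (conj_shift m x)] by move=> x /h[].
have cs0 : conj_shift m 0 = 0 by rewrite /conj_shift cmul0r cmul0l.
have csB x y : conj_shift m (x - y) = conj_shift m x - conj_shift m y.
  by rewrite addrC -scaleN1r conj_shiftZD scaleN1r addrC.
apply: alg_ind => [|n|k n a b ad bd].
- split.
  + move=> a x y [cx Gx] [cy Gy]; split; first exact: csubZD (corner_subalg e) _ _ _ cx cy.
    by rewrite /= conj_shiftZD; exact: GZD.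
  + by split; [exact: csub0 (corner_subalg e)|rewrite /= cs0].
  + move=> x y [cx Gx] [cy Gy]; split; first exact: csubM (corner_subalg e) _ _ cx cy.
    by rewrite /= conj_shift_mul//; exact: GM.
  + move=> x [cx Gx]; split; first exact: csub_adj (corner_subalg e) _ cx.
    by rewrite /= conj_shift_adj; exact: Gadj.
  + apply: closedI; first exact: csub_closed (corner_subalg e).
    apply: preimage_closed csB (@conj_shift_le m) Gcl.
    by rewrite mulr_ge0 ?rnorm_ge0.
- by split; [exact: tail_corner|rewrite /= conj_shift_tail; exact: alg_tail].
- split; first exact: munit_corner.
  by rewrite /= conj_shift_munit; apply: alg_munit_dvd (dim_shift _ _ fg) _ _.
Qed.

(** The embedding sends the unit [tail 0] to [tail m], so it preserves units only for [m = 0]. *)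
Lemma alg_embeds f g : Defs.le_inf f g ->
  exists psi : csub_type (alg e_on f) -> csub_type (alg e_on g), star_mono psi.
Proof.
move=> [m fg].
exists (fun x => CsubType (mem_set (alg_conj_shift fg (set_mem (csub_valP x))))).
have cr (x : csub_type (alg e_on f)) : corner e (csub_val x).
  exact/alg_corner/set_mem/(csub_valP x).
split; first split.
- by move=> a x y; apply/val_inj; exact: conj_shiftZD.
- by move=> x y; apply/val_inj; exact: conj_shift_mul.
- by move=> x; apply/val_inj; exact: conj_shift_adj.
- move=> x y /(congr1 csub_val) /= h; apply/val_inj.
  exact: conj_shift_inj h.
Qed.

End Embedding.

(** * UHF components and their traces *)

(** In a full-rank factorization [A = P Q], cancelling [P] on the left and [Q] on the right of
    [P Q P Q = P Q] leaves [Q P = 1], whose size is the rank. *)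
Lemma mxtrace_idempotent (F : fieldType) n (A : 'M[F]_n) :
  A *m A = A -> \tr A = (\rank A)%:R.
Proof.
move=> AA; have [B colB] := row_fullP (col_base_full A).
have [C rowC] := row_freeP (row_base_free A).
have cancel r (P : 'M[F]_(n, r)) (Q : 'M[F]_(r, n)) B' C' : B' *m P = 1%:M ->
    Q *m C' = 1%:M -> P *m Q *m (P *m Q) = P *m Q -> Q *m P = 1%:M.
  move=> BP QC PQ.
  have : B' *m (P *m Q *m (P *m Q)) *m C' = B' *m (P *m Q) *m C' by rewrite PQ.
  by rewrite !mulmxA BP !mul1mx QC -mulmxA QC mulmx1.
rewrite -{1}(mulmx_base A) mxtrace_mulC (cancel _ _ _ _ _ colB rowC) ?mxtrace1//.
by rewrite mulmx_base AA.
Qed.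

Lemma approx_sub (R : realType) (V : completeNormedModType R[i]) (S : set V) : S `<=` approx S.
Proof. by move=> x Sx eps e0; exists x => //; rewrite subrr rnorm0. Qed.

Section Blocks.
Variables (R : realType) (H : hilbertType R) (e : nat -> H).
Hypothesis e_on : orthonormal_seq e.
Variable k : nat.
Local Notation munit := (munit e_on).
Local Notation tail := (tail e_on).
Implicit Types (D d n m : nat) (x y : 'B(H)).

Definition block_seq D : seq (nat * nat) := [seq (a, b) | a <- iota 0 D, b <- iota 0 D].

Definition block_op D (g : nat * nat) : 'B(H) := munit k D g.1 g.2.

Lemma block_biorth D g g' : g \in block_seq D -> g' \in block_seq D ->
  coef e (block_op D g) (k, g'.1) (k, g'.2) = (g == g')%:R.
Proof.
case: g g' => [a b] [a' b']; rewrite !pairs_mem => /andP[ad bd] /andP[ad' bd'].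
rewrite munit_coef eqxx modn_small//= xpair_eqE [b' == b]eq_sym.
by case: eqP => [->|_]; rewrite ?andbF// subnn add0n andbT eq_sym.
Qed.

Lemma block_mul D g g' : g \in block_seq D -> g' \in block_seq D ->
  cmul (block_op D g) (block_op D g') = 0 \/
  exists2 g'', g'' \in block_seq D & cmul (block_op D g) (block_op D g') = block_op D g''.
Proof.
case: g g' => [a b] [a' b']; rewrite !pairs_mem => /andP[ad bd] /andP[ad' bd'].
rewrite /block_op munit_mul//=; case: ifP => _; last by left.
by right; exists (a, b') => //; rewrite pairs_mem ad bd'.
Qed.

Lemma block_adj D g : g \in block_seq D ->
  exists2 g', g' \in block_seq D & cadj (block_op D g) = block_op D g'.
Proof.
case: g => [a b]; rewrite pairs_mem => /andP[ad bd].
by exists (b, a); [rewrite pairs_mem bd ad|rewrite /block_op munit_adj].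
Qed.

Definition block D : cstarSubalg 'B(H) :=
  @frame_alg _ _ _ e_on _ _ (block_op D) (fun g => (k, g.2)) (fun g => (k, g.1))
    (pairs_uniq D) (@block_biorth D) (@block_mul D) (@block_adj D).

Lemma block_munit D a b : (a < D)%N -> (b < D)%N -> csub_carrier (block D) (munit k D a b).
Proof.
move=> ad bd; apply: (frame_span_op (pairs_uniq D) (@block_biorth D)) (_ : (a, b) \in _).
by rewrite pairs_mem ad.
Qed.

Lemma block_ind D (P : set 'B(H)) :
  (forall (a : R[i]) x y, P x -> P y -> P (a *: x + y)) -> P 0 ->
  (forall a b, (a < D)%N -> (b < D)%N -> P (munit k D a b)) ->
  forall x, csub_carrier (block D) x -> P x.
Proof.
move=> PZD P0 Pm; apply: frame_span_ind => // -[a b].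
by rewrite pairs_mem => /andP[]; exact: Pm.
Qed.

Lemma block_munit_dvd D D' a b : (0 < D')%N -> (D %| D')%N -> (a < D)%N -> (b < D)%N ->
  csub_carrier (block D') (munit k D a b).
Proof.
move=> D'0 /dvdnP[d dD] ad bd; rewrite {}dD in D'0 *.
have := D'0; rewrite muln_gt0 => /andP[d0 D0].
rewrite (munit_split _ _ D0 d0)// mulnC; apply: csub_sum => c _.
have cD (x : nat) : (x < D)%N -> (c * D + x < D * d)%N.
  move=> xD; apply: (@leq_trans (c * D + D)); first by rewrite ltn_add2l.
  by rewrite -mulSnr mulnC leq_mul2l ltn_ord orbT.
by apply: block_munit; exact: cD.
Qed.

Lemma block_sub D D' : (0 < D')%N -> (D %| D')%N ->
  csub_carrier (block D) `<=` csub_carrier (block D').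
Proof.
move=> D'0 DD'; have [SZD S0 _ _ _] := csub_subproof (block D').
by apply: block_ind => // a b; exact: block_munit_dvd.
Qed.

Definition cunit : 'B(H) := munit k 1 0 0.

Lemma cunit_munit D a b : cmul cunit (munit k D a b) = munit k D a b.
Proof.
apply: pisom_mul; try exact: munit_map_inj.
move=> [k' t]; rewrite /munit_map /=; case: ifP => //= _.
by rewrite eqxx modn1 /= subn0 addn0.
Qed.

Lemma munit_cunit D a b : cmul (munit k D a b) cunit = munit k D a b.
Proof.
apply: pisom_mul; try exact: munit_map_inj.
move=> [k' t]; rewrite /munit_map /= modn1 eqxx andbT.
by have [_|] := eqVneq k' k; rewrite //= subn0 addn0 eqxx.
Qed.

Lemma cunit_idem : cmul cunit cunit = cunit. Proof. exact: cunit_munit. Qed.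

Lemma cunit_adj : cadj cunit = cunit. Proof. exact: munit_adj. Qed.

Lemma block_cunit D : (0 < D)%N -> csub_carrier (block D) cunit.
Proof. by move=> D0; apply: block_munit_dvd => //; exact: dvd1n. Qed.

Lemma block_unit D x : csub_carrier (block D) x -> cmul cunit x = x /\ cmul x cunit = x.
Proof.
move: x; apply: block_ind => [a x y [x1 x2] [y1 y2]||a b _ _].
- by rewrite cmulDl cmulDr cmulZl cmulZr x1 x2 y1 y2.
- by rewrite cmul0l cmul0r.
- by rewrite cunit_munit munit_cunit.
Qed.

Definition block_mx D x : 'M[R[i]]_D := \matrix_(a, b) coef e x (k, val a) (k, val b).

Lemma block_mxZD D (a : R[i]) x y : block_mx D (a *: x + y) = a *: block_mx D x + block_mx D y.
Proof. by apply/matrixP => i j; rewrite !mxE coefZD. Qed.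

Lemma block_mx_munit D (a b : 'I_D) : block_mx D (munit k D a b) = delta_mx a b.
Proof.
apply/matrixP => i j; rewrite !mxE.
have := @block_biorth D (val a, val b) (val i, val j); rewrite !pairs_mem !ltn_ord => ->//.
by congr (_%:R); rewrite xpair_eqE [val a == _]eq_sym [val b == _]eq_sym.
Qed.

Lemma block_mx0 D : block_mx D 0 = 0.
Proof. by apply/matrixP => i j; rewrite !mxE coef0. Qed.

Lemma block_mxM D x y : csub_carrier (block D) x -> csub_carrier (block D) y ->
  block_mx D (cmul x y) = block_mx D x *m block_mx D y.
Proof.
move=> + By; move: x; apply: block_ind => [a x x' hx hx'||a b aD bD].
- by rewrite cmulDl cmulZl !block_mxZD hx hx' mulmxDl -scalemxAl.
- by rewrite cmul0l !block_mx0 mul0mx.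
move: y By; apply: block_ind => [c x x' hx hx'||c d cD dD].
- by rewrite cmulDr cmulZr !block_mxZD hx hx' mulmxDr -scalemxAr.
- by rewrite cmul0r !block_mx0 mulmx0.
rewrite munit_mul//.
rewrite (block_mx_munit (Ordinal aD) (Ordinal bD)) (block_mx_munit (Ordinal cD) (Ordinal dD)).
rewrite mul_delta_mx_cond -[Ordinal bD == Ordinal cD]/(b == c).
case: eqP => _; first by rewrite (block_mx_munit (Ordinal aD) (Ordinal dD)).
by rewrite block_mx0.
Qed.

Lemma block_mx_eq0 D x : csub_carrier (block D) x -> block_mx D x = 0 -> x = 0.
Proof.
move=> Bx x0; rewrite [x]Bx big_seq big1// => -[a b].
rewrite pairs_mem => /andP[aD bD] /=.
by have /matrixP/(_ (Ordinal aD) (Ordinal bD)) := x0; rewrite !mxE => ->; rewrite scale0r.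
Qed.

(** The normalized trace of the compression to the first [D] kets of the component [k]. It is linear
    and contractive on all of ['B(H)], so it can be evaluated on limits, but its trace property is
    used only on [block D]. *)
Definition ntrace D x : R[i] := \tr (block_mx D x) / D%:R.

Lemma ntraceZD D (a : R[i]) x y : ntrace D (a *: x + y) = a * ntrace D x + ntrace D y.
Proof. by rewrite /ntrace block_mxZD raddfD /= mxtraceZ mulrDl mulrA. Qed.

Lemma ntrace0 D : ntrace D 0 = 0.
Proof. by rewrite /ntrace block_mx0 raddf0 mul0r. Qed.

Lemma ntraceD D x y : ntrace D (x + y) = ntrace D x + ntrace D y.
Proof. by have := ntraceZD D 1 x y; rewrite scale1r mul1r. Qed.

Lemma ntraceB D x y : ntrace D (x - y) = ntrace D x - ntrace D y.
Proof. by rewrite addrC -scaleN1r ntraceZD mulN1r addrC. Qed.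

Lemma Re_normD (a b : R[i]) : complex.Re `|a + b| <= complex.Re `|a| + complex.Re `|b|.
Proof. by rewrite -lecR rmorphD /= -!normC_Re; exact: ler_normD. Qed.

Lemma ntrace_le D x : (0 < D)%N -> complex.Re `|ntrace D x| <= rnorm x.
Proof.
move=> D0; have D0' : (0 : R[i]) < D%:R by rewrite ltr0n.
rewrite -lecR -normC_Re /ntrace normrM normfV [`|D%:R|]ger0_norm ?ler0n//.
rewrite ler_pdivrMr// mulr_natr /mxtrace.
apply: (le_trans (ler_norm_sum _ _ _)).
rewrite -[X in _ *+ X](card_ord D) -sumr_const; apply: ler_sum => i _.
by rewrite mxE normC_Re lecR coef_le.
Qed.

Lemma ntrace_comm D x y : csub_carrier (block D) x -> csub_carrier (block D) y ->
  ntrace D (cmul x y) = ntrace D (cmul y x).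
Proof. by move=> Bx By; rewrite /ntrace (block_mxM Bx By) (block_mxM By Bx) mxtrace_mulC. Qed.

Lemma ntrace_munit D a b : (a < D)%N -> (b < D)%N ->
  ntrace D (munit k D a b) = (a == b)%:R / D%:R.
Proof.
move=> aD bD; rewrite /ntrace (block_mx_munit (Ordinal aD) (Ordinal bD)); congr (_ / _).
rewrite /mxtrace (bigD1 (Ordinal aD))//= mxE eqxx big1 ?addr0// => i ia.
by rewrite mxE (negbTE ia).
Qed.

(** Refinement replaces a unit by [d] units, each carrying [1/d] of its trace. *)
Lemma ntrace_block D d x : (0 < D)%N -> (0 < d)%N -> csub_carrier (block D) x ->
  ntrace (D * d) x = ntrace D x.
Proof.
move=> D0 d0; move: x; apply: block_ind => [a x y hx hy||a b aD bD].
- by rewrite !ntraceZD hx hy.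
- by rewrite !ntrace0.
rewrite ntrace_munit// (munit_split _ _ D0 d0)//.
rewrite (big_morph (ntrace (D * d)) (ntraceD _) (ntrace0 _)).
have cD (c : 'I_d) (y : nat) : (y < D)%N -> (c * D + y < D * d)%N.
  move=> yD; apply: (@leq_trans (c * D + D)); first by rewrite ltn_add2l.
  by rewrite -mulSnr mulnC leq_mul2l ltn_ord orbT.
rewrite (eq_bigr (fun=> (a == b)%:R / (D * d)%:R)).
  have Dn : (D%:R : R[i]) != 0 by rewrite pnatr_eq0 -lt0n.
  have dn : (d%:R : R[i]) != 0 by rewrite pnatr_eq0 -lt0n.
  rewrite sumr_const card_ord -[LHS]mulr_natr natrM invfM -!mulrA.
  by rewrite mulVf// mulr1.
by move=> c _; rewrite ntrace_munit ?cD// eqn_add2l.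
Qed.

Lemma ntrace_idempotent D p : csub_carrier (block D) p -> cmul p p = p ->
  exists2 c : nat, ntrace D p = c%:R / D%:R & c = 0%N -> p = 0.
Proof.
move=> Bp pp; exists (\rank (block_mx D p)).
  by rewrite /ntrace mxtrace_idempotent// -block_mxM// pp.
by move/eqP; rewrite mxrank_eq0 => /eqP; exact: block_mx_eq0.
Qed.

Variable g : nat -> nat.
Local Notation d := (dim g k).

Lemma dim_mul m n : (m <= n)%N -> exists2 c, (0 < c)%N & d n = (d m * c)%N.
Proof.
move=> /(dim_dvd g k)/dvdnP[c cE]; exists c; last by rewrite cE mulnC.
by have := dim_gt0 g k n; rewrite cE muln_gt0 => /andP[].
Qed.

Definition uhf : set 'B(H) := approx (\bigcup_n csub_carrier (block (d n))).

Lemma blocks_common x y : (\bigcup_n csub_carrier (block (d n))) x ->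
  (\bigcup_n csub_carrier (block (d n))) y ->
  exists n, csub_carrier (block (d n)) x /\ csub_carrier (block (d n)) y.
Proof.
move=> [m _ mx] [n _ ny]; exists (maxn m n).
by split; [apply: block_sub mx|apply: block_sub ny];
  rewrite ?dim_gt0//; apply: dim_dvd; rewrite ?leq_maxl ?leq_maxr.
Qed.

Lemma uhf_subalg : is_cstar_subalg uhf.
Proof.
apply: approx_subalg =>
  [a y z /blocks_common h /h[n [ny nz]]||y z /blocks_common h /h[n [ny nz]]|y [n _ ny]].
- by exists n => //; exact: (csubZD (csub_subproof (block (d n))) _ ny nz).
- by exists 0%N => //; exact: csub0 (csub_subproof (block (d 0))).
- by exists n => //; exact: (csubM (csub_subproof (block (d n))) ny nz).
- by exists n => //; exact: (csub_adj (csub_subproof (block (d n))) ny).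
Qed.

Lemma block_uhf n : csub_carrier (block (d n)) `<=` uhf.
Proof. by move=> x Bx; apply: approx_sub; exists n. Qed.

Lemma uhf_unit x : uhf x -> cmul cunit x = x /\ cmul x cunit = x.
Proof.
move=> /approx_tends[u Bu ux]; split; apply: (tends_unique _ ux).
  have -> : u = fun n => cmul cunit (u n).
    by apply/funext => n; have [m _ /block_unit[-> _]] := Bu n.
  exact: tendsM (tends_cst _) ux.
have -> : u = fun n => cmul (u n) cunit.
  by apply/funext => n; have [m _ /block_unit[_ ->]] := Bu n.
exact: tendsM ux (tends_cst _).
Qed.

(* The normalized traces of [x] on the blocks tend to [0]; for [x] in [uhf] this
   means that the tracial state vanishes at [x]. *)
Definition null_trace x := forall eps : R, 0 < eps ->
  exists N, forall n, (N <= n)%N -> complex.Re `|ntrace (d n) x| < eps.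

Lemma null_traceD x y : null_trace x -> null_trace y -> null_trace (x + y).
Proof.
move=> hx hy eps e0.
have [|N HN] := hx (eps / 2); first by rewrite divr_gt0.
have [|M HM] := hy (eps / 2); first by rewrite divr_gt0.
exists (maxn N M) => n; rewrite geq_max => /andP[/HN h1 /HM h2].
have := Re_normD (ntrace (d n) x) (ntrace (d n) y); rewrite -ntraceD; lra.
Qed.

Lemma null_trace0 : null_trace 0.
Proof. by move=> eps e0; exists 0%N => n _; rewrite ntrace0 normr0. Qed.

Lemma null_traceN x : null_trace x -> null_trace (- x).
Proof.
move=> hx eps /hx[N HN]; exists N => n /HN.
by rewrite -[- x]add0r ntraceB ntrace0 sub0r normrN.
Qed.

Lemma null_trace_sum I (r : seq I) (F : I -> 'B(H)) :
  (forall i, null_trace (F i)) -> null_trace (\sum_(i <- r) F i).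
Proof.
move=> hF; elim/big_rec : _ => [|i x _ hx]; first exact: null_trace0.
exact: null_traceD.
Qed.

(** Approximants in a common block have a commutator of trace exactly 0 on all later blocks;
    contractivity of [ntrace] bounds the remainder. *)
Lemma null_commutator x y : uhf x -> uhf y -> null_trace (cmul x y - cmul y x).
Proof.
move=> /approx_tends[u Bu ux] /approx_tends[v Bv vy] eps e0.
have t : tends (fun n => -1 *: cmul (v n) (u n) + cmul (u n) (v n)) (-1 *: cmul y x + cmul x y).
  by apply: tendsZD; exact: tendsM.
have [N /(_ N (leqnn N)) HN] := t _ e0.
have [m [mu mv]] := blocks_common (Bu N) (Bv N).
exists m => n mn.
have sub x' : csub_carrier (block (d m)) x' -> csub_carrier (block (d n)) x'.
  by apply: block_sub; [exact: dim_gt0|exact: dim_dvd].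
have h0 : ntrace (d n) (-1 *: cmul (v N) (u N) + cmul (u N) (v N)) = 0.
  by rewrite ntraceZD mulN1r (ntrace_comm (sub _ mu) (sub _ mv)) addNr.
have -> : cmul x y - cmul y x = -1 *: cmul y x + cmul x y by rewrite scaleN1r addrC.
rewrite -[ntrace _ _]subr0 -h0 -ntraceB.
by apply: le_lt_trans (ntrace_le _ (dim_gt0 _ _ _)) _; rewrite rnormB.
Qed.

(** A nearby block element is corrected to an idempotent [p] of the block, which is similar to [q]
    inside [uhf]. Its trace is its rank over [d m], on every later block as well. Rank 0 would give
    [|q| <= 2/5], whereas a nonzero projection has norm 1. *)
Lemma uhf_projection q : uhf q -> cmul q q = q -> cadj q = q ->
  exists m c p, [/\ forall n, (m <= n)%N -> ntrace (d n) p = c%:R / (d m)%:R,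
    null_trace (q - p) & c = 0%N -> q = 0].
Proof.
move=> Uq qq qa.
have [|x [m _ Bx] xq] := Uq 100^-1; first by rewrite invr_gt0.
have dm0 := dim_gt0 g k m.
have [p Bp [pp pq]] : exists2 p, csub_carrier (block (d m)) p &
    cmul p p = p /\ rnorm (p - q) <= 2 / 5.
  have xq' : rnorm (x - q) <= 100^-1 by rewrite rnormB; exact: ltW.
  exact: (idempotent_near (csub_subproof (block (d m))) (block_cunit dm0) Bx
    (@block_unit _) cunit_adj qq qa xq').
have Up : uhf p by exact: block_uhf Bp.
have [w [v [Uw Uv wv vw qw]]] : exists w v,
    [/\ uhf w, uhf v, cmul w v = cunit, cmul v w = cunit & cmul q w = cmul w p].
  have Uz : uhf cunit by apply: (@block_uhf m); exact: block_cunit.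
  exact: (close_idempotents_similar uhf_subalg Uz uhf_unit Up Uq pp qq pq).
have [c cE c0] := ntrace_idempotent Bp pp.
exists m, c, p; split.
- by move=> n /dim_mul[a a0 ->]; rewrite ntrace_block.
- (* [q] and [p] are similar, so their difference is a commutator. *)
  have -> : q - p = cmul (cmul w p) v - cmul v (cmul w p).
    rewrite -{1}qw -[cmul (cmul q w) v]cmulA wv cmulA vw.
    by have [_ ->] := uhf_unit Uq; have [-> _] := uhf_unit Up.
  exact: (null_commutator (csubM uhf_subalg Uw Up) Uv).
- move=> /c0 p0; have [//|q1] := projection_norm qq qa.
  by exfalso; move: pq; rewrite p0 sub0r rnormN q1; lra.
Qed.

Lemma cunit_central x : csub_carrier (alg e_on g) x -> cmul cunit x = cmul x cunit.
Proof.
have S : is_cstar_subalg [set x | cmul cunit x = cmul x cunit].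
  split=> /=.
  - by move=> a y z hy hz; rewrite cmulDl cmulDr cmulZl cmulZr hy hz.
  - by rewrite cmul0l cmul0r.
  - by move=> y z hy hz; rewrite cmulA hy -cmulA hz cmulA.
  - by move=> y /(congr1 (@cadj _ _)); rewrite !cadjM cunit_adj => ->.
  - have -> : [set x | cmul cunit x = cmul x cunit] = [set x | cmul x cunit = cmul cunit x].
      by apply/seteqP; split=> y /=.
    exact: commutant_closed.
move: x; apply: alg_ind S _ _ => [n|k' n a b aD bD] /=.
  by rewrite munit_tail tail_munit.
have [->|kk] := eqVneq k' k; first by rewrite cunit_munit munit_cunit.
by rewrite !munit_mul0// eq_sym.
Qed.

Lemma cunit_uhf x : csub_carrier (alg e_on g) x -> uhf (cmul cunit x).
Proof.
have cl : closed [set x | uhf (cmul cunit x)].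
  apply: (@preimage_closed _ _ _ _ (rnorm cunit)) => [|y z|y|].
  - exact: rnorm_ge0.
  - exact: cmulBr.
  - exact: rnormM.
  - exact: csub_closed uhf_subalg.
move=> /alg_dense ax; apply: (closed_approx cl) => eps /ax[y [n _ Sy] xy].
exists y; last exact: xy.
change (uhf (cmul cunit y)); move: y Sy {xy}; have [UZD U0 _ _ _] := uhf_subalg.
apply: frame_span_ind => [a y z hy hz||].
- by rewrite cmulDr cmulZr; exact: UZD.
- by rewrite cmul0r.
move=> [[k' [a b]]|] /=.
  rewrite level_seq_Some => /and3P[kn aD bD].
  have [kk|kk] := eqVneq k' k; last by rewrite munit_mul0// eq_sym.
  subst k'.
  rewrite cunit_munit; apply: (@block_uhf n); apply: block_munit_dvd => //.
  exact: dim_gt0.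
move=> _; rewrite munit_tail; case: ifP => _; last exact: U0.
by apply: (@block_uhf 0); exact/block_cunit/dim_gt0.
Qed.

End Blocks.

(** * Obstructions to embeddings *)

Section NonEmbedding.
Variables (R : realType) (H : hilbertType R) (e : nat -> H).
Hypothesis e_on : orthonormal_seq e.
Variables (f g : nat -> nat).
Local Notation munit := (munit e_on).
Local Notation Af := (csub_type (alg e_on f)).
Local Notation Ag := (csub_type (alg e_on g)).
Variable psi : Af -> Ag.
Hypothesis psi_mono : star_mono psi.

Let psi_hom : star_hom psi. Proof. by case: psi_mono. Qed.

(** The component of [psi] in the [k]-th summand, multiplicative because [cunit e_on k] is a central
    projection for [alg e_on g]. *)
Definition cut k (x : Af) : 'B(H) := cmul (cunit e_on k) (csub_val (psi x)).

Let psi_central k x :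
  cmul (cunit e_on k) (csub_val (psi x)) = cmul (csub_val (psi x)) (cunit e_on k).
Proof. exact/cunit_central/set_mem/(csub_valP (psi x)). Qed.

Lemma cut_uhf k x : uhf e_on k g (cut k x).
Proof. exact/cunit_uhf/set_mem/(csub_valP (psi x)). Qed.

Lemma cutD k x y : cut k (x + y) = cut k x + cut k y.
Proof. by rewrite /cut (star_homD psi_hom) -cmulDr. Qed.

Lemma cut0 k : cut k 0 = 0.
Proof. by rewrite /cut (star_hom0 psi_hom) [csub_val 0]/(0 : 'B(H)) cmul0r. Qed.

Lemma cutM k x y : cut k (cmul x y) = cmul (cut k x) (cut k y).
Proof.
rewrite /cut (star_homM psi_hom).
rewrite -[csub_val (cmul _ _)]/(cmul (csub_val (psi x)) (csub_val (psi y))).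
by rewrite -[RHS]cmulA (cmulA (csub_val (psi x))) -psi_central !cmulA cunit_idem.
Qed.

Lemma cut_adj k x : cut k (cadj x) = cadj (cut k x).
Proof.
rewrite /cut (star_hom_adj psi_hom) -[csub_val (cadj _)]/(cadj (csub_val (psi x))).
by rewrite -{1}(cunit_adj e_on k) -cadjM psi_central.
Qed.

Lemma cut_neq0 x : x != 0 -> exists k, cut k x <> 0.
Proof.
move=> x0; apply: contrapT => nk; move/eqP: x0; apply.
have [_ psi_inj] := psi_mono; apply: psi_inj; rewrite (star_hom0 psi_hom).
apply: (val_inj : injective (@csub_val R 'B(H) (alg e_on g))).
apply: (@corner_coef _ _ e).
- exact/alg_corner/set_mem/(csub_valP (psi x)).
- exact: csub0 (corner_subalg e).
move=> [k t] q; rewrite [RHS]coef0 /coef.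
(* Coefficients in the row [(k, t)] see only the component [k]: the ket is fixed by [cunit e_on k],
   which moves across the inner product. *)
have -> : ket e (k, t) = adjoint (cunit e_on k) (ket e (k, t)).
  rewrite (cunit_adj e_on k : adjoint _ = _) /cunit munit_ket eqxx modn1 /=.
  by rewrite subn0 addn0.
rewrite -adjointP.
have ck : cut k x = 0 by apply: contrapT => ck; apply: nk; exists k.
have -> : cunit e_on k (csub_val (psi x) (ket e q)) = cut k x (ket e q) by [].
by rewrite ck linear0l.
Qed.

Definition alg_unit0 n a b (aD : (a < dim f 0 n)%N) (bD : (b < dim f 0 n)%N) : Af :=
  CsubType (mem_set (@alg_munit _ _ _ e_on f 0 n a b aD bD)).

Let D n := dim f 0 n.
(** The first column of matrix units: partial isometries with common source [q0 n], whose ranges add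
    up to the unit of the component 0. That unit is [q0 0], since [dim f 0 0] is an empty
    product. *)
Let u n (a : 'I_(D n)) : Af := alg_unit0 (ltn_ord a) (dim_gt0 f 0 n).
Let q0 n : Af := alg_unit0 (dim_gt0 f 0 n) (dim_gt0 f 0 n).

Let u_adj_mul n a : cmul (cadj (u (n := n) a)) (u a) = q0 n.
Proof.
apply/val_inj; rewrite /= munit_adj ?dim_gt0 ?ltn_ord//.
by rewrite munit_mul ?ltn_ord// eqxx.
Qed.

Let u_sum n : \sum_(a < D n) cmul (u a) (cadj (u a)) = q0 0.
Proof.
apply: (val_inj : injective (@csub_val R 'B(H) (alg e_on f))).
rewrite (big_morph (@csub_val R 'B(H) (alg e_on f)) (id1 := 0) (op1 := +%R))//=.
have -> : dim f 0 0 = 1%N by rewrite /dim big_ord0.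
rewrite (munit_split _ _ (ltnSn 0) (dim_gt0 f 0 n))//; apply: eq_bigr => a _.
rewrite mul1n muln1 addn0 munit_adj ?dim_gt0 ?ltn_ord//.
rewrite munit_mul ?ltn_ord ?dim_gt0// eqxx.
Qed.

Let q0_adj n : cadj (q0 n) = q0 n.
Proof. by apply/val_inj; rewrite /= munit_adj ?dim_gt0. Qed.

Let q0_idem n : cmul (q0 n) (q0 n) = q0 n.
Proof. by apply/val_inj; rewrite /= munit_mul ?dim_gt0// eqxx. Qed.

Lemma embedding_le : Defs.le_inf f g.
Proof.
have [|k qk] := @cut_neq0 (q0 0).
  apply/eqP => /(congr1 (@csub_val R 'B(H) (alg e_on f))).
  move=> /(congr1 (fun T => coef e T (0, 0)%N (0, 0)%N)).
  rewrite [RHS]coef0 /= munit_coef !eqxx mod0n /=.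
  by move=> /eqP; rewrite oner_eq0.
have proj n : exists m c p, [/\
    forall i, (m <= i)%N -> ntrace e k (dim g k i) p = c%:R / (dim g k m)%:R,
    null_trace e k g (cut k (q0 n) - p) & c = 0%N -> cut k (q0 n) = 0].
  apply: (@uhf_projection _ _ _ e_on); first exact: cut_uhf.
    by rewrite -cutM q0_idem.
  by rewrite -cut_adj q0_adj.
have [m [c [p [pE pq c0]]]] := proj 0%N.
have cp : (0 < c)%N by rewrite lt0n; apply/eqP => /c0.
(* Both [k] and [c] come from [q0 0] alone, before [i] is introduced; hence the bound is uniform. *)
exists (k + c)%N => i.
(* The successor is needed for [dim f 0 i.+1] to include the factor [nprime i ^ f i]. *)
have [m' [c' [p' [p'E pq' _]]]] := proj i.+1.
pose N := dim f 0 i.+1.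
have key : (c * dim g k m' = N * c' * dim g k m)%N.
  have nt : null_trace e k g (\sum_(a < N) p' - p).
    (* Modulo commutators, [cut k (q0 0)] is [N] copies of [cut k (q0 i.+1)]; each projection is
       then traded for its idempotent in a block. *)
    have -> : \sum_(a < N) p' - p = (cut k (q0 0) - p)
        - \sum_(a < N) (cmul (cut k (u a)) (cadj (cut k (u a)))
                        - cmul (cadj (cut k (u a))) (cut k (u a)))
        - \sum_(a < N) (cut k (q0 i.+1) - p').
      rewrite -(u_sum i.+1) (big_morph (cut k) (cutD k) (cut0 k)).
      under eq_bigr do rewrite cutM cut_adj.
      rewrite !sumrB.
      under [X in _ = _ - (_ - X) - _]eq_bigr do rewrite -cut_adj -cutM u_adj_mul.
      by lin R[i] ('B(H) : lmodType R[i]).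
    apply: null_traceD; first apply: null_traceD => //.
      apply/null_traceN/null_trace_sum => a; apply: (null_commutator (g := g)).
        exact: cut_uhf.
      by rewrite -cut_adj; exact: cut_uhf.
    by apply/null_traceN/null_trace_sum => a.
  (* Beyond [m] and [m'] the trace is the constant [z], so tending to 0 forces [z = 0]: approximate
     equality of traces becomes an equality of integers. *)
  pose z : R[i] := N%:R * (c'%:R / (dim g k m')%:R) - c%:R / (dim g k m)%:R.
  have trE n : (maxn m m' <= n)%N -> ntrace e k (dim g k n) (\sum_(a < N) p' - p) = z.
    rewrite geq_max => /andP[mn mn'].
    rewrite ntraceB pE// (big_morph _ (ntraceD _ _ _) (ntrace0 _ _ _)).
    rewrite p'E// sumr_const card_ord.
    by congr (_ - _); exact/esym/mulr_natl.
  have z0 : z = 0.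
    apply/eqP; rewrite -normr_le0 normC_Re lecR leNgt; apply/negP => zp.
    have [n0 /(_ (maxn n0 (maxn m m')))] := nt _ zp.
    by rewrite leq_maxl trE ?leq_maxr// => /(_ isT); rewrite ltxx.
  have dn n : ((dim g k n)%:R : R[i]) != 0 by rewrite pnatr_eq0 -lt0n dim_gt0.
  move/eqP: z0; rewrite subr_eq0 mulrA -natrM eqr_div// -!natrM eqr_nat => /eqP h.
  by rewrite h.
have c'p : (0 < c')%N.
  rewrite lt0n; apply/eqP => c'0; move: key; rewrite c'0 muln0 => /eqP.
  by rewrite muln_eq0 !gtn_eqF ?dim_gt0.
have := congr1 (logn (nprime i)) key.
rewrite !lognM ?muln_gt0 ?dim_gt0 ?cp ?c'p// !dim_logn ltnSn addn0.
(* The left side of [key] has valuation at most [logn (nprime i) c + g i + k], the right side at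
   least [f i]; a positive [c] exceeds its valuation. *)
have := ltn_logl (nprime i) cp.
by case: (i < m')%N; case: (i < m)%N; lia.
Qed.

End NonEmbedding.

(** * Borel measurability of the reduction *)

Section Borel.
Variables (R : realType) (H : hilbertType R) (e : nat -> H).
Hypothesis e_on : orthonormal_seq e.

Lemma generator_local j : exists N, forall f f' : nat -> nat,
  (forall i, (i < N)%N -> f i = f' i) -> generator e_on f j = generator e_on f' j.
Proof.
rewrite /generator; case: unpickle => [[n|[[k n] [a b]]]|]; try by exists 0%N.
exists n => f f' ff'.
suff -> : dim f k n = dim f' k n by [].
by apply: eq_bigr => i _; rewrite ff'.
Qed.

Lemma finite_support_open (U : set (nat -> nat)) N :
  (forall f f' : nat -> nat, (forall i, (i < N)%N -> f i = f' i) -> U f -> U f') ->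
  baire_open U.
Proof.
move=> UN; rewrite /baire_open openE => f Uf.
suff : \forall f' \near (f : {ptws nat -> nat}), forall i, (i < N)%N -> f i = f' i.
  by apply: filterS => f' ff'; exact: UN Uf.
elim: N {UN} => [|N IH]; first by apply: filterE => f' i; rewrite ltn0.
have : \forall f' \near (f : {ptws nat -> nat}), f N = f' N.
  have := @proj_continuous nat (fun=> nat) N f [set f N] (discrete_set1 (f N)).
  by apply: filterS => f' /= ->.
move=> h; near=> f' => i; rewrite ltnS leq_eqVlt => /predU1P[->|].
  by near: f'.
by move: i; near: f'.
Unshelve. all: by end_near. Qed.

(** Each coordinate depends on finitely many values of its argument, so it pulls sets of operators
    back to open sets of the Baire space. *)
Lemma generator_borel : borel_map (generator e_on).
Proof.
rewrite /borel_map.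
refine (@measurability _ _ (g_sigma_algebraType baire_open)
  (g_sigma_algebraType (@Gamma_cylinder R H)) setT _ (@Gamma_cylinder R H) erefl _) => _ [B [n _ [S mS <-]] <-].
apply: sub_sigma_algebra; have [N HN] := generator_local n.
apply: (@finite_support_open _ N) => f f' ff' /= [_ [_ Sf]].
by split=> //; split=> //; rewrite /= -(HN f).
Qed.

End Borel.

Theorem theorem1p5 (R : realType) (H : hilbertType R)
    (H_sep : separable H) (H_inf : ~ finite_dim H) :
  exists Phi : (nat -> nat) -> (nat -> 'B(H)),
    [/\ borel_map Phi,
        forall f : nat -> nat, AF (Cstar (Phi f)) /\ unital (Cstar (Phi f))
      & forall f g : nat -> nat, E_Ksigma f g <->
          bi_embeddable (Cstar (Phi f)) (Cstar (Phi g))].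
Proof.
have [e e_on] := orthonormal_exists H_inf.
exists (generator e_on); split=> [|f|f g].
- exact: generator_borel.
- by split; [exact: alg_AF|exact: alg_unital].
- split=> [[fg gf]|[[psi psiP] [phi phiP]]].
    by split; exact: alg_embeds.
  by split; [exact: embedding_le psiP|exact: embedding_le phiP].
Qed.
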